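(* Let $0\le k\le n$. The Ozsváth–Szabó algebra $\mathcal B_l(n,k)$ is a graded flat deformation of the (integral) Sartori algebra $\mathcal A^{\mathbb Z}_{n,k}$ over the polynomial ring $S=\mathbb Z[\varepsilon_1,\dots,\varepsilon_k]$ ($\deg\varepsilon_i=2i$), where $\varepsilon_i$ maps to the central element $e_i(U_1,\dots,U_n)$ (the $i$-th elementary symmetric polynomial). That is, with $j\colon S\to\mathcal B_l(n,k)$, $j(\varepsilon_i)=e_i(U_1,\dots,U_n)$, there is a graded ring homomorphism $\pi\colon \mathcal B_l(n,k)\to\mathcal A^{\mathbb Z}_{n,k}$ inducing an isomorphism from the quotient of $\mathcal B_l(n,k)$ by the two-sided ideal generated by $e_i(U_1,\dots,U_n)$, $1\le i\le k$, to $\mathcal A^{\mathbb Z}_{n,k}$; and $j$ makes $\mathcal B_l(n,k)$ a flat $S$-module.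
   Context: **Ozsváth–Szabó algebra.** Fix integers $n\ge 0$, $0\le k\le n$. An I-state is a subset $\mathbf x\subset\{0,\dots,n\}$; it is a left I-state if $n\notin\mathbf x$. $V(n,k)$ (resp. $V_l(n,k)$) is the set of I-states (resp. left I-states) with $k$ elements, $\mathbf x=\{x_1<\dots<x_k\}$. For $1\le i\le n$ put $v_i^{\mathbf x}=|\mathbf x\cap\{i,\dots,n\}|$. $\mathcal B_0(n,k)$ is the $\mathbb Z[U_1,\dots,U_n]$-algebra which is free as a module on elements $f_{\mathbf x,\mathbf y}$ ($\mathbf x,\mathbf y\in V(n,k)$), with $f_{\mathbf x,\mathbf y}f_{\mathbf y,\mathbf z}=\prod_{i=1}^nU_i^{g_i}f_{\mathbf x,\mathbf z}$, $g_i=\tfrac12(|v_i^{\mathbf y}-v_i^{\mathbf z}|-|v_i^{\mathbf x}-v_i^{\mathbf z}|+|v_i^{\mathbf x}-v_i^{\mathbf y}|)$, and $f_{\mathbf x,\mathbf y}f_{\mathbf w,\mathbf z}=0$ for $\mathbf y\ne\mathbf w$. The $\mathbf I_{\mathbf x}=f_{\mathbf x,\mathbf x}$ are orthogonal idempotents with sum $1$. For $1\le i\le n$, $R_i=\sum f_{\mathbf x,(\mathbf x\setminus\{i-1\})\cup\{i\}}$ over $\mathbf x$ with $\mathbf x\cap\{i-1,i\}=\{i-1\}$, and $L_i=\sum f_{\mathbf x,(\mathbf x\setminus\{i\})\cup\{i-1\}}$ over $\mathbf x$ with $\mathbf x\cap\{i-1,i\}=\{i\}$. $\mathcal B(n,k)$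 is the quotient of $\mathcal B_0(n,k)$ by the two-sided ideal generated by $R_{i-1}R_i$, $L_iL_{i-1}$ ($2\le i\le n$) and $U_i\mathbf I_{\mathbf x}$ ($1\le i\le n$, $\mathbf x\cap\{i-1,i\}=\varnothing$). $\mathcal B_l(n,k)=e\,\mathcal B(n,k)\,e$ with $e=\sum_{\mathbf x\in V_l(n,k)}\mathbf I_{\mathbf x}$. Grading: $\deg U_i=2$, $\deg f_{\mathbf x,\mathbf y}=\sum_i|v_i^{\mathbf x}-v_i^{\mathbf y}|$. $U_i$ also denotes the central element $U_i\cdot 1\in\mathcal B_l(n,k)$. **Integral Sartori algebra.** $R=\mathbb Z[x_1,\dots,x_n]$, $\deg x_i=2$. $D_{n,k}$ is the set of sequences $\mu=\mu_1\cdots\mu_n$ of $k$ symbols $\wedge$ and $n-k$ symbols $\vee$; $\wedge_i^\mu,\vee_j^\mu$ are the positions of the $i$-th $\wedge$ and $j$-th $\vee$. $b_i^\mu$ is $1$ plus the number of $\wedge$'s strictly to the right of position $i$; $\mathbf b^\mu=(b^\mu_1,\dots,b^\mu_n)$. With $h_j$ complete homogeneous symmetric polynomials, $I_{\mathbf b}=\langle h_{b_1}(x_1),h_{b_2}(x_1,x_2),\dots,h_{b_n}(x_1,\dots,x_n)\rangle\subset R$, $R_{\mathbf b}=R/I_{\mathbf b}$. $\lambda,\mu\in D_{n,k}$ are too far if for some $1\le j\le n-k-1$, $\vee_j^\mu\ge\vee_{j+1}^\lambda$ or $\vee_j^\lambda\ge\vee_{j+1}^\mu$. An $R$-map $R_{\mathbf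 b^\lambda}\to R_{\mathbf b^\mu}$ is written $(1\mapsto p)$. $\mathcal W^\alpha_{\lambda,\mu}\subset\mathrm{Hom}_R(R_{\mathbf b^\lambda},R_{\mathbf b^\mu})$ is the whole Hom space if $\lambda,\mu$ are too far, and otherwise the $R$-submodule generated by the maps $1\mapsto (x_{\alpha(j)}x_{\alpha(j)+1}\cdots x_{\beta(j)})(x_1^{c_1}\cdots x_n^{c_n})$, $1\le j\le n-k$, with $c_i=\max(b_i^\mu-b_i^\lambda,0)$, $\alpha(j)=\max(\vee_j^\lambda,\vee_j^\mu)$, $\beta(j)=\min(\vee_{j+1}^\mu,\vee_{j+1}^\lambda)-1$ for $j<n-k$, $\beta(n-k)=n$. Then $\mathcal A^{\mathbb Z}_{n,k}=\bigoplus_{\lambda,\mu\in D_{n,k}}\mathrm{Hom}_R(R_{\mathbf b^\lambda},R_{\mathbf b^\mu})/\mathcal W^\alpha_{\lambda,\mu}$ with product given by composition ($ab=a\circ b$), graded by $\deg(1\mapsto p)=\deg p-\sum_i(b_i^\mu-b_i^\lambda)$ for homogeneous $p$. **Deformations.** For a finitely generated free (graded) $\mathbb Z$-module $U$, a graded deformation of a graded ring $A$ over $U^*$ is a graded ring $\tilde A$ with graded homomorphisms $\mathrm{Sym}(U)\xrightarrow{j}\tilde A\xrightarrow{\pi}A$ such that $\mathrm{im}(j)$ is central and $\pi$ induces an isomorphism from $\tilde A$ modulo the ideal generated by $j(U)$ to $A$; it is flat if $\tilde A$ is a flat $\mathrm{Sym}(U)$-module via $j$. *)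

(* Defs.v *)
From HB Require Import structures.
From mathcomp Require Import all_boot all_order all_algebra.
From mathcomp Require Import mpoly.
From mathcomp Require Import boolp.
From mathcomp Require Import zify ring.

Set Implicit Arguments.
Unset Strict Implicit.
Unset Printing Implicit Defensive.

Import GRing.Theory.
Local Open Scope ring_scope.
Local Open Scope quotient_scope.

(** * Two-sided ideals and quotient rings *)

Definition two_sided_ideal (A : pzRingType) (I : A -> Prop) : Prop :=
  [/\ I 0, forall x y, I x -> I y -> I (x - y),
      forall a x, I x -> I (a * x) & forall a x, I x -> I (x * a)].

Record tsideal (A : pzRingType) := TSIdeal {
  ts_mem :> A -> Prop;
  ts_memP : two_sided_ideal ts_mem }.

Definition ideal_gen (A : pzRingType) (G : A -> Prop) (x : A) : Prop :=
  exists s : seq (A * A * A), (forall t, t \in s -> G t.1.2) /\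
    x = \sum_(t <- s) t.1.1 * t.1.2 * t.2.

Lemma ideal_gen_two_sided (A : pzRingType) (G : A -> Prop) :
  two_sided_ideal (ideal_gen G).
Proof.
split.
- by exists [::]; split=> //; rewrite big_nil.
- move=> x y [s [Gs ->]] [t [Gt ->]].
  exists (s ++ [seq (- u.1.1, u.1.2, u.2) | u <- t]); split.
    move=> u; rewrite mem_cat => /orP[/Gs//|/mapP[v vt ->]]; exact: Gt vt.
  rewrite big_cat big_map /= -sumrN; congr (_ + _).
  by apply: eq_bigr => u _; rewrite !mulNr.
- move=> a x [s [Gs ->]]; exists [seq (a * u.1.1, u.1.2, u.2) | u <- s].
  split; first by move=> u /mapP[v vs ->]; exact: Gs vs.
  by rewrite big_map mulr_sumr; apply: eq_bigr => u _; rewrite !mulrA.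
- move=> a x [s [Gs ->]]; exists [seq (u.1.1, u.1.2, u.2 * a) | u <- s].
  split; first by move=> u /mapP[v vs ->]; exact: Gs vs.
  by rewrite big_map mulr_suml; apply: eq_bigr => u _; rewrite !mulrA.
Qed.

Definition idealG (A : pzRingType) (G : A -> Prop) : tsideal A :=
  TSIdeal (ideal_gen_two_sided G).

Definition ts_bool (A : pzRingType) (I : tsideal A) : A -> bool :=
  fun x => `[< I x >].

Lemma ts_zmod_closed (A : pzRingType) (I : tsideal A) :
  zmod_closed (ts_bool I).
Proof.
have [I0 IB _ _] := ts_memP I; split; first exact/asboolP.
by move=> x y /asboolP Ix /asboolP Iy; apply/asboolP/IB.
Qed.

HB.instance Definition _ (A : pzRingType) (I : tsideal A) :=
  GRing.isZmodClosed.Build A (ts_bool I) (ts_zmod_closed I).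

Definition ts_closed (A : pzRingType) (I : tsideal A) : zmodClosed A :=
  GRing.ZmodClosed.clone A (ts_bool I) _.

Definition qring (A : pzRingType) (I : tsideal A) : Type := Quotient.quot (ts_closed I).

HB.instance Definition _ (A : pzRingType) (I : tsideal A) :=
  GRing.Zmodule.on (qring I).

Definition qpi (A : pzRingType) (I : tsideal A) (x : A) : qring I :=
  \pi_(Quotient.quot (ts_closed I)) x.

Section QuotientRing.
Variables (A : pzRingType) (I : tsideal A).
Local Notation Q := (qring I).

Lemma qpi_eq (x y : A) : qpi I x = qpi I y <-> I (x - y).
Proof.
rewrite /qpi; split.
  by move/eqP; rewrite -Quotient.idealrBE => /asboolP.
by move=> Ixy; apply/eqP; rewrite -Quotient.idealrBE; apply/asboolP.
Qed.

Lemma qpi_surj (q : Q) : exists x, q = qpi I x.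
Proof. by exists (repr (q : Quotient.quot (ts_closed I))); rewrite /qpi reprK. Qed.

Lemma qpiB : zmod_morphism (qpi I).
Proof. by move=> x y; rewrite /qpi raddfB. Qed.

HB.instance Definition _ := GRing.isZmodMorphism.Build A Q (qpi I) qpiB.

Definition qone : Q := qpi I 1.
Definition qmul (p q : Q) : Q :=
  qpi I (repr (p : Quotient.quot (ts_closed I)) * repr (q : Quotient.quot (ts_closed I))).

Lemma qmulE x y : qmul (qpi I x) (qpi I y) = qpi I (x * y).
Proof.
apply/qpi_eq.
have rE z : I (repr (qpi I z : Quotient.quot (ts_closed I)) - z).
  by apply/qpi_eq; rewrite /qpi reprK.
set a := repr _; set b := repr _.
have -> : a * b - x * y = a * (b - y) + (a - x) * y.
  by rewrite mulrBr mulrBl addrA subrK.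
have [I0 IB IL IR] := ts_memP I.
have ID u v : I u -> I v -> I (u + v).
  by move=> Iu Iv; rewrite -[v]opprK -[- v]sub0r; exact: (IB _ _ Iu (IB _ _ I0 Iv)).
by apply: ID; [exact/IL/rE|exact/IR/rE].
Qed.

Lemma qmulA : associative qmul.
Proof.
move=> p q r; have [x ->] := qpi_surj p; have [y ->] := qpi_surj q.
by have [z ->] := qpi_surj r; rewrite !qmulE mulrA.
Qed.
Lemma qmul1 : left_id qone qmul.
Proof. by move=> p; have [x ->] := qpi_surj p; rewrite qmulE mul1r. Qed.
Lemma qmulr1 : right_id qone qmul.
Proof. by move=> p; have [x ->] := qpi_surj p; rewrite qmulE mulr1. Qed.
Lemma qmulDl : left_distributive qmul +%R.
Proof.
move=> p q r; have [x ->] := qpi_surj p; have [y ->] := qpi_surj q.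
by have [z ->] := qpi_surj r; rewrite -raddfD !qmulE mulrDl raddfD.
Qed.
Lemma qmulDr : right_distributive qmul +%R.
Proof.
move=> p q r; have [x ->] := qpi_surj p; have [y ->] := qpi_surj q.
by have [z ->] := qpi_surj r; rewrite -raddfD !qmulE mulrDr raddfD.
Qed.

HB.instance Definition _ :=
  GRing.Zmodule_isPzRing.Build Q qmulA qmul1 qmulr1 qmulDl qmulDr.

Lemma qpi_monoid_morphism : monoid_morphism (qpi I).
Proof. by split=> [|x y] //; rewrite -qmulE. Qed.

HB.instance Definition _ :=
  GRing.isMonoidMorphism.Build A Q (qpi I) qpi_monoid_morphism.

Definition qscale (a : A) (q : Q) : Q := qpi I a * q.

Lemma qscaleA a b q : qscale a (qscale b q) = qscale (a * b) q.
Proof. by rewrite /qscale mulrA rmorphM. Qed.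
Lemma qscale1 : left_id 1 qscale.
Proof. by move=> q; rewrite /qscale rmorph1 mul1r. Qed.
Lemma qscaleDr : right_distributive qscale +%R.
Proof. by move=> a p q; rewrite /qscale mulrDr. Qed.
Lemma qscaleDl q : {morph qscale^~ q : a b / a + b}.
Proof. by move=> a b; rewrite /qscale rmorphD mulrDl. Qed.

HB.instance Definition _ :=
  GRing.Zmodule_isLmodule.Build A Q qscaleA qscale1 qscaleDr qscaleDl.

End QuotientRing.

(** * Corner rings *)

Record idempotent (A : pzRingType) := Idempotent {
  idem_val :> A;
  idemP : idem_val * idem_val = idem_val }.

Section Corner.
Variables (A : pzRingType) (E : idempotent A).
Local Notation e := (idem_val E).

Definition in_corner (x : A) : bool := `[< exists a, x = e * a * e >].

Record corner : Type := Corner { cval : A; cvalP : in_corner cval }.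

HB.instance Definition _ := [isSub for cval].
HB.instance Definition _ := [Choice of corner by <:].

Lemma in_cornerP x : in_corner x -> e * x = x /\ x * e = x.
Proof.
move=> /asboolP[a ->]; split; first by rewrite !mulrA idemP.
by rewrite -mulrA idemP.
Qed.

Lemma corner_zmod_closed : zmod_closed in_corner.
Proof.
split; first by apply/asboolP; exists 0; rewrite mulr0 mul0r.
move=> x y /asboolP[a ->] /asboolP[b ->]; apply/asboolP.
by exists (a - b); rewrite mulrBr mulrBl.
Qed.

HB.instance Definition _ := GRing.isZmodClosed.Build A in_corner corner_zmod_closed.
HB.instance Definition _ := [SubChoice_isSubZmodule of corner by <:].

Lemma in_corner1 : in_corner e.
Proof. by apply/asboolP; exists e; rewrite !idemP. Qed.

Lemma in_cornerM (x y : corner) : in_corner (cval x * cval y).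
Proof.
have [ex _] := in_cornerP (cvalP x); have [_ ye] := in_cornerP (cvalP y).
by apply/asboolP; exists (cval x * cval y); rewrite mulrA ex -mulrA ye.
Qed.

Lemma in_corner_proj x : in_corner (e * x * e).
Proof. by apply/asboolP; exists x. Qed.

Definition cone : corner := Corner in_corner1.
Definition cmul (x y : corner) : corner := Corner (in_cornerM x y).
Definition cproj (x : A) : corner := Corner (in_corner_proj x).

Lemma cmulA : associative cmul.
Proof. by move=> x y z; apply: val_inj; rewrite /= mulrA. Qed.
Lemma cmul1 : left_id cone cmul.
Proof. by move=> x; apply: val_inj; case: (in_cornerP (cvalP x)). Qed.
Lemma cmulr1 : right_id cone cmul.
Proof. by move=> x; apply: val_inj; case: (in_cornerP (cvalP x)). Qed.
Lemma cmulDl : left_distributive cmul +%R.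
Proof. by move=> x y z; apply: val_inj; rewrite /= mulrDl. Qed.
Lemma cmulDr : right_distributive cmul +%R.
Proof. by move=> x y z; apply: val_inj; rewrite /= mulrDr. Qed.

HB.instance Definition _ :=
  GRing.Zmodule_isPzRing.Build corner cmulA cmul1 cmulr1 cmulDl cmulDr.

End Corner.

(** * Graded rings, flatness, deformations *)

(* [H d] is the set of homogeneous elements of degree d. *)
Record grading (A : pzRingType) (H : int -> A -> Prop) : Prop := Grading {
  grading0 : forall d, H d 0;
  gradingB : forall d x y, H d x -> H d y -> H d (x - y);
  grading1 : H 0 1;
  gradingM : forall c d x y, H c x -> H d y -> H (c + d) (x * y);
  grading_span : forall x, exists (s : seq int) (a : int -> A),
    (forall d, H d (a d)) /\ x = \sum_(d <- s) a d;
  grading_direct : forall (s : seq int) (a : int -> A), uniq s ->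
    (forall d, H d (a d)) -> \sum_(d <- s) a d = 0 ->
    forall d, d \in s -> a d = 0 }.

Definition graded_hom (A B : pzRingType) (HA : int -> A -> Prop)
  (HY : int -> B -> Prop) (f : A -> B) : Prop :=
  forall d x, HA d x -> HY d (f x).

Definition image_grading (A B : pzRingType) (f : A -> B)
  (H : int -> A -> Prop) (d : int) (y : B) : Prop :=
  exists2 x, H d x & y = f x.

(* The grading of Z[X_0, ..., X_(k-1)] with X_i in degree w i. *)
Definition weight_grading (k : nat) (w : 'I_k -> nat) (d : int)
  (p : {mpoly int[k]}) : Prop :=
  forall m, m \in msupp p -> (\sum_(i < k) w i * m i)%N%:Z = d.

Definition balanced (S : pzRingType) (M N : lmodType S) (P : zmodType)
  (beta : M -> N -> P) : Prop :=
  [/\ forall m m' x, beta (m + m') x = beta m x + beta m' x,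
      forall m x x', beta m (x + x') = beta m x + beta m x'
    & forall s m x, beta (s *: m) x = beta m (s *: x)].

(* By the universal property of M (x)_S N, the sum of the elementary tensors
   p.1 (x) p.2 for p in t vanishes iff its image under every balanced map
   does.  Every element of M (x)_S N is such a sum. *)
Definition tensor_zero (S : pzRingType) (M N : lmodType S)
  (t : seq (M * N)) : Prop :=
  forall (P : zmodType) (beta : M -> N -> P), balanced beta ->
    \sum_(p <- t) beta p.1 p.2 = 0.

(* For S commutative: M (x)_S - preserves injectivity of linear maps. *)
Definition flat (S : comNzRingType) (M : lmodType S) : Prop :=
  forall (N N' : lmodType S) (f : {linear N -> N'}), injective f ->
  forall t : seq (M * N),
    tensor_zero [seq (p.1, f p.2) | p <- t] -> tensor_zero t.

(* A ring A seen as an S-module through j : S -> A. *)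
Definition via (S A : pzRingType) (j : {rmorphism S -> A}) : Type := A.

Section Via.
Variables (S A : pzRingType) (j : {rmorphism S -> A}).

HB.instance Definition _ := GRing.Zmodule.copy (via j) A.

Definition via_scale (s : S) (a : via j) : via j := j s * (a : A).

Lemma via_scaleA a b q : via_scale a (via_scale b q) = via_scale (a * b) q.
Proof. by rewrite /via_scale mulrA rmorphM. Qed.
Lemma via_scale1 : left_id 1 via_scale.
Proof. by move=> q; rewrite /via_scale rmorph1 mul1r. Qed.
Lemma via_scaleDr : right_distributive via_scale +%R.
Proof. by move=> a p q; rewrite /via_scale [LHS]mulrDr. Qed.
Lemma via_scaleDl q : {morph via_scale^~ q : a b / a + b}.
Proof. by move=> a b; rewrite /via_scale rmorphD [LHS]mulrDl. Qed.

HB.instance Definition _ := GRing.Zmodule_isLmodule.Build S (via j)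
  via_scaleA via_scale1 via_scaleDr via_scaleDl.
End Via.

(* Here U is the free graded module on X_0, ..., X_(k-1), with X_i of degree
   w i, so that Sym(U) is the weighted polynomial ring. *)
Record graded_deformation (k : nat) (w : 'I_k -> nat)
    (At : pzRingType) (HAt : int -> At -> Prop)
    (A : pzRingType) (HA : int -> A -> Prop)
    (j : {rmorphism {mpoly int[k]} -> At}) (pi : {rmorphism At -> A}) : Prop :=
  GradedDeformation {
    def_grading_total : grading HAt;
    def_grading_base : grading HA;
    def_j_graded : graded_hom (weight_grading w) HAt j;
    def_pi_graded : graded_hom HAt HA pi;
    def_central : forall s a, j s * a = a * j s;
    def_surj : forall y, exists x, pi x = y;
    def_ker : forall x,
      pi x = 0 <-> ideal_gen (fun a => exists i : 'I_k, a = j 'X_i) x }.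

(** * The Ozsvath-Szabo algebra *)

Section OzsvathSzabo.
Variables n k : nat.
Local Notation ZU := {mpoly int[n]}.

Definition istate : predArgType := {x : {set 'I_n.+1} | #|x| == k}.

Definition left_istate (x : istate) : bool := ord_max \notin val x.

(* The index i : 'I_n stands for i.+1 in 1..n; lo i and hi i are the
   corresponding elements i and i.+1 of 0..n. *)
Definition lo (i : 'I_n) : 'I_n.+1 := widen_ord (leqnSn n) i.
Definition hi (i : 'I_n) : 'I_n.+1 := lift ord0 i.

Definition vcount (x : istate) (i : 'I_n) : nat :=
  #|[set j in val x | (hi i <= j)%N]|.

(* The subtraction and the halving are exact. *)
Definition gexp (x y z : istate) : 'X_{1..n} :=
  [multinom (`|vcount y i - vcount z i| + `|vcount x i - vcount y i|
             - `|vcount x i - vcount z i|)./2 | i < n]%N.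

(* A record rather than an alias of the type of finite functions, which already
   carries the pointwise product.  [bcoef a (x, y)] is the coefficient of f_xy. *)
Record B0 : Type := MkB0 { bcoef : {ffun istate * istate -> ZU} }.

HB.instance Definition _ := [isNew for bcoef].
HB.instance Definition _ := [Choice of B0 by <:].

Definition mkB0 (F : istate * istate -> ZU) : B0 := MkB0 [ffun u => F u].

Lemma mkB0E F u : bcoef (mkB0 F) u = F u.
Proof. exact: ffunE. Qed.
Lemma B0P (a b : B0) : bcoef a =1 bcoef b -> a = b.
Proof. by move=> ab; apply: val_inj; apply/ffunP. Qed.

Definition B0add (a b : B0) : B0 := mkB0 (fun u => bcoef a u + bcoef b u).
Definition B0opp (a : B0) : B0 := mkB0 (fun u => - bcoef a u).
Definition B0zero : B0 := mkB0 (fun=> 0).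

Lemma B0addA : associative B0add.
Proof. by move=> a b c; apply: B0P => u; rewrite !mkB0E addrA. Qed.
Lemma B0addC : commutative B0add.
Proof. by move=> a b; apply: B0P => u; rewrite !mkB0E addrC. Qed.
Lemma B0add0 : left_id B0zero B0add.
Proof. by move=> a; apply: B0P => u; rewrite !mkB0E add0r. Qed.
Lemma B0addN : left_inverse B0zero B0opp B0add.
Proof. by move=> a; apply: B0P => u; rewrite !mkB0E addNr. Qed.

HB.instance Definition _ :=
  GRing.isZmodule.Build B0 B0addA B0addC B0add0 B0addN.

Lemma bcoef0 u : bcoef 0 u = 0. Proof. exact: mkB0E. Qed.
Lemma bcoefD (a b : B0) u : bcoef (a + b) u = bcoef a u + bcoef b u.
Proof. exact: mkB0E. Qed.

End OzsvathSzabo.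

HB.lock Definition fbasis (n k : nat) (x y : istate n k) : B0 n k :=
  mkB0 (fun u => (u == (x, y))%:R).

Section OzsvathSzaboRing.
Variables n k : nat.
Local Notation ZU := {mpoly int[n]}.
Local Notation istate := (istate n k).
Local Notation B0 := (B0 n k).

Lemma fbasisE (x y u v : istate) :
  bcoef (fbasis x y) (u, v) = ((u == x) && (v == y))%:R.
Proof. by rewrite fbasis.unlock; exact: mkB0E. Qed.

Definition B0mul (a b : B0) : B0 :=
  mkB0 (fun u => \sum_y 'X_[gexp u.1 y u.2]
                        * (bcoef a (u.1, y) * bcoef b (y, u.2))).
Definition B0one : B0 := mkB0 (fun u => (u.1 == u.2)%:R).
Definition B0scale (p : ZU) (a : B0) : B0 := mkB0 (fun u => p * bcoef a u).

Lemma gexp_double (x y z : istate) i :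
  ((gexp x y z i).*2 + `|vcount x i - vcount z i|
   = `|vcount y i - vcount z i| + `|vcount x i - vcount y i|)%N.
Proof. by rewrite mnmE; move: (vcount x i) (vcount y i) (vcount z i); lia. Qed.

Lemma gexp_cocycle (x y z w : istate) :
  (gexp x y z + gexp x z w = gexp y z w + gexp x y w)%MM.
Proof.
apply/mnmP => i; rewrite !mnmDE.
have := gexp_double x y z i; have := gexp_double x z w i.
have := gexp_double y z w i; have := gexp_double x y w i.
lia.
Qed.

Lemma gexp_xxy (x y : istate) : gexp x x y = 0%MM.
Proof. by apply/mnmP => i; have := gexp_double x x y i; rewrite mnm0E; lia. Qed.
Lemma gexp_xyy (x y : istate) : gexp x y y = 0%MM.
Proof. by apply/mnmP => i; have := gexp_double x y y i; rewrite mnm0E; lia. Qed.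

Lemma B0mulA : associative B0mul.
Proof.
move=> a b c; apply: B0P => -[x w]; rewrite !mkB0E /=.
under eq_bigr => y _ do rewrite mkB0E /= !mulr_sumr.
under [RHS]eq_bigr => z _ do rewrite mkB0E /= !(mulr_suml, mulr_sumr).
rewrite exchange_big /=; apply: eq_bigr => z _; apply: eq_bigr => y _.
have E : 'X_[gexp x y z] * 'X_[gexp x z w]
       = 'X_[gexp y z w] * 'X_[gexp x y w] :> ZU.
  by rewrite -!mpolyXD gexp_cocycle.
transitivity (('X_[gexp y z w] * 'X_[gexp x y w])
  * (bcoef a (x, y) * bcoef b (y, z) * bcoef c (z, w)) : ZU); first by ring.
by rewrite -E; ring.
Qed.

Lemma B0mul1 : left_id B0one B0mul.
Proof.
move=> a; apply: B0P => -[x y]; rewrite mkB0E /= (bigD1 x) //= mkB0E eqxx.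
rewrite gexp_xxy mpolyX0 !mul1r big1 ?addr0 // => z zx.
by rewrite mkB0E /= eq_sym (negPf zx) mul0r mulr0.
Qed.

Lemma B0mulr1 : right_id B0one B0mul.
Proof.
move=> a; apply: B0P => -[x y]; rewrite mkB0E /= (bigD1 y) //= mkB0E eqxx.
rewrite gexp_xyy mpolyX0 mulr1 !mul1r big1 ?addr0 // => z zx.
by rewrite mkB0E /= (negPf zx) !mulr0.
Qed.

Lemma B0mulDl : left_distributive B0mul +%R.
Proof.
move=> a b c; apply: B0P => u; rewrite bcoefD !mkB0E -big_split /=.
by apply: eq_bigr => y _; rewrite bcoefD; ring.
Qed.

Lemma B0mulDr : right_distributive B0mul +%R.
Proof.
move=> a b c; apply: B0P => u; rewrite bcoefD !mkB0E -big_split /=.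
by apply: eq_bigr => y _; rewrite bcoefD; ring.
Qed.

HB.instance Definition _ :=
  GRing.Zmodule_isPzRing.Build B0 B0mulA B0mul1 B0mulr1 B0mulDl B0mulDr.

Lemma B0scaleA a b q : B0scale a (B0scale b q) = B0scale (a * b) q.
Proof. by apply: B0P => u; rewrite !mkB0E mulrA. Qed.
Lemma B0scale1 : left_id 1 B0scale.
Proof. by move=> q; apply: B0P => u; rewrite !mkB0E mul1r. Qed.
Lemma B0scaleDr : right_distributive B0scale +%R.
Proof. by move=> a p q; apply: B0P => u; rewrite !(bcoefD, mkB0E) mulrDr. Qed.
Lemma B0scaleDl q : {morph B0scale^~ q : a b / a + b}.
Proof. by move=> a b; apply: B0P => u; rewrite !(bcoefD, mkB0E) mulrDl. Qed.

HB.instance Definition _ := GRing.Zmodule_isLmodule.Build ZU B0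
  B0scaleA B0scale1 B0scaleDr B0scaleDl.

Lemma B0scaleAl (p : ZU) (a b : B0) : p *: (a * b) = (p *: a) * b.
Proof.
apply: B0P => u; rewrite !mkB0E mulr_sumr; apply: eq_bigr => y _.
by rewrite !mkB0E; ring.
Qed.

Lemma B0scaleAr (p : ZU) (a b : B0) : p *: (a * b) = a * (p *: b).
Proof.
apply: B0P => u; rewrite !mkB0E mulr_sumr; apply: eq_bigr => y _.
by rewrite !mkB0E; ring.
Qed.

Lemma bcoefZ p (a : B0) u : bcoef (p *: a) u = p * bcoef a u.
Proof. exact: mkB0E. Qed.

Lemma bcoefM (a b : B0) x z : bcoef (a * b) (x, z) =
  \sum_y 'X_[gexp x y z] * (bcoef a (x, y) * bcoef b (y, z)).
Proof. exact: mkB0E. Qed.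

Lemma fbasisM x y z : fbasis x y * fbasis y z = 'X_[gexp x y z] *: fbasis x z.
Proof.
apply: B0P => -[u v]; rewrite bcoefM bcoefZ fbasisE (bigD1 y) //= big1.
  rewrite addr0 !fbasisE eqxx andbT.
  case: (u =P x) => [->|_] /=; last by rewrite mul0r !mulr0.
  by case: (v =P z) => [->|_] /=; rewrite ?mul1r ?mulr0.
by move=> w wy; rewrite fbasisE (negPf wy) andbF mul0r mulr0.
Qed.

Lemma fbasisM0 x y w z : y != w -> fbasis x y * fbasis w z = 0.
Proof.
move=> yw; apply: B0P => -[u v]; rewrite bcoefM bcoef0 big1 // => t _.
rewrite !fbasisE; case: (t =P y) => [->|_].
  by rewrite (negPf yw) !mulr0.
by rewrite andbF mul0r mulr0.
Qed.

Lemma fbasis_sum1 : (1 : B0) = \sum_x fbasis x x.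
Proof.
apply: B0P => -[u v]; rewrite [LHS]mkB0E.
rewrite (big_morph (fun a => bcoef a (u, v)) (fun a b => bcoefD a b _) (bcoef0 _)).
rewrite (bigD1 u) //= (fbasisE u u) eqxx big1 ?addr0 /= 1?eq_sym // => x xu.
by rewrite (fbasisE x x) eq_sym (negPf xu).
Qed.

Definition Rgen (i : 'I_n) : B0 :=
  \sum_(p : istate * istate | [&& lo i \in val p.1, hi i \notin val p.1 &
          val p.2 == hi i |: (val p.1 :\ lo i)]) fbasis p.1 p.2.

Definition Lgen (i : 'I_n) : B0 :=
  \sum_(p : istate * istate | [&& hi i \in val p.1, lo i \notin val p.1 &
          val p.2 == lo i |: (val p.1 :\ hi i)]) fbasis p.1 p.2.

Inductive OSrel : B0 -> Prop :=
| OSrel_RR (i j : 'I_n) : j = i.+1 :> nat -> OSrel (Rgen i * Rgen j)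
| OSrel_LL (i j : 'I_n) : j = i.+1 :> nat -> OSrel (Lgen j * Lgen i)
| OSrel_U (i : 'I_n) (x : istate) : lo i \notin val x -> hi i \notin val x ->
    OSrel ('X_i *: fbasis x x).

Definition OSideal : tsideal B0 := idealG OSrel.

Definition OSB : pzRingType := qring OSideal.

Definition left_idem0 : B0 := \sum_(x | left_istate x) fbasis x x.

Lemma left_idem0_idem : left_idem0 * left_idem0 = left_idem0.
Proof.
rewrite /left_idem0 mulr_suml; apply: eq_bigr => x lx.
rewrite (bigD1 x) //= mulrDr fbasisM gexp_xxy mpolyX0 scale1r.
rewrite mulr_sumr big1 ?addr0 // => y /andP[_ yx].
by rewrite fbasisM0 // eq_sym.
Qed.

Lemma left_idem_idem :
  qpi OSideal left_idem0 * qpi OSideal left_idem0 = qpi OSideal left_idem0.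
Proof. by rewrite -rmorphM left_idem0_idem. Qed.

Definition left_idem : idempotent OSB := Idempotent left_idem_idem.

Definition OSBl : pzRingType := corner left_idem.

(* The central element U_(i+1) * 1. *)
Definition OSU (i : 'I_n) : OSBl :=
  cproj left_idem (qpi OSideal ('X_i *: (1 : B0))).

Definition esymU (r : nat) : OSBl :=
  \sum_(h : {set 'I_n} | #|h| == r) \prod_(i in h) OSU i.

Definition B0grading (d : int) (a : B0) : Prop :=
  forall x y m, m \in msupp (bcoef a (x, y)) ->
    (2 * mdeg m + \sum_(i < n) `|vcount x i - vcount y i|)%N%:Z = d.

Definition OSBlgrading (d : int) (b : OSBl) : Prop :=
  image_grading (qpi OSideal) B0grading d (cval b).

End OzsvathSzaboRing.

(** * The integral Sartori algebra *)

(* Hom_R(U, V), as an R-module. *)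
Definition Hom (R : comNzRingType) (U V : lmodType R) : Type :=
  {linear U -> V}.

Section Hom.
Variables (R : comNzRingType).

HB.instance Definition _ (U V : lmodType R) := gen_eqMixin (Hom U V).
HB.instance Definition _ (U V : lmodType R) := gen_choiceMixin (Hom U V).

Definition happ (U V : lmodType R) (f : Hom U V) (u : U) : V :=
  (f : {linear U -> V}) u.

Lemma homP (U V : lmodType R) (f g : Hom U V) : happ f =1 happ g -> f = g.
Proof.
rewrite /happ; case: f => f cf; case: g => g cg /= /funext fg.
have {}fg : f = g by exact: fg.
subst g; suff -> : cf = cg by [].
case: cf cg => [[fB] [fZ]] [[gB] [gZ]].
by rewrite (Prop_irrelevance fB gB) (Prop_irrelevance fZ gZ).
Qed.

Section HomModule.
Variables U V : lmodType R.
Implicit Types (f g : Hom U V).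

Definition hzero : Hom U V := \0 : {linear U -> V}.
Definition hopp f : Hom U V := (\- (f : {linear U -> V})) : {linear U -> V}.
Definition hadd f g : Hom U V :=
  ((f : {linear U -> V}) \+ (g : {linear U -> V})) : {linear U -> V}.
Definition hscale (a : R) f : Hom U V :=
  (a \*: (f : {linear U -> V})) : {linear U -> V}.

Lemma haddA : associative hadd.
Proof. by move=> f g h; apply: homP => u; rewrite /happ /= addrA. Qed.
Lemma haddC : commutative hadd.
Proof. by move=> f g; apply: homP => u; rewrite /happ /= addrC. Qed.
Lemma hadd0 : left_id hzero hadd.
Proof. by move=> f; apply: homP => u; rewrite /happ /= add0r. Qed.
Lemma haddN : left_inverse hzero hopp hadd.
Proof. by move=> f; apply: homP => u; rewrite /happ /= addNr. Qed.

HB.instance Definition _ :=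
  GRing.isZmodule.Build (Hom U V) haddA haddC hadd0 haddN.

Lemma hscaleA a b f : hscale a (hscale b f) = hscale (a * b) f.
Proof. by apply: homP => u; rewrite /happ /= scalerA. Qed.
Lemma hscale1 : left_id 1 hscale.
Proof. by move=> f; apply: homP => u; rewrite /happ /= scale1r. Qed.
Lemma hscaleDr : right_distributive hscale +%R.
Proof. by move=> a f g; apply: homP => u; rewrite /happ /= scalerDr. Qed.
Lemma hscaleDl f : {morph hscale^~ f : a b / a + b}.
Proof. by move=> a b; apply: homP => u; rewrite /happ /= scalerDl. Qed.

HB.instance Definition _ := GRing.Zmodule_isLmodule.Build R (Hom U V)
  hscaleA hscale1 hscaleDr hscaleDl.

Lemma happ0 u : happ (0 : Hom U V) u = 0. Proof. by []. Qed.
Lemma happD f g u : happ (f + g) u = happ f u + happ g u. Proof. by []. Qed.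
Lemma happ_sum I (r : seq I) (P : pred I) (F : I -> Hom U V) u :
  happ (\sum_(i <- r | P i) F i) u = \sum_(i <- r | P i) happ (F i) u.
Proof. by elim/big_rec2: _ => // i x y _ <-. Qed.
End HomModule.

Definition hid (U : lmodType R) : Hom U U := idfun : {linear U -> U}.
Definition hcomp (U V W : lmodType R) (g : Hom V W) (f : Hom U V) : Hom U W :=
  ((g : {linear V -> W}) \o (f : {linear U -> V})) : {linear U -> W}.
End Hom.

(* The direct sum over l, m of Hom_R(M l, M m), with product a b = a o b. *)
Section HomRing.
Variables (R : comNzRingType) (D : finType) (M : D -> lmodType R).

Definition hom_ring : Type := forall l m : D, Hom (M l) (M m).

HB.instance Definition _ := gen_eqMixin hom_ring.
HB.instance Definition _ := gen_choiceMixin hom_ring.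

Definition rzero : hom_ring := fun l m => 0.
Definition ropp (a : hom_ring) : hom_ring := fun l m => - a l m.
Definition radd (a b : hom_ring) : hom_ring := fun l m => a l m + b l m.

Lemma hom_ringP (a b : hom_ring) :
  (forall l m u, happ (a l m) u = happ (b l m) u) -> a = b.
Proof.
by move=> ab; apply: functional_extensionality_dep => l;
   apply: functional_extensionality_dep => m; apply: homP => u; apply: ab.
Qed.

Lemma raddA : associative radd.
Proof. by move=> a b c; apply: hom_ringP => l m u; rewrite /radd addrA. Qed.
Lemma raddC : commutative radd.
Proof. by move=> a b; apply: hom_ringP => l m u; rewrite /radd addrC. Qed.
Lemma radd0 : left_id rzero radd.
Proof. by move=> a; apply: hom_ringP => l m u; rewrite /radd add0r. Qed.
Lemma raddN : left_inverse rzero ropp radd.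
Proof. by move=> a; apply: hom_ringP => l m u; rewrite /radd addNr. Qed.

HB.instance Definition _ :=
  GRing.isZmodule.Build hom_ring raddA raddC radd0 raddN.

Definition rone : hom_ring := fun l m =>
  match l =P m with
  | ReflectT e => ecast m (Hom (M l) (M m)) e (hid (M l))
  | ReflectF _ => 0
  end.

Definition rmul (a b : hom_ring) : hom_ring := fun l m =>
  \sum_p hcomp (a p m) (b l p).

Lemma roneE l u : happ (rone l l) u = u.
Proof. by rewrite /rone; case: eqP => // e; rewrite (eq_axiomK e). Qed.
Lemma roneN l m u : l != m -> happ (rone l m) u = 0.
Proof. by rewrite /rone; case: eqP. Qed.

Lemma rmulE a b l m u :
  happ (rmul a b l m) u = \sum_p happ (a p m) (happ (b l p) u).
Proof. exact: happ_sum. Qed.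

Lemma rmulA : associative rmul.
Proof.
move=> a b c; apply: hom_ringP => l m u; rewrite !rmulE.
under eq_bigr => p _ do rewrite rmulE /happ linear_sum.
under [RHS]eq_bigr => p _ do rewrite rmulE.
by rewrite exchange_big.
Qed.

Lemma rmul1 : left_id rone rmul.
Proof.
move=> a; apply: hom_ringP => l m u; rewrite rmulE (bigD1 m) //= roneE.
by rewrite big1 ?addr0 // => p pm; rewrite roneN.
Qed.

Lemma rmulr1 : right_id rone rmul.
Proof.
move=> a; apply: hom_ringP => l m u; rewrite rmulE (bigD1 l) //= roneE.
by rewrite big1 ?addr0 // => p pl; rewrite roneN 1?eq_sym // /happ linear0.
Qed.

Lemma rmulDl : left_distributive rmul +%R.
Proof.
move=> a b c; apply: hom_ringP => l m u.
by rewrite happD !rmulE -big_split.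
Qed.

Lemma rmulDr : right_distributive rmul +%R.
Proof.
move=> a b c; apply: hom_ringP => l m u.
rewrite happD !rmulE -big_split; apply: eq_bigr => p _.
by rewrite happD /happ linearD.
Qed.

HB.instance Definition _ :=
  GRing.Zmodule_isPzRing.Build hom_ring rmulA rmul1 rmulr1 rmulDl rmulDr.
End HomRing.

Definition submod_gen (R : pzRingType) (V : lmodType R) (G : V -> Prop)
  (v : V) : Prop :=
  exists s : seq (R * V), (forall t, t \in s -> G t.2) /\
    v = \sum_(t <- s) t.1 *: t.2.

Section Sartori.
Variables n k : nat.
Local Notation ZX := {mpoly int[n]}.

(* true is a wedge, false is a vee *)
Definition wseq : predArgType := {mu : n.-tuple bool | count_mem true mu == k}.

Definition bseq (mu : wseq) (i : 'I_n) : nat :=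
  (1 + #|[set j : 'I_n | (i < j)%N && tnth (val mu) j]|)%N.

(* The positions of the vees, increasing; both the positions and the index of
   a vee are counted from 0. *)
Definition vees (mu : wseq) : seq nat :=
  [seq val i | i <- enum 'I_n & ~~ tnth (val mu) i].
Definition vee (mu : wseq) (j : nat) : nat := nth 0%N (vees mu) j.

(* Complete homogeneous symmetric polynomial of degree d in the first r
   variables. *)
Definition hpoly (d r : nat) : ZX :=
  \sum_(m : 'X_{1..n < d.+1} | (mdeg m == d) &&
         [forall i : 'I_n, (r <= i)%N ==> (m i == 0%N)]) 'X_[m].

Definition Iideal (b : 'I_n -> nat) : tsideal ZX :=
  idealG (fun p => exists i : 'I_n, p = hpoly (b i) i.+1).

Definition Rb (b : 'I_n -> nat) : lmodType ZX := qring (Iideal b).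

(* phi is the map (1 |-> p) *)
Definition is_map (b b' : 'I_n -> nat) (phi : Hom (Rb b) (Rb b')) (p : ZX) :
  Prop := happ phi (qpi (Iideal b) 1) = qpi (Iideal b') p.

Definition too_far (l m : wseq) : Prop :=
  exists j : nat, (j.+1 < n - k)%N /\
    ((vee l j.+1 <= vee m j)%N \/ (vee m j.+1 <= vee l j)%N).

Definition alpha (l m : wseq) (j : nat) : nat := maxn (vee l j) (vee m j).

(* One more than the last index beta(j) in the product. *)
Definition beta_succ (l m : wseq) (j : nat) : nat :=
  if (j.+1 < n - k)%N then minn (vee m j.+1) (vee l j.+1) else n.

(* Truncated subtraction: c_i = max(b_i^m - b_i^l, 0). *)
Definition cpoly (l m : wseq) : ZX :=
  \prod_(i < n) 'X_i ^+ (bseq m i - bseq l i)%N.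

Definition Wgen (l m : wseq) (phi : Hom (Rb (bseq l)) (Rb (bseq m))) : Prop :=
  exists j : nat, (j < n - k)%N /\
    is_map phi ((\prod_(i < n | (alpha l m j <= i < beta_succ l m j)%N) 'X_i)
                * cpoly l m).

Definition Wsub (l m : wseq) (phi : Hom (Rb (bseq l)) (Rb (bseq m))) : Prop :=
  too_far l m \/ submod_gen (@Wgen l m) phi.

Definition sartori_hom : pzRingType := hom_ring (fun l : wseq => Rb (bseq l)).

Definition sartoriW (a : sartori_hom) : Prop :=
  forall l m, Wsub ((a : hom_ring _) l m).

(* The product of the Sartori algebra is well defined because the direct sum of
   the W_(l, m) is a two-sided ideal; the algebra is the quotient by it. *)
Definition sartori (HW : two_sided_ideal sartoriW) : pzRingType :=
  qring (TSIdeal HW).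

Definition sartori_hom_grading (d : int) (a : sartori_hom) : Prop :=
  forall l m, exists2 p : ZX, is_map ((a : hom_ring _) l m) p &
    forall t, t \in msupp p -> (2 * mdeg t)%N%:Z
      - \sum_(i < n) ((bseq m i)%:Z - (bseq l i)%:Z) = d.

Definition sartori_grading (HW : two_sided_ideal sartoriW) (d : int)
  (a : sartori HW) : Prop :=
  image_grading (qpi (TSIdeal HW)) sartori_hom_grading d a.

End Sartori.

(* Main.v *)
Require Import Defs.
From HB Require Import structures.
From mathcomp Require Import all_boot all_order all_algebra.
From mathcomp Require Import perm ssrcomplements mpoly.
From mathcomp Require Import boolp.
From mathcomp Require Import zify ring.

Set Implicit Arguments.
Unset Strict Implicit.
Unset Printing Implicit Defensive.

Import Order.TTheory GRing.Theory.
Local Open Scope ring_scope.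

(**
Both algebras have, for each pair of left states x and y, a component that is a
quotient of a polynomial ring, and the whole proof compares these components.

On the Ozsvath-Szabo side the component of f_xy is Z[U_1..U_n]/J_xy, where J_xy
is generated by products of variables over disjoint intervals, one for each j,
between the j-th and the (j+1)-st unoccupied positions of x and y; a product is
empty, and J_xy the whole ring, when x and y are too far ([OSidealP]).  These
products lie in the ideal of relations because f_xy factors, up to the missing
variables, through a state that is killed by one variable ([near_state]) or
through two consecutive steps ([far_chain]); conversely the ideals J_xy absorb
the structure constants U^gexp ([class_ideal_mull], [class_ideal_mulr]).

On the Sartori side every homomorphism R_b -> R_b' is 1 |-> p x^c, and p matters
modulo I_min(b, b') only ([Iideal_hom], [Iideal_colon]).  For b' = b + delta_i
this says that x_i and the i-th generator are regular modulo the remaining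
generators.  The reason is that h_(b_i)(x_1..x_i) is monic of degree b_i in x_i:
the products x^a h^m with a_i < b_i have all monomials as leading monomials and
form a basis of the polynomial ring ([tri_regular]).  The general case is reached
by raising b one entry at a time.  In these coordinates W is the image of J_xy
([WsubP]), and the monomials x^c multiply with the same correction U^gexp as the
f_xy ([hmap_comp]), so f_xy |-> (1 |-> x^c) is a ring homomorphism on the corner.

Its kernel is J_xy + I_min(b, b') in each component.  Modulo the elementary
symmetric polynomials the generator h_(b_i)(x_1..x_i) is e_(b_i)(x_(i+1)..x_n) up
to sign, and by the pigeonhole principle each square-free monomial of this degree
contains one of the products generating J_xy; so J_xy + I_min(b, b') is
J_xy + (e_1, ..., e_k) ([Iideal_sub_esym], [mesym_Iideal]).

Flatness holds because Z[U_1..U_n]/J is free over Z[e_1..e_k] whenever J is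
generated by n - k products of variables with disjoint supports
([colour_ideal_free]).  Put R = Z[U_1..U_n].  If U_i divides one of the products
properly, R/J is an extension of R/(J + U_i) by R/(J : U_i), which are of the same
kind.  If all the products are single variables, R/J is a polynomial ring in k
variables on which e_k acts as their product, and a basis of R/(J + e_k) over
Z[e_1..e_(k-1)] lifts to one of R/J.
*)

(** * Two-sided ideals *)

Section IdealTheory.
Variables (A : pzRingType) (I : A -> Prop).
Hypothesis tI : two_sided_ideal I.

Lemma ts0 : I 0. Proof. by case: tI. Qed.
Lemma tsB x y : I x -> I y -> I (x - y). Proof. by case: tI => _ + _ _; apply. Qed.
Lemma tsMl a x : I x -> I (a * x). Proof. by case: tI => _ _ + _; apply. Qed.
Lemma tsMr x a : I x -> I (x * a). Proof. by case: tI => _ _ _; apply. Qed.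
Lemma tsN x : I x -> I (- x). Proof. by move=> Ix; rewrite -sub0r; exact: tsB ts0 Ix. Qed.
Lemma tsD x y : I x -> I y -> I (x + y).
Proof. by move=> Ix Iy; rewrite -[y]opprK; exact: tsB Ix (tsN Iy). Qed.
Lemma ts_sum J (r : seq J) (P : pred J) (F : J -> A) :
  (forall j, P j -> I (F j)) -> I (\sum_(j <- r | P j) F j).
Proof. by move=> IF; elim/big_rec: _ => [|j x /IF Ij Ix]; [exact: ts0 | exact: tsD]. Qed.
Lemma ts_eq x y : I (x - y) -> I y -> I x.
Proof. by move=> Ixy Iy; rewrite -(subrK y x); exact: tsD. Qed.
Lemma ts_sub x y : I (x - y) -> I (y - x).
Proof. by move/tsN; rewrite opprB. Qed.
End IdealTheory.

Lemma ideal_gen_min (A : pzRingType) (G I : A -> Prop) :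
  two_sided_ideal I -> (forall g, G g -> I g) -> forall x, ideal_gen G x -> I x.
Proof.
move=> tI GI x [s [Gs ->]]; rewrite big_seq; apply: ts_sum => // t /Gs/GI It.
by apply: tsMr => //; apply: tsMl.
Qed.

Lemma ideal_gen_incl (A : pzRingType) (G : A -> Prop) x : G x -> ideal_gen G x.
Proof.
move=> Gx; exists [:: (1, x, 1)]; rewrite big_seq1 /= mul1r mulr1; split=> // t.
by rewrite inE => /eqP->.
Qed.

Lemma ideal_gen_sub (A : pzRingType) (G G' : A -> Prop) :
  (forall g, G g -> G' g) -> forall x, ideal_gen G x -> ideal_gen G' x.
Proof.
by move=> GG'; apply: ideal_gen_min (ideal_gen_two_sided G') _ => g /GG'/ideal_gen_incl.
Qed.

Definition ideal_sum (A : zmodType) (I J : A -> Prop) (x : A) : Prop :=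
  exists y z, [/\ I y, J z & x = y + z].

Lemma ideal_sum_two_sided (A : pzRingType) (I J : A -> Prop) :
  two_sided_ideal I -> two_sided_ideal J -> two_sided_ideal (ideal_sum I J).
Proof.
move=> tI tJ; split.
- by exists 0, 0; split; [exact: ts0 | exact: ts0 | rewrite addr0].
- move=> _ _ [y [z [Iy Jz ->]]] [y' [z' [Iy' Jz' ->]]]; exists (y - y'), (z - z').
  by split; [exact: tsB | exact: tsB | rewrite opprD addrACA].
- move=> a _ [y [z [Iy Jz ->]]]; exists (a * y), (a * z).
  by split; [exact: tsMl | exact: tsMl | rewrite mulrDr].
- move=> a _ [y [z [Iy Jz ->]]]; exists (y * a), (z * a).
  by split; [exact: tsMr | exact: tsMr | rewrite mulrDl].
Qed.

Lemma ideal_sumL (A : pzRingType) (I J : A -> Prop) x :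
  two_sided_ideal J -> I x -> ideal_sum I J x.
Proof. by move=> tJ Ix; exists x, 0; split; [|exact: ts0 | rewrite addr0]. Qed.

Lemma ideal_sumR (A : pzRingType) (I J : A -> Prop) x :
  two_sided_ideal I -> J x -> ideal_sum I J x.
Proof. by move=> tI Jx; exists 0, x; split; [exact: ts0 | | rewrite add0r]. Qed.

(** * Monomial ideals attached to colourings *)

Section MonomialIdeals.
Variable n : nat.
Local Notation R := {mpoly int[n]}.

(** The exponents of the monomials divisible by the product of all the variables
    of some colour s, 1 <= s <= r.  Colouring the indices is a way to give r
    products of variables with pairwise disjoint supports; an empty class stands
    for the product 1, and the colours out of range for no class at all. *)
Definition hits (r : nat) (c : 'I_n -> nat) (m : 'X_{1..n}) : bool :=
  has (fun s => [forall i, (c i == s) ==> (0 < m i)%N]) (iota 1 r).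

Lemma hitsP r c (m : 'X_{1..n}) : reflect
  (exists2 s, (0 < s <= r)%N & forall i, c i = s -> (0 < m i)%N) (hits r c m).
Proof.
apply: (iffP hasP) => [[s]|[s rs cm]].
  rewrite mem_iota add1n ltnS => rs /forallP cm; exists s => // i /eqP cs.
  by have := cm i; rewrite cs.
exists s; first by rewrite mem_iota add1n ltnS.
by apply/forallP => i; apply/implyP => /eqP/cm.
Qed.

Lemma hits_le r c (m m' : 'X_{1..n}) : (m <= m')%MM -> hits r c m -> hits r c m'.
Proof.
move=> /mnm_lepP mm' /hitsP[s rs cm]; apply/hitsP; exists s => // i /cm.
by move/leq_trans; apply.
Qed.

Definition colour_ideal (r : nat) (c : 'I_n -> nat) (p : R) : Prop :=
  forall m, m \in msupp p -> hits r c m.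

Lemma colour_idealX r c (m : 'X_{1..n}) : hits r c m -> colour_ideal r c 'X_[m].
Proof. by move=> hm m'; rewrite msuppX inE => /eqP->. Qed.

Lemma mem_msuppM (p q : R) m : m \in msupp (p * q) ->
  exists m1 m2, [/\ m1 \in msupp p, m2 \in msupp q & m = (m1 + m2)%MM].
Proof.
by move/msuppM_le => /allpairsP[[m1 m2] /= [pm1 qm2 ->]]; exists m1, m2.
Qed.

Lemma mem_msuppB (p q : R) m : m \in msupp (p - q) -> m \in msupp p \/ m \in msupp q.
Proof. by move/msuppB_le; rewrite mem_cat => /orP. Qed.

Lemma colour_ideal_two_sided r c : two_sided_ideal (colour_ideal r c).
Proof.
split; first by move=> m; rewrite msupp0.
- by move=> x y cx cy m /mem_msuppB[/cx|/cy].
- move=> a x cx m /mem_msuppM[m1 [m2 [_ /cx h ->]]]; exact: hits_le (lem_addl _ _) h.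
- move=> a x cx m /mem_msuppM[m1 [m2 [/cx h _ ->]]]; exact: hits_le (lem_addr _ _) h.
Qed.
Hint Resolve colour_ideal_two_sided : core.

Lemma msupp_mulX m (p : R) m' :
  m' \in msupp ('X_[m] * p) <-> exists2 m1, m1 \in msupp p & m' = (m + m1)%MM.
Proof.
rewrite mulrC (perm_mem (msuppMX p m)); split=> [/mapP[m1]|[m1 pm1 ->]].
  by exists m1.
by apply/mapP; exists m1.
Qed.

Definition mfilter (P : pred 'X_{1..n}) (p : R) : R := \sum_(m <- msupp p | P m) p@_m *: 'X_[m].

Lemma mcoeff_mfilter P (p : R) m : (mfilter P p)@_m = if P m then p@_m else 0.
Proof.
transitivity (\sum_(m' <- msupp p) if P m' then p@_m' * (m' == m)%:R else 0).
  rewrite /mfilter raddf_sum big_mkcond; apply: eq_bigr => m' _ /=.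
  by rewrite mcoeffZ mcoeffX.
case: ifPn => Pm; last first.
  rewrite big1 // => m' _; case: eqP => [->|_]; first by rewrite (negPf Pm).
  by rewrite mulr0 if_same.
rewrite [p in RHS]mpolyE raddf_sum; apply: eq_bigr => m' _ /=; rewrite mcoeffZ mcoeffX.
by case: eqP => [->|_]; rewrite ?Pm // mulr0 if_same.
Qed.

Lemma msupp_mfilter P (p : R) m : m \in msupp (mfilter P p) -> P m /\ m \in msupp p.
Proof. by rewrite !mcoeff_msupp mcoeff_mfilter; case: ifP => //; rewrite eqxx. Qed.

Lemma mpoly_split (P : pred 'X_{1..n}) (p : R) : exists p1 p2 : R,
  [/\ p = p1 + p2, forall m, m \in msupp p1 -> m \in msupp p /\ P m
    & forall m, m \in msupp p2 -> m \in msupp p /\ ~~ P m].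
Proof.
exists (mfilter P p), (mfilter (predC P) p); split=> [|m /msupp_mfilter[]|m /msupp_mfilter[]] //.
apply/mpolyP => m; rewrite mcoeffD !mcoeff_mfilter /=.
by case: (P m); rewrite ?addr0 ?add0r.
Qed.

Lemma mpoly_divX m0 (p : R) : (forall m, m \in msupp p -> (m0 <= m)%MM) ->
  exists q, p = 'X_[m0] * q.
Proof.
move=> mp; exists (\sum_(m <- msupp p) p@_m *: 'X_[m - m0]).
rewrite {1}[p]mpolyE mulr_sumr; apply: eq_big_seq => m pm.
by rewrite -scalerAr -mpolyXD addmC submK ?mp.
Qed.

End MonomialIdeals.
#[export] Hint Resolve colour_ideal_two_sided : core.

(** * Freeness of monomial quotients over the elementary symmetric polynomials *)

Section Freeness.
Variable n : nat.
Local Notation R := {mpoly int[n]}.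

Lemma msize_leP (p : R) d :
  reflect (forall m, m \in msupp p -> (mdeg m < d)%N) (msize p <= d)%N.
Proof.
apply: (iffP idP) => [pd m /msize_mdeg_lt mp|pd]; first exact: leq_trans mp pd.
by rewrite msizeE; apply/bigmax_leqP_seq => m /pd.
Qed.

Lemma msizeXM m (q : R) : q != 0 -> msize ('X_[m] * q) = (mdeg m + msize q)%N.
Proof.
move=> q0; have X0 : 'X_[m] != 0 :> R by rewrite -msize_poly_eq0 msizeX.
by rewrite msizeM // msizeX addSn.
Qed.

Definition esym_eval (k : nat) (s : {mpoly int[k]}) : R :=
  s \mPo [tuple mesym n int i.+1 | i < k].

HB.instance Definition _ k := GRing.RMorphism.copy (@esym_eval k)
  (comp_mpoly [tuple mesym n int i.+1 | i < k]).

Lemma esym_evalX k (i : 'I_k) : esym_eval 'X_i = mesym n int i.+1.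
Proof. by rewrite /esym_eval comp_mpolyXU -tnth_nth tnth_mktuple. Qed.

(** Freeness of R/J over Z[eps_1..eps_k].  The spanning part carries a bound
    on the degrees, because lifting a basis modulo e_k is an induction on them. *)
Definition quot_free (k : nat) (J : R -> Prop) : Prop :=
  exists (T : finType) (b : T -> R),
  (forall d p, (msize p <= d)%N -> exists s : T -> {mpoly int[k]},
     (forall t, (msize (esym_eval (s t) * b t) <= d)%N) /\
     J (p - \sum_t esym_eval (s t) * b t)) /\
  (forall s : T -> {mpoly int[k]}, J (\sum_t esym_eval (s t) * b t) -> forall t, s t = 0).

(** Under these hypotheses 0 -> R/J' -> R/J -> R/J'' -> 0 is exact, the first map
    being multiplication by U_i, and bases of the outer terms combine into a
    basis of the middle one. *)
Lemma quot_free_ext k (J J' J'' : R -> Prop) (i : 'I_n) :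
  two_sided_ideal J -> two_sided_ideal J'' ->
  (forall p, J ('X_i * p) <-> J' p) ->
  (forall p, J p -> J'' p) -> J'' 'X_i ->
  (forall p, J'' p -> exists p1 q,
     [/\ J p1, (msize ('X_i * q) <= msize p)%N & p = p1 + 'X_i * q]) ->
  quot_free k J' -> quot_free k J'' -> quot_free k J.
Proof.
move=> tJ tJ'' JJ' JJ'' J''X spl [T' [b' [span' ind']]] [T'' [b'' [span'' ind'']]].
pose b (t : T' + T'') := match t with inl t => 'X_i * b' t | inr t => b'' t end.
have sumb (s : T' + T'' -> {mpoly int[k]}) : \sum_t esym_eval (s t) * b t =
    'X_i * (\sum_t esym_eval (s (inl t)) * b' t) + \sum_t esym_eval (s (inr t)) * b'' t.
  rewrite big_sumType /= mulr_sumr; congr (_ + _).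
  by apply: eq_bigr => t _; rewrite mulrCA.
exists (T' + T'')%type, b; split=> [d p pd|s].
  have [s'' [s''d J''p]] := span'' d p pd.
  have [p1 [q [Jp1 qd pE]]] := spl _ J''p.
  have {}qd : (msize ('X_i * q) <= d)%N.
    apply: leq_trans qd _; apply: leq_trans (msizeD_le _ _) _.
    rewrite geq_max pd msizeN; apply: leq_trans (msize_sum _ _ _) _.
    by apply/bigmax_leqP => t _; exact: s''d.
  have [s' [s'd J'q]] : exists s' : T' -> {mpoly int[k]},
     (forall t, (msize ('X_i * (esym_eval (s' t) * b' t)) <= d)%N) /\
     J' (q - \sum_t esym_eval (s' t) * b' t).
    have [q0|q0] := eqVneq q 0.
      exists (fun=> 0); split=> [t|]; first by rewrite rmorph0 mul0r mulr0 msize0.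
      rewrite q0 sub0r big1 => [|t _]; last by rewrite rmorph0 mul0r.
      by apply/JJ'; rewrite oppr0 mulr0; exact: ts0.
    move: qd; rewrite msizeXM // mdeg1 => qd.
    have [|s' [s'd J'q]] := span' d.-1 q; first by case: d qd {pd s''d}.
    exists s'; split=> // t.
    have [-> | z] := eqVneq (esym_eval (s' t) * b' t) 0; first by rewrite mulr0 msize0.
    rewrite msizeXM // mdeg1; have := s'd t; move: qd; case: d {pd s''d s'd} => //.
  exists (fun t => match t with inl t => s' t | inr t => s'' t end); split.
    by case=> t /=; [rewrite mulrCA; exact: s'd | exact: s''d].
  rewrite sumb /=; move/JJ': J'q; rewrite mulrBr => Jq.
  have -> : p - ('X_i * (\sum_t esym_eval (s' t) * b' t) + \sum_t esym_eval (s'' t) * b'' t)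
     = p1 + ('X_i * q - 'X_i * \sum_t esym_eval (s' t) * b' t).
    by rewrite opprD addrCA pE addrC -!addrA.
  exact: tsD.
rewrite sumb => Js.
have s''0 : forall t, s (inr t) = 0.
  apply: (ind'' (fun t => s (inr t))).
  have := tsB tJ'' (JJ'' _ Js) (tsMr tJ'' (\sum_t esym_eval (s (inl t)) * b' t) J''X).
  by rewrite addrAC subrr add0r.
have s'0 : forall t, s (inl t) = 0.
  apply: (ind' (fun t => s (inl t))); apply/JJ'; move: Js.
  by rewrite [X in _ + X]big1 ?addr0 // => t _; rewrite s''0 rmorph0 mul0r.
by case.
Qed.

Lemma esym_eval_mwiden k (s : {mpoly int[k]}) : esym_eval (mwiden s) = esym_eval s.
Proof.
rewrite [s]mpolyE [mwiden _]raddf_sum [LHS]raddf_sum [RHS]raddf_sum /=; apply: eq_bigr => m _.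
rewrite mwidenZ mwidenX /esym_eval !comp_mpolyZ !comp_mpolyX; congr (_ *: _).
rewrite big_ord_recr /= mnmwiden_ordmax expr0 mulr1; apply: eq_bigr => i _.
by rewrite mnmwiden_widen !tnth_mktuple.
Qed.

(** Feeds the induction on the degree in the last variable in [quot_free_lift]. *)
Lemma mwiden_split k (s : {mpoly int[k.+1]}) :
  exists s01 : {mpoly int[k]} * {mpoly int[k.+1]},
  s = mwiden s01.1 + 'X_ord_max * s01.2 /\
  forall d, (forall m, m \in msupp s -> (m ord_max < d.+1)%N) ->
            forall m, m \in msupp s01.2 -> (m ord_max < d)%N.
Proof.
have [p0 [p1 [-> p0P p1P]]] := mpoly_split (fun m => m ord_max == 0%N) s.
have [s1 p1E] : exists s1, p1 = 'X_[U_(ord_max)] * s1.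
  apply: mpoly_divX => m /p1P[_ m0]; apply/mnm_lepP => i; rewrite mnm1E.
  by case: eqP => // <-; rewrite lt0n.
pose s0 : {mpoly int[k]} :=
  \sum_(m <- msupp p0) p0@_m *: 'X_[[multinom m (widen_ord (leqnSn k) i) | i < k]].
exists (s0, s1); split=> [|d sd m s1m] /=.
  congr (_ + _) => //; rewrite raddf_sum [LHS]mpolyE /=; apply: eq_big_seq => m pm.
  rewrite mwidenZ mwidenX; congr (_ *: 'X_[_]); apply/mnmP => i.
  have [j ->|->] := unliftP ord_max i; last first.
    by rewrite mnmwiden_ordmax; have [_ /eqP] := p0P _ pm.
  have -> : lift ord_max j = widen_ord (leqnSn k) j by apply: ord_inj; rewrite lift_max.
  by rewrite mnmwiden_widen mnmE.
have p1m : (U_(ord_max) + m)%MM \in msupp p1.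
  by rewrite p1E; apply/msupp_mulX; exists m.
have : (U_(ord_max) + m)%MM \in msupp (p0 + p1).
  rewrite mcoeff_msupp mcoeffD (memN_msupp_eq0 (p := p0)) ?add0r -?mcoeff_msupp //.
  by apply/negP => /p0P[_]; have [_ /negP] := p1P _ p1m.
by move/sd; rewrite mnmDE mnm1E eqxx.
Qed.

(** A basis of R/(J + u) over one elementary polynomial less remains a basis of
    R/J when e_k acts there as the monomial u without torsion: it generates by
    induction on the degree, and a relation can be divided by eps_k. *)
Lemma quot_free_lift k (J J'' : R -> Prop) (u : 'X_{1..n}) :
  two_sided_ideal J -> two_sided_ideal J'' -> mdeg u = k.+1 ->
  J (mesym n int k.+1 - 'X_[u]) ->
  (forall p, J ('X_[u] * p) -> J p) ->
  (forall p, J p -> J'' p) -> J'' 'X_[u] ->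
  (forall p, J'' p -> exists p1 q,
     [/\ J p1, (msize ('X_[u] * q) <= msize p)%N & p = p1 + 'X_[u] * q]) ->
  quot_free k J'' -> quot_free k.+1 J.
Proof.
move=> tJ tJ'' du Je nzd JJ'' J''u spl [T [b [span ind]]].
have evmax : esym_eval ('X_ord_max : {mpoly int[k.+1]}) = mesym n int k.+1 by rewrite esym_evalX.
have sumE (s : T -> {mpoly int[k]}) (s' : T -> {mpoly int[k.+1]}) :
   \sum_t esym_eval (mwiden (s t) + 'X_ord_max * s' t) * b t =
   \sum_t esym_eval (s t) * b t + mesym n int k.+1 * \sum_t esym_eval (s' t) * b t.
  rewrite mulr_sumr -big_split; apply: eq_bigr => t _ /=.
  by rewrite rmorphD rmorphM /= esym_eval_mwiden evmax mulrDl mulrA.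
exists T, b; split=> [d|s].
  elim/ltn_ind: d => d IH p pd.
  have [s [sd J''p]] := span d p pd; have [p1 [q [Jp1 qd pE]]] := spl _ J''p.
  have {}qd : (msize ('X_[u] * q) <= d)%N.
    apply: leq_trans qd _; apply: leq_trans (msizeD_le _ _) _.
    rewrite geq_max pd msizeN; apply: leq_trans (msize_sum _ _ _) _.
    by apply/bigmax_leqP => t _; exact: sd.
  have [s' [s'd Jq]] : exists s' : T -> {mpoly int[k.+1]},
     (forall t, (msize (esym_eval ('X_ord_max * s' t) * b t) <= d)%N) /\
     J (q - \sum_t esym_eval (s' t) * b t).
    have [q0|q0] := eqVneq q 0.
      exists (fun=> 0); split=> [t|]; first by rewrite mulr0 rmorph0 mul0r msize0.
      by rewrite q0 sub0r big1 ?oppr0 => [|t _]; [exact: ts0 | rewrite rmorph0 mul0r].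
    rewrite msizeXM // du in qd.
    have [||s' [s'd Jq]] := IH (msize q) _ q; [lia | by [] |].
    exists s'; split=> // t; rewrite rmorphM /= evmax -mulrA.
    have [-> | z] := eqVneq (esym_eval (s' t) * b t) 0; first by rewrite mulr0 msize0.
    have [-> | e0] := eqVneq (mesym n int k.+1) 0; first by rewrite mul0r msize0.
    have ek : (msize (mesym n int k.+1) <= k.+2)%N.
      by apply/msize_leP => m; rewrite mem_msupp_mesym => /andP[/eqP-> _].
    rewrite msizeM //; apply: leq_trans qd; rewrite -subn1 leq_subLR add1n -addSn.
    exact: leq_add ek (s'd t).
  exists (fun t => mwiden (s t) + 'X_ord_max * s' t); split=> [t|].
    rewrite rmorphD /= esym_eval_mwiden mulrDl; apply: leq_trans (msizeD_le _ _) _.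
    by rewrite geq_max sd s'd.
  rewrite sumE opprD addrA pE -addrA; apply: tsD => //.
  have -> : 'X_[u] * q - mesym n int k.+1 * (\sum_t esym_eval (s' t) * b t) =
     'X_[u] * (q - \sum_t esym_eval (s' t) * b t)
     - (mesym n int k.+1 - 'X_[u]) * \sum_t esym_eval (s' t) * b t by ring.
  by apply: tsB => //; [exact: tsMl | exact: tsMr].
have [d sd] : exists d, forall t m, m \in msupp (s t) -> (m ord_max < d)%N.
  exists (\max_t \max_(m <- msupp (s t)) (m ord_max).+1)%N => t m sm.
  pose F (m' : 'X_{1..k.+1}) := (m' ord_max).+1.
  apply: leq_trans (leq_bigmax_seq (F := F) m sm isT) _.
  exact: (leq_bigmax (F := fun t' => \max_(m' <- msupp (s t')) F m')).
elim: d s sd => [|d IH] s sd Js t.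
  by apply/eqP; rewrite -msupp_eq0; case E: (msupp _) (sd t) => // [m l] /(_ m (mem_head _ _)).
have [f fP] := choice (fun t => mwiden_split (s t)).
have sE : s = (fun t => mwiden (f t).1 + 'X_ord_max * (f t).2).
  by apply: funext => u'; case: (fP u').
rewrite sE sumE in Js.
have J''e : J'' (mesym n int k.+1) by apply: (ts_eq tJ'' (JJ'' _ Je)).
have f0 : forall t, (f t).1 = 0.
  apply: (ind (fun t => (f t).1)).
  have := tsB tJ'' (JJ'' _ Js) (tsMr tJ'' (\sum_t esym_eval (f t).2 * b t) J''e).
  by rewrite addrK.
have f1 : forall t, (f t).2 = 0.
  apply: (IH (fun t => (f t).2)) => [t' m m2|].
    by case: (fP t') => _ /(_ d (sd t')); apply.
  move: Js; rewrite big1 ?add0r => [Je2|t' _]; last by rewrite f0 rmorph0 mul0r.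
  apply: nzd; apply: (ts_eq tJ _ Je2); rewrite -mulrBl; apply: tsMr => //.
  exact: ts_sub.
by rewrite sE f0 f1 mulr0 addr0 rmorph0.
Qed.

Lemma colour_ideal_split r c r'' c'' (u : 'X_{1..n}) (p : R) :
  (forall m, hits r'' c'' m -> hits r c m \/ (u <= m)%MM) ->
  colour_ideal r'' c'' p -> exists p1 q,
    [/\ colour_ideal r c p1, (msize ('X_[u] * q) <= msize p)%N & p = p1 + 'X_[u] * q].
Proof.
move=> hu p''; have [p1 [p2 [pE p1P p2P]]] := mpoly_split (hits r c) p.
have [q qE] : exists q, p2 = 'X_[u] * q.
  by apply: mpoly_divX => m /p2P[/p''/hu[->|]].
exists p1, q; split; first by move=> m /p1P[].
  by rewrite -qE; apply/msize_leP => m /p2P[/msize_mdeg_lt].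
by rewrite -qE.
Qed.

Lemma quot_free_unit k (J : R -> Prop) : (forall p, J p) -> quot_free k J.
Proof.
move=> Jall; exists void, (fun t : void => match t with end).
by split=> [d p _|s _ []]; exists (fun t : void => match t with end); split=> [[]|].
Qed.

Lemma quot_free_const (J : R -> Prop) : two_sided_ideal J ->
  (forall p, J p <-> p@_0 = 0) -> quot_free 0 J.
Proof.
move=> tJ JE; have evC (c : int) : esym_eval (c%:MP : {mpoly int[0]}) = c%:MP.
  by rewrite /esym_eval comp_mpolyC.
have sumE (F : unit -> R) : \sum_t F t = F tt by rewrite (big_pred1 tt) // => -[].
exists unit, (fun=> 1); split=> [d p pd|s].
  exists (fun=> (p@_0)%:MP); split=> [_|]; last first.
    by apply/JE; rewrite sumE evC mulr1 mcoeffB mcoeffC eqxx mulr1 subrr.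
  rewrite evC mulr1; apply/msize_leP => m; rewrite msuppC.
  case: eqP => // /eqP p0; rewrite inE => /eqP->.
  by apply: (elimT (msize_leP _ _) pd); rewrite mcoeff_msupp.
rewrite sumE mulr1 [s tt]nvar0_mpolyC evC => /JE.
by rewrite mcoeffC eqxx mulr1 => s0 []; rewrite [s tt]nvar0_mpolyC s0 mpolyC0.
Qed.

(** Removing one index from a colour class of size at least two, or shrinking
    that class to the index, gives the two outer terms of the exact sequence
    0 -> R/(J : U_i) -> R/J -> R/(J + U_i) -> 0. *)
Lemma colour_ideal_free_ext k r c (i : 'I_n) : (0 < c i <= r)%N ->
  quot_free k (colour_ideal r (fun l => if l == i then 0%N else c l)) ->
  quot_free k (colour_ideal r (fun l => if (c l == c i) && (l != i) then 0%N else c l)) ->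
  quot_free k (colour_ideal r c).
Proof.
move=> ci; apply: (@quot_free_ext _ _ _ _ i) => // [p|p Jp m /Jp||p].
- split=> [Jp m pm|Jp m].
    have /Jp/hitsP[s rs cs] : (U_(i) + m)%MM \in msupp ('X_i * p).
      by apply/msupp_mulX; exists m.
    apply/hitsP; exists s => // l; case: eqP => [_ s0|/eqP li /cs].
      by rewrite -s0 in rs.
    by rewrite mnmDE mnm1E eq_sym (negPf li).
  move/msupp_mulX => [m1 /Jp/hitsP[s rs cs] ->]; apply/hitsP; exists s => // l cl.
  rewrite mnmDE mnm1E eq_sym; have := cs l; case: (l == i) => [_|/(_ cl)]; lia.
- move/hitsP=> [s rs cs]; apply/hitsP; exists s => // l.
  by case: ifP => [_ s0|_ /cs //]; rewrite -s0 in rs.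
- apply: colour_idealX; apply/hitsP; exists (c i) => // l.
  rewrite mnm1E; case: (eqVneq l i) => [->|li]; first by rewrite eqxx.
  by case: eqP => //= _ ci0; rewrite -ci0 in ci.
- apply: colour_ideal_split => m /hitsP[s rs cs].
  have [sc|sc] := eqVneq s (c i).
    right; apply/mnm_lepP => l; rewrite mnm1E; case: eqP => // <-.
    by apply: cs; rewrite !eqxx.
  left; apply/hitsP; exists s => // l cl; apply: cs.
  by rewrite cl (negPf sc).
Qed.

(** When every class is a singleton, R/J is a polynomial ring in the uncoloured
    variables, and the elementary symmetric polynomial whose degree is their
    number acts on it as their product. *)
Lemma colour_ideal_free_lift k r c : (r + k.+1 = n)%N ->
  (forall s, (0 < s <= r)%N -> exists i, c i = s) ->
  (forall i j, (0 < c i <= r)%N -> c i = c j -> i = j) ->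
  quot_free k (colour_ideal r.+1 (fun l => if (0 < c l <= r)%N then c l else r.+1)) ->
  quot_free k.+1 (colour_ideal r c).
Proof.
move=> rk surj inj; pose u : 'X_{1..n} := [multinom ~~ (0 < c i <= r)%N : nat | i < n].
have uE i : u i = ~~ (0 < c i <= r)%N by rewrite mnmE.
have nhit m : ~~ hits r c m -> forall i, (0 < c i <= r)%N -> m i = 0%N.
  move=> nh i ci; apply/eqP; rewrite -leqn0 leqNgt; apply: contra nh => mi.
  by apply/hitsP; exists (c i) => // j cj; rewrite -(inj i j).
have du : mdeg u = k.+1.
  have cr : #|[set i | (0 < c i <= r)%N]| = r.
    pose f (s : 'I_r) := projT1 (cid (surj s.+1 (ltn_ord s))).
    have fE s : c (f s) = s.+1 by rewrite /f; case: cid.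
    have finj : injective f.
      by move=> s t lstate; apply: val_inj; apply: succn_inj; rewrite -!fE lstate.
    rewrite -[RHS](card_ord r) -(card_imset _ finj); apply: eq_card => i; rewrite inE.
    apply/idP/imsetP => [ci|[s _ ->]]; last by rewrite fE /=.
    have ci' : ((c i).-1 < r)%N by lia.
    exists (Ordinal ci') => //; apply: inj => //; rewrite fE /=; lia.
  have := cardsC [set i | (0 < c i <= r)%N]; rewrite cr card_ord -[RHS]rk => /addnI <-.
  rewrite mdegE -sum1_card [RHS]big_mkcond /=; apply: eq_bigr => i _.
  by rewrite uE !inE; case: (_ <= _)%N.
(* a term of e_k that avoids all the coloured variables is the product u *)
apply: (@quot_free_lift _ _ _ u) => //.
- move=> m; rewrite mcoeff_msupp mcoeffB mcoeff_mesym mcoeffX => em.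
  apply/negPn/negP => nh; case/negP: em; rewrite subr_eq0.
  suff -> : mechar k.+1 m = (u == m) by [].
  apply/idP/eqP => [/andP[/eqP dm /forallP m1]|<-]; last first.
    by rewrite /mechar du eqxx; apply/forallP => i; rewrite uE; case: (~~ _).
  have le : forall i, (m i <= u i)%N.
    move=> i; rewrite uE; case ci: (0 < c i <= r)%N; first by rewrite (nhit _ nh).
    exact: m1.
  apply/mnmP => i; have : (\sum_i (u i - m i) == 0)%N.
    rewrite -(eqn_add2r (\sum_i m i)) -big_split /= add0n -mdegE dm -du mdegE.
    by apply/eqP/eq_bigr => j _; rewrite subnK.
  rewrite sum_nat_eq0 => /forallP/(_ i) /=; rewrite subn_eq0 => ui; apply/eqP.
  by rewrite eqn_leq ui le.
- move=> p Jp m pm; have /Jp/hitsP[s rs cs] : (u + m)%MM \in msupp ('X_[u] * p).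
    by apply/msupp_mulX; exists m.
  by apply/hitsP; exists s => // i ci; have := cs i ci; rewrite mnmDE uE ci rs.
- move=> p Jp m /Jp/hitsP[s rs cs]; apply/hitsP; exists s; first lia.
  move=> i; case: ifP => [_ /cs //|_ sr]; lia.
- apply: colour_idealX; apply/hitsP; exists r.+1; first lia.
  by move=> i; rewrite uE; case: ifP => // ci; lia.
- move=> p; apply: colour_ideal_split => m /hitsP[s rs cs].
  have [sr|sr] := eqVneq s r.+1.
    right; apply/mnm_lepP => i; rewrite uE; case ci: (0 < c i <= r)%N => //=.
    by apply: cs; rewrite ci.
  left; apply/hitsP; exists s; first lia.
  by move=> i ci; apply: cs; rewrite ci; case: ifP => //; lia.
Qed.

(** By induction on the number of coloured indices the classes may be assumed to
    be singletons; for k > 0 the uncoloured variables are then given one more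
    colour and k decreases, and for k = 0 the quotient is Z.  If a class is empty
    the quotient is zero. *)
Theorem colour_ideal_free k r c : (r + k = n)%N -> quot_free k (colour_ideal r c).
Proof.
elim: k r c => [|k IHk] r c; have [N] := ubnP #|[set i | (0 < c i <= r)%N]|;
  elim: N c => // N IHN c; rewrite ltnS => cN rk.
all: have [[s rs sn]|surj] := pselect (exists2 s, (0 < s <= r)%N & forall i, c i <> s);
  first by apply: quot_free_unit => p m _; apply/hitsP; exists s => // i /sn.
all: have {}surj : forall s, (0 < s <= r)%N -> exists i, c i = s by
  move=> s rs; apply: contrapT => sn; apply: surj; exists s => // i ci; apply: sn; exists i.
all: have [[i [j [ci cij ij]]]|inj] := pselect (exists i j, [/\ (0 < c i <= r)%N, c i = c j & i <> j]);
  first by apply: (colour_ideal_free_ext ci); apply: IHN => //; apply: leq_trans cN;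
  apply: proper_card; apply/properP; split;
  [ by apply/subsetP => l; rewrite !inE; case: ifP
  | by exists i; rewrite !inE ?eqxx ?ci
  | by apply/subsetP => l; rewrite !inE; case: ifP
  | by exists j; rewrite !inE -cij ?ci // eqxx; case: eqP ij => // ->; case ].
all: have {}inj : forall i j, (0 < c i <= r)%N -> c i = c j -> i = j by
  move=> i j ci cij; apply: contrapT => ij; apply: inj; exists i, j.
  apply: quot_free_const => // p.
  have all_c i : (0 < c i <= r)%N.
    have f_inj : injective (fun s : 'I_r => projT1 (cid (surj s.+1 (ltn_ord s)))).
      move=> s t; case: cid => x xs; case: cid => y yt /= xy; apply: val_inj.
      by apply: succn_inj; rewrite -xs -yt xy.
    have [|g _ gK] := inj_card_bij f_inj; first by rewrite !card_ord -rk addn0.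
    by rewrite -[i]gK; case: cid => x /= ->; exact: ltn_ord.
  split=> [Jp|p0 m].
    apply/eqP; rewrite mcoeff_eq0; apply/negP => /Jp/hitsP[s /surj[i ci]] /(_ i ci).
    by rewrite mnm0E.
  rewrite mcoeff_msupp => pm; have : m != 0%MM by apply: contraNneq pm => ->; rewrite p0.
  rewrite -mdeg_eq0 mdegE sum_nat_eq0 negb_forall => /existsP[i /= mi].
  by apply/hitsP; exists (c i) => // j /esym/inj <- //; rewrite lt0n.
apply: colour_ideal_free_lift => //; apply: IHk; lia.
Qed.

End Freeness.

(** The coordinates on the basis are linear forms on M, so that they turn a
    vanishing tensor into vanishing coordinates in N', where f is injective. *)
Lemma flat_of_basis (S : comNzRingType) (M : lmodType S) (T : finType) (b : T -> M) :
  (forall m, exists s : T -> S, m = \sum_t s t *: b t) ->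
  (forall s : T -> S, \sum_t s t *: b t = 0 -> forall t, s t = 0) ->
  flat M.
Proof.
move=> span ind N N' f f_inj t t0.
have [c cE] := choice span.
have cU m s : m = \sum_t s t *: b t -> c m = s.
  move=> ms; apply: funext => u; apply/eqP; rewrite -subr_eq0; apply/eqP.
  apply: (ind (fun u => c m u - s u)).
  under eq_bigr do rewrite scalerBl.
  by rewrite sumrB -cE -ms subrr.
have cD m m' u : c (m + m') u = c m u + c m' u.
  rewrite (cU _ (fun u => c m u + c m' u)) //.
  by under eq_bigr do rewrite scalerDl; rewrite big_split /= -!cE.
have cZ a m u : c (a *: m) u = a * c m u.
  rewrite (cU _ (fun u => a * c m u)) //.
  by under eq_bigr do rewrite -scalerA; rewrite -scaler_sumr -cE.
(* the coordinates of the tensor vanish, as those of its image do *)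
have coord0 u : \sum_(p <- t) c p.1 u *: p.2 = 0.
  apply: f_inj; rewrite linear0 linear_sum.
  have := t0 _ (fun m x => c m u *: x); rewrite big_map /= => c0.
  under eq_bigr => p _ do rewrite linearZ; apply: c0.
  split=> [m m' x|m x x'|s m x]; first by rewrite cD scalerDl.
    by rewrite scalerDr.
  by rewrite cZ scalerA mulrC.
move=> P beta [bD bDr bZ].
have b0 x : beta 0 x = 0 by apply: (addrI (beta 0 x)); rewrite -bD !addr0.
have br0 m : beta m 0 = 0 by apply: (addrI (beta m 0)); rewrite -bDr !addr0.
have bS (I : Type) (r : seq I) (F : I -> M) x :
    beta (\sum_(i <- r) F i) x = \sum_(i <- r) beta (F i) x.
  by elim/big_rec2: _ => [|i y1 y2 _ <-].
have bSr (I : Type) (r : seq I) (F : I -> N) m :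
    beta m (\sum_(i <- r) F i) = \sum_(i <- r) beta m (F i).
  by elim/big_rec2: _ => [|i y1 y2 _ <-].
under eq_bigr => p _ do rewrite [p.1]cE bS.
rewrite exchange_big big1 //= => u _.
under eq_bigr => p _ do rewrite bZ.
by rewrite -bSr coord0 br0.
Qed.

(** * Triangular systems of polynomials are regular in every order *)

Lemma ideal_gen_morph (A B : pzRingType) (phi : {rmorphism A -> B})
    (G : A -> Prop) (G' : B -> Prop) :
  (forall g, G g -> ideal_gen G' (phi g)) ->
  forall x, ideal_gen G x -> ideal_gen G' (phi x).
Proof.
move=> GG'; apply: ideal_gen_min => //; have tG := ideal_gen_two_sided G'; split.
- by rewrite rmorph0; exact: ts0.
- by move=> x y Gx Gy; rewrite rmorphB; exact: tsB.
- by move=> a x Gx; rewrite rmorphM; exact: tsMl.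
- by move=> x a Gx; rewrite rmorphM; exact: tsMr.
Qed.

Definition omit (R : Type) (n : nat) (f : 'I_n -> R) (i : 'I_n) (p : R) : Prop :=
  exists2 j, j != i & p = f j.

Section Triangular.
Variable n : nat.
Local Notation R := {mpoly int[n]}.
Variables (g : 'I_n -> R) (d : 'I_n -> nat).
Hypothesis d_gt0 : forall j, (0 < d j)%N.
Hypothesis lead_g : forall j, mlead (g j) = (U_(j) *+ d j)%MM.
Hypothesis leadc_g : forall j, (g j)@_(U_(j) *+ d j) = 1.

(** The exponents below the d_j are kept; the multiples of d_j turn into powers
    of g_j.  The leading monomial of [tri_mon e] is e, which makes these
    polynomials a basis of the ring. *)
Definition tri_mon (e : 'X_{1..n}) : R :=
  'X_[[multinom (e i %% d i)%N | i < n]] * \prod_j g j ^+ (e j %/ d j).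

Definition tri (q : R) : R := \sum_(e <- msupp q) q@_e *: tri_mon e.

Lemma g_neq0 j : g j != 0.
Proof. by apply/eqP => g0; have := leadc_g j; rewrite g0 mcoeff0. Qed.

Lemma lead_tri_mon e : mlead (tri_mon e) = e /\ (tri_mon e)@_e = 1.
Proof.
have p0 : \prod_j g j ^+ (e j %/ d j) != 0.
  by apply/prodf_neq0 => j _; rewrite expf_neq0 ?g_neq0.
have X0 m : 'X_[m] != 0 :> R by rewrite -msize_poly_eq0 msizeX.
have le : mlead (tri_mon e) = e.
  rewrite /tri_mon mleadM // mleadXm mlead_prod => [|j _ _]; last first.
    by rewrite expf_neq0 ?g_neq0.
  apply/mnmP => i; rewrite mnmDE mnmE mnm_sumE (bigD1 i) //= big1 => [|j ji].
    by rewrite mleadX ?g_neq0 // lead_g !mulmnE mnm1E eqxx mul1n addn0 addnC mulnC -divn_eq.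
  by rewrite mleadX ?g_neq0 // lead_g !mulmnE mnm1E (negPf ji).
split=> //; rewrite -[X in _@_X]le /tri_mon mleadM // mleadcM mleadXm mcoeffX eqxx mul1r.
rewrite mlead_prod => [|j _ _]; last by rewrite expf_neq0 ?g_neq0.
rewrite mleadc_prod big1 // => j _; rewrite mleadX ?g_neq0 // mleadcX lead_g.
by rewrite leadc_g expr1n.
Qed.

Lemma triE N q : (msize q <= N)%N ->
  tri q = \sum_(e : 'X_{1..n < N}) q@_e *: tri_mon e.
Proof.
move=> qN; pose I : subFinType _ := 'X_{1..n < N}.
rewrite /tri (big_mksub I) ?msupp_uniq //=; last first.
  by move=> x /msize_mdeg_lt /leq_trans; apply.
by rewrite big_rmcond //= => i /memN_msupp_eq0 ->; rewrite scale0r.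
Qed.

Lemma tri_additive : zmod_morphism tri.
Proof.
move=> p q; pose N := maxn (msize (p - q)) (maxn (msize p) (msize q)).
rewrite !(@triE N) ?leq_max ?leqnn ?orbT // -sumrB.
by apply: eq_bigr => e _; rewrite mcoeffB scalerBl.
Qed.

HB.instance Definition _ := GRing.isZmodMorphism.Build R R tri tri_additive.

Lemma triZ c q : tri (c *: q) = c *: tri q.
Proof.
pose N := maxn (msize (c *: q)) (msize q).
rewrite !(@triE N) ?leq_max ?leqnn ?orbT // scaler_sumr.
by apply: eq_bigr => e _; rewrite mcoeffZ scalerA.
Qed.

Lemma triX e : tri 'X_[e] = tri_mon e.
Proof. by rewrite /tri msuppX big_seq1 mcoeffX eqxx scale1r. Qed.

Lemma tri_monM j e : tri_mon (U_(j) *+ d j + e) = g j * tri_mon e.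
Proof.
rewrite /tri_mon mulrCA; congr (_ * _).
  congr 'X_[_]; apply/mnmP => i; rewrite !mnmE mulmnE mnm1E.
  by case: eqP => [->|_]; rewrite ?mul1n ?modnDl.
rewrite (bigD1 j) //= [in RHS](bigD1 j) //= mulrA; congr (_ * _).
  by rewrite mnmDE mulmnE mnm1E eqxx mul1n divnDl ?dvdnn // divnn d_gt0 exprS.
by apply: eq_bigr => i ij; rewrite mnmDE mulmnE mnm1E eq_sym (negPf ij).
Qed.

Lemma triM j q : tri ('X_[U_(j) *+ d j] * q) = g j * tri q.
Proof.
rewrite [q]mpolyE mulr_sumr [LHS]raddf_sum [in RHS]raddf_sum mulr_sumr /=; apply: eq_bigr => e _.
by rewrite -scalerAr !triZ -mpolyXD !triX tri_monM scalerAr.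
Qed.

Lemma tri_inj q : tri q = 0 -> q = 0.
Proof.
have [-> // | q0 t0] := eqVneq q 0.
have : (tri q)@_(mlead q) = mleadc q.
  rewrite /tri raddf_sum (bigD1_seq (mlead q)) ?mlead_supp ?msupp_uniq //=.
  rewrite mcoeffZ (lead_tri_mon _).2 mulr1 big_seq_cond big1 ?addr0 // => e.
  case/andP=> /msupp_le_mlead; rewrite le_eqVlt => /orP[/eqP-> /eqP//|eq _].
  by rewrite mcoeffZ (mcoeff_gt_mlead (p := tri_mon e)) ?mulr0 // (lead_tri_mon _).1.
by rewrite t0 mcoeff0 => /esym/eqP; rewrite mleadc_eq0 (negPf q0).
Qed.

Lemma tri_surj p : exists q, p = tri q.
Proof.
elim/mleadrect: p => p IH; have [->|p0] := eqVneq p 0; first by exists 0; rewrite raddf0.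
pose p' := p - mleadc p *: tri_mon (mlead p).
have [q qE] : exists q, p' = tri q.
  have [->|p'0] := eqVneq p' 0; first by exists 0; rewrite raddf0.
  apply: IH; rewrite lt_neqAle; apply/andP; split.
    apply: contraNneq p'0 => e; rewrite -mleadc_eq0 e /p' mcoeffB mcoeffZ.
    by rewrite (lead_tri_mon _).2 mulr1 subrr.
  apply: le_trans (mleadB_le _ _) _; rewrite leUx lexx /=.
  by apply: le_trans (mleadZ_le _ _) _; rewrite (lead_tri_mon _).1.
exists (q + mleadc p *: 'X_[mlead p]).
by rewrite raddfD /= triZ triX -qE subrK.
Qed.

(** In the basis above, multiplication by g_i is a shift, and the ideal of the
    other g_j is spanned by a shift-stable part of the basis. *)
Lemma tri_regular i p : ideal_gen (omit g i) (g i * p) -> ideal_gen (omit g i) p.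
Proof.
have tI := ideal_gen_two_sided (omit g i).
pose M (q : R) := forall e, e \in msupp q -> exists2 j, j != i & (d j <= e j)%N.
have MD q q' : M q -> M q' -> M (q + q').
  by move=> Mq Mq' e /msuppD_le; rewrite mem_cat => /orP[/Mq|/Mq'].
have IM x : ideal_gen (omit g i) x -> exists2 q, M q & x = tri q.
  move=> [s [Gs ->]]; rewrite big_seq; elim/big_ind: _.
  - by exists 0; rewrite ?raddf0 // => e; rewrite msupp0.
  - by move=> _ _ [q Mq ->] [q' Mq' ->]; exists (q + q'); [exact: MD | rewrite raddfD].
  move=> t /Gs[j ji ->]; have [q qE] := tri_surj (t.1.1 * t.2).
  exists ('X_[U_(j) *+ d j] * q); last by rewrite triM -qE; ring.
  move=> e /msupp_mulX[e' _ ->]; exists j => //.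
  by rewrite mnmDE mulmnE mnm1E eqxx mul1n leq_addr.
move=> /IM[q Mq]; have [r ->] := tri_surj p; rewrite -triM => /eqP.
rewrite -subr_eq0 -raddfB => /eqP/tri_inj/eqP; rewrite subr_eq0 => /eqP rq.
have Mr : M r.
  move=> e re; have : (U_(i) *+ d i + e)%MM \in msupp q.
    by rewrite -rq; apply/msupp_mulX; exists e.
  by case/Mq=> j ji; rewrite mnmDE mulmnE mnm1E eq_sym (negPf ji); exists j.
rewrite /tri big_seq; apply: ts_sum => // e /Mr[j ji ej].
have -> : e = (U_(j) *+ d j + (e - U_(j) *+ d j))%MM.
  rewrite addmC submK //; apply/mnm_lepP => l; rewrite mulmnE mnm1E.
  by case: eqP => // <-; rewrite mul1n.
rewrite tri_monM -mul_mpolyC; apply: tsMl => //; apply: tsMr => //.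
by apply: ideal_gen_incl; exists j.
Qed.

End Triangular.

(** The same for polynomials in which x_j^(d_j) is the least monomial for the
    lexicographic order: reversing the variables makes it the greatest. *)
Lemma triangular_regular n (f : 'I_n -> {mpoly int[n]}) (d : 'I_n -> nat) i p :
  (forall j, (0 < d j)%N) ->
  (forall j m, m \in msupp (f j) ->
     mdeg m = d j /\ forall l : 'I_n, (j < l)%N -> m l = 0%N) ->
  (forall j, (f j)@_(U_(j) *+ d j) = 1) ->
  ideal_gen (omit f i) (f i * p) -> ideal_gen (omit f i) p.
Proof.
move=> d_gt0 fsupp flead.
pose s : 'S_n := perm (@rev_ord_inj n).
have sE j : s j = rev_ord j by rewrite permE.
have ssym : cancel (@msym n int s) (@msym n int s).
  move=> q; apply/mpolyP => m; rewrite !mcoeff_sym; congr (q@_ _); apply/mnmP => j.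
  by rewrite !mnmE !sE rev_ordK.
pose g j := msym s (f (rev_ord j)).
have msE j e : [multinom (U_(j) *+ e)%MM (s l) | l < n] = (U_(rev_ord j) *+ e)%MM.
  apply/mnmP => l; rewrite mnmE !mulmnE !mnm1E sE.
  by rewrite -[in RHS](inj_eq rev_ord_inj) rev_ordK.
have leadc_g j : (g j)@_(U_(j) *+ d (rev_ord j)) = 1 by rewrite mcoeff_sym msE flead.
have lead_g j : mlead (g j) = (U_(j) *+ d (rev_ord j))%MM.
  apply/eqP; rewrite eq_le; apply/andP; split; last first.
    by apply: msupp_le_mlead; rewrite mcoeff_msupp leadc_g.
  have g0 : g j != 0 by apply/eqP => g0; have := leadc_g j; rewrite g0 mcoeff0.
  have := mlead_supp g0; move: (mlead _) => m.
  rewrite mcoeff_msupp mcoeff_sym -mcoeff_msupp => /fsupp[].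
  rewrite mdeg_mperm => dm ml.
  have {}ml (l : 'I_n) : (l < j)%N -> m l = 0%N.
    move=> lj; have := ml (rev_ord l); rewrite mnmE sE rev_ordK; apply.
    by have := ltn_ord j; move=> /=; lia.
  rewrite le_eqVlt; apply/orP; have [->|ne] := eqVneq m (U_(j) *+ d (rev_ord j))%MM; [by left|right].
  apply/ltmcP; first by rewrite dm mdegMn mdeg1 mul1n.
  exists j => [l lj|]; first by rewrite (ml _ lj) mulmnE mnm1E; case: eqP lj => // ->; rewrite ltnn.
  rewrite mulmnE mnm1E eqxx mul1n -dm ltn_neqAle; apply/andP; split; last first.
    by rewrite mdegE (bigD1 j) //= leq_addr.
  apply: contra ne => /eqP mj; apply/eqP/mnmP => l; rewrite mulmnE mnm1E.
  case: (eqVneq j l) => [<-|jl]; first by rewrite mul1n mj dm.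
  have : (\sum_(l | l != j) m l == 0)%N.
    by move/eqP: mj; rewrite mdegE (bigD1 j) //= -{1}[m j]addn0 eqn_add2l eq_sym.
  by rewrite sum_nat_eq0 => /forallP/(_ l); rewrite eq_sym jl => /eqP.
have fg q : ideal_gen (omit f i) q -> ideal_gen (omit g (rev_ord i)) (msym s q).
  apply: ideal_gen_morph => _ [j ji ->]; apply: ideal_gen_incl.
  by exists (rev_ord j); rewrite ?(inj_eq rev_ord_inj) // /g rev_ordK.
have gf q : ideal_gen (omit g (rev_ord i)) q -> ideal_gen (omit f i) (msym s q).
  apply: ideal_gen_morph => _ [j ji ->]; apply: ideal_gen_incl.
  exists (rev_ord j); last by rewrite /g /= ssym.
  by rewrite -(inj_eq rev_ord_inj) rev_ordK.
move/fg; rewrite msymM -[X in msym s (f X)]rev_ordK => /(tri_regular _ lead_g leadc_g).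
by move=> H; rewrite -[p]ssym; apply: gf; apply: H.
Qed.

(** * Complete homogeneous and elementary symmetric polynomials *)

Section HomogeneousSums.
Variable n : nat.
Local Notation R := {mpoly int[n]}.

Definition mon_sum (P : pred 'X_{1..n}) (d : nat) : R :=
  \sum_(m : 'X_{1..n < d.+1} | (mdeg m == d) && P m) 'X_[m].

Lemma mcoeff_mon_sum P d m : (mon_sum P d)@_m = ((mdeg m == d) && P m)%:R.
Proof.
rewrite /mon_sum raddf_sum /=; have [/andP[/eqP dm Pm]|nm] := boolP (_ && _).
  have md : (mdeg m < d.+1)%N by rewrite dm.
  rewrite (bigD1 (BMultinom md)) /=; last by rewrite dm eqxx.
  rewrite mcoeffX eqxx big1 ?addr0 // => m' /andP[_ m'm].
  by rewrite mcoeffX; move: m'm; rewrite -val_eqE /= => /negPf->.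
rewrite big1 // => m' Pm'; rewrite mcoeffX; case: eqP => // m'm.
by rewrite -m'm Pm' in nm.
Qed.

Lemma mcoeff_hpoly d r m :
  (hpoly n d r)@_m = ((mdeg m == d) && [forall i : 'I_n, (r <= i)%N ==> (m i == 0%N)])%:R.
Proof.
exact: (mcoeff_mon_sum (fun m => [forall i : 'I_n, (r <= i)%N ==> (m i == 0%N)])).
Qed.

(** The d-th elementary symmetric polynomial in the variables of index >= i. *)
Definition etail (d i : nat) : R := mon_sum (fun m => [forall j : 'I_n, m j <= (i <= j)]%N) d.

Lemma mcoeffXM i (p : R) m :
  ('X_i * p)@_m = if (0 < m i)%N then p@_(m - U_(i)) else 0.
Proof.
rewrite mulrC; case: ifPn => [mi|].
  rewrite -[in LHS](@submK _ U_(i) m); first by rewrite addmC mcoeffMX.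
  by rewrite lep1mP -lt0n.
rewrite -eqn0Ngt => /eqP mi; apply/eqP; rewrite mcoeff_eq0; apply/negP.
by rewrite mulrC => /msupp_mulX[m1 _ mE]; rewrite mE mnmDE mnm1E eqxx in mi.
Qed.

Lemma mdegBU (m : 'X_{1..n}) i d : (0 < m i)%N -> (mdeg (m - U_(i)) == d) = (mdeg m == d.+1).
Proof.
move=> mi; rewrite -[in RHS](@submK _ U_(i) m) ?lep1mP -?lt0n // mdegD mdeg1 addn1.
by rewrite eqSS.
Qed.

Lemma hpolyS d (i : 'I_n) : hpoly n d.+1 i.+1 = hpoly n d.+1 i + 'X_i * hpoly n d i.+1.
Proof.
apply/mpolyP => m; rewrite mcoeffD mcoeffXM !mcoeff_hpoly; have [mi|] := ltnP.
  have -> : [forall j : 'I_n, (i <= j)%N ==> (m j == 0%N)] = false.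
    by apply/negbTE/forallPn; exists i; rewrite leqnn /= -lt0n.
  rewrite andbF add0r mdegBU //; congr (_ && _)%:R; apply: eq_forallb => j.
  by rewrite mnmBE mnm1E; case: (eqVneq i j) => [<-|]; rewrite ?ltnn ?subn0.
rewrite leqn0 addr0 => /eqP mi; congr (_ && _)%:R; apply: eq_forallb => j.
by rewrite [in RHS]leq_eqVlt; have [/ord_inj <-|//] := eqVneq (i : nat) j; rewrite ltnn mi.
Qed.

Lemma etailS d (i : 'I_n) : etail d.+1 i = etail d.+1 i.+1 + 'X_i * etail d i.+1.
Proof.
apply/mpolyP => m; rewrite mcoeffD mcoeffXM !mcoeff_mon_sum; have [mi|] := ltnP.
  have -> : [forall j : 'I_n, m j <= (i < j)]%N = false.
    by apply/negbTE/forallPn; exists i; rewrite ltnn -ltnNge.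
  rewrite andbF add0r mdegBU //; congr (_ && _)%:R; apply: eq_forallb => j.
  rewrite mnmBE mnm1E; case: (eqVneq i j) => [<-|ij]; first by rewrite ltnn leqnn; lia.
  by rewrite subn0 [in RHS]ltn_neqAle (inj_eq (@ord_inj n)) ij.
rewrite leqn0 addr0 => /eqP mi; congr (_ && _)%:R; apply: eq_forallb => j.
by rewrite [(i <= j)%N]leq_eqVlt; have [/ord_inj <-|//] := eqVneq (i : nat) j; rewrite mi.
Qed.

Lemma hpoly0 d : hpoly n d 0 = (d == 0%N)%:R.
Proof.
apply/mpolyP => m; rewrite mcoeff_hpoly -mpolyC_nat mcoeffC -natrM mulnb; congr (nat_of_bool _)%:R.
have [->|m0] := eqVneq m 0%MM.
  by rewrite mdeg0 andbT eq_sym; case: (d == 0%N) => //=; apply/forallP => i; rewrite mnm0E.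
rewrite andbF; apply/negbTE; rewrite negb_and orbC; apply/orP; left.
apply: contra m0 => /forallP m0; apply/eqP/mnmP => i; rewrite mnm0E.
by apply/eqP; have := m0 i.
Qed.

Lemma etail_n d : etail d n = (d == 0%N)%:R.
Proof.
apply/mpolyP => m; rewrite mcoeff_mon_sum -mpolyC_nat mcoeffC -natrM mulnb; congr (nat_of_bool _)%:R.
have [->|m0] := eqVneq m 0%MM.
  by rewrite mdeg0 andbT eq_sym; case: (d == 0%N) => //=; apply/forallP => i; rewrite mnm0E.
rewrite andbF; apply/negbTE; rewrite negb_and orbC; apply/orP; left.
apply: contra m0 => /forallP m0; apply/eqP/mnmP => i; rewrite mnm0E.
by have := m0 i; rewrite [(n <= i)%N]leqNgt ltn_ord leqn0 => /eqP.
Qed.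

Lemma etail0 d : etail d 0 = mesym n int d.
Proof. by apply/mpolyP => m; rewrite mcoeff_mon_sum mcoeff_mesym. Qed.

Lemma hpoly_0 r : hpoly n 0 r = 1.
Proof.
apply/mpolyP => m; rewrite mcoeff_hpoly mcoeff1 mdeg_eq0; congr (nat_of_bool _)%:R.
by case: eqP => //= ->; apply/forallP => i; rewrite mnm0E implybT.
Qed.

Lemma etail_0 i : etail 0 i = 1.
Proof.
apply/mpolyP => m; rewrite mcoeff_mon_sum mcoeff1 mdeg_eq0; congr (nat_of_bool _)%:R.
by case: eqP => //= ->; apply/forallP => j; rewrite mnm0E.
Qed.

(** The generating functions of the h_d(x_1..x_i) and of the e_d(x_(i+1)..x_n)
    satisfy H_i(t) E(-t) = E_i(-t), where E(-t) is 1 modulo the e_d. *)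
Lemma hpoly_etail (E : R -> Prop) : two_sided_ideal E ->
  (forall d, E (mesym n int d.+1)) ->
  forall i d, (i <= n)%N -> E (hpoly n d i - (-1) ^+ d * etail d i).
Proof.
move=> tE Ee; elim=> [|i IH] d.
  rewrite hpoly0 etail0; case: d => [|d] _; last by rewrite sub0r; apply: tsN => //; apply: tsMl.
  by rewrite mesym0E mulr1 subrr; exact: ts0.
elim: d => [|d IHd] ni; first by rewrite hpoly_0 etail_0 mulr1 subrr; exact: ts0.
have Eh := IH d.+1 (ltnW ni); have Ehd := IHd ni.
have := hpolyS d (Ordinal ni); have := etailS d (Ordinal ni); rewrite /= => eS ->.
have -> : hpoly n d.+1 i + 'X_(Ordinal ni) * hpoly n d i.+1 - (-1) ^+ d.+1 * etail d.+1 i.+1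
  = (hpoly n d.+1 i - (-1) ^+ d.+1 * etail d.+1 i)
    + 'X_(Ordinal ni) * (hpoly n d i.+1 - (-1) ^+ d * etail d i.+1).
  by rewrite eS !exprS; ring.
by apply: tsD => //; apply: tsMl.
Qed.

(** The same recursions, run from i = n down to i = 0. *)
Lemma mesym_hpoly (F : R -> Prop) : two_sided_ideal F ->
  (forall d, F (hpoly n d.+1 n)) -> forall d, F (mesym n int d.+1).
Proof.
move=> tF Fh; suff T i d : (i <= n)%N -> F ((-1) ^+ d * etail d (n - i) - hpoly n d (n - i)).
  move=> d; have := T n d.+1 (leqnn n); rewrite subnn etail0 hpoly0 subr0.
  by move/(tsMl tF ((-1) ^+ d.+1)); rewrite mulrA -expr2 sqrr_sign mul1r.
elim: i d => [|i IH] d ni.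
  rewrite subn0 etail_n; case: d => [|d]; last by rewrite mulr0 sub0r; apply: tsN.
  by rewrite hpoly_0 mulr1 subrr; exact: ts0.
case: d => [|d]; first by rewrite hpoly_0 etail_0 mulr1 subrr; exact: ts0.
have ni' : (n - i.+1 < n)%N by lia.
have := hpolyS d (Ordinal ni'); have := etailS d (Ordinal ni'); rewrite /= => ->.
have -> : (n - i.+1).+1 = (n - i)%N by lia.
move=> hE; have -> : hpoly n d.+1 (n - i.+1) =
    hpoly n d.+1 (n - i) - 'X_(Ordinal ni') * hpoly n d (n - i) by rewrite hE addrK.
have -> : (-1) ^+ d.+1 * (etail d.+1 (n - i) + 'X_(Ordinal ni') * etail d (n - i))
     - (hpoly n d.+1 (n - i) - 'X_(Ordinal ni') * hpoly n d (n - i))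
  = ((-1) ^+ d.+1 * etail d.+1 (n - i) - hpoly n d.+1 (n - i))
    - 'X_(Ordinal ni') * ((-1) ^+ d * etail d (n - i) - hpoly n d (n - i)).
  by rewrite exprS; ring.
by apply: tsB => //; [apply: IH | apply: tsMl => //; apply: IH]; lia.
Qed.

End HomogeneousSums.

(** * Homomorphisms between the rings R_b *)

Definition principal (A : pzRingType) (c x : A) : Prop := exists z, x = c * z.

Lemma principal_two_sided (A : comPzRingType) (c : A) : two_sided_ideal (principal c).
Proof.
split; first by exists 0; rewrite mulr0.
- by move=> _ _ [z ->] [z' ->]; exists (z - z'); rewrite mulrBr.
- by move=> a _ [z ->]; exists (a * z); rewrite mulrCA.
- by move=> a _ [z ->]; exists (z * a); rewrite mulrA.
Qed.

Section IdealsIb.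
Variable n : nat.
Local Notation R := {mpoly int[n]}.
Implicit Types (b : 'I_n -> nat) (p q : R) (I : R -> Prop).

(** The sequences b of weights are slow, and so are their minima, which need not
    come from weights. *)
Definition slow b : Prop := forall i j : 'I_n, j = i.+1 :> nat -> (b i <= (b j).+1)%N.

Definition hgen b (i : 'I_n) : R := hpoly n (b i) i.+1.

Lemma Iideal_two_sided b : two_sided_ideal (Iideal b).
Proof. exact: ideal_gen_two_sided. Qed.
Hint Resolve Iideal_two_sided ideal_gen_two_sided : core.

(** In a slow sequence the generators up to index j already produce all the
    higher complete symmetric polynomials in the first j variables, through
    h_(d+1)(x_1..x_j) = h_(d+1)(x_1..x_(j-1)) + x_j h_d(x_1..x_j). *)
Lemma hpoly_above b I (j : 'I_n) d : two_sided_ideal I -> slow b ->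
  (forall l : 'I_n, (l <= j)%N -> I (hgen b l)) -> (b j <= d)%N -> I (hpoly n d j.+1).
Proof.
move=> tI sb; case: j => j jn; elim: j jn d => [|j IH] jn d Ib.
  elim: d => [|d IHd] bd; first by have := Ib _ (leqnn _); rewrite /hgen /=; case: (b _) bd.
  move: bd; rewrite leq_eqVlt => /orP[/eqP bd|bd].
    by have := Ib (Ordinal jn) (leqnn _); rewrite /hgen bd.
  rewrite (hpolyS d (Ordinal jn)) hpoly0 add0r; apply: tsMl => //; exact: IHd.
elim: d => [|d IHd] bd; first by have := Ib _ (leqnn _); rewrite /hgen /=; case: (b _) bd.
move: bd; rewrite leq_eqVlt => /orP[/eqP bd|bd].
  by have := Ib (Ordinal jn) (leqnn _); rewrite /hgen bd.
rewrite (hpolyS d (Ordinal jn)); apply: tsD => //; last by apply: tsMl => //; apply: IHd.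
apply: (IH (ltnW jn)) => [l lj|]; first by apply: Ib; exact: leqW.
by apply: leq_trans bd; exact: (sb (Ordinal (ltnW jn)) (Ordinal jn)).
Qed.

Lemma hgen_Iideal b i : Iideal b (hgen b i).
Proof. by apply: ideal_gen_incl; exists i. Qed.

Lemma Iideal_le b b' p : slow b' -> (forall i, (b' i <= b i)%N) -> Iideal b p -> Iideal b' p.
Proof.
move=> sb' bb'; apply: ideal_gen_min => // _ [i ->]; apply: (hpoly_above _ sb') => // l _.
exact: hgen_Iideal.
Qed.

Definition up b (i : 'I_n) : 'I_n -> nat := fun j => (b j + (j == i))%N.

Lemma hgen_omit b i p : ideal_gen (omit (hgen b) i) p -> Iideal b p.
Proof. by apply: ideal_gen_min => // _ [j ji ->]; exact: hgen_Iideal. Qed.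

Lemma hgen_omit_up b i p : ideal_gen (omit (hgen b) i) p -> Iideal (up b i) p.
Proof.
apply: ideal_gen_min => // _ [j ji ->]; have := hgen_Iideal (up b i) j.
by rewrite /hgen /up (negPf ji) addn0.
Qed.

Lemma Iideal_split b i p : Iideal b p ->
  exists y z, ideal_gen (omit (hgen b) i) y /\ p = y + hgen b i * z.
Proof.
move=> Ip; suff [y [_ [Iy [z ->] ->]]] :
    ideal_sum (ideal_gen (omit (hgen b) i)) (principal (hgen b i)) p by exists y, z.
apply: ideal_gen_min Ip => [|_ [j ->]].
  by apply: ideal_sum_two_sided => //; exact: principal_two_sided.
have [->|ji] := eqVneq j i.
  by apply: ideal_sumR => //; exists 1; rewrite mulr1.
apply: ideal_sumL; first exact: principal_two_sided.
by apply: ideal_gen_incl; exists j.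
Qed.

(** As h_(b_i + 1)(x_1..x_i) = h_(b_i + 1)(x_1..x_(i-1)) + x_i h_(b_i)(x_1..x_i),
    where the first term is generated by the h_(b_j) with j < i, raising b_i by
    one amounts to multiplying the i-th generator by x_i. *)
Lemma hgen_up b i : slow b ->
  ideal_gen (omit (hgen b) i) (hgen (up b i) i - 'X_i * hgen b i).
Proof.
move=> sb; rewrite /hgen /up eqxx addn1 hpolyS addrK.
case: i => -[|i] ni /=; first by rewrite hpoly0; exact: ts0.
apply: (@hpoly_above b _ (Ordinal (ltnW ni))) => //=; last exact: sb.
move=> l li; apply: ideal_gen_incl; exists l => //.
by apply: contraTneq li => ->; rewrite -ltnNge.
Qed.

Lemma Iideal_up_split b i p : slow b -> Iideal (up b i) p ->
  exists y z, ideal_gen (omit (hgen b) i) y /\ p = y + 'X_i * hgen b i * z.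
Proof.
move=> sb /(Iideal_split i)[y [z [Iy ->]]].
exists (y + (hgen (up b i) i - 'X_i * hgen b i) * z), z; split; last by ring.
apply: tsD => //; last by apply: tsMr => //; exact: hgen_up.
apply: ideal_gen_sub Iy => _ [j ji ->]; exists j => //.
by rewrite /hgen /up (negPf ji) addn0.
Qed.

Lemma hgen_supp b i m : m \in msupp (hgen b i) ->
  mdeg m = b i /\ forall l : 'I_n, (i < l)%N -> m l = 0%N.
Proof.
rewrite mcoeff_msupp mcoeff_hpoly; case: andP => [[/eqP dm /forallP ml] _|]; last by rewrite eqxx.
by split=> // l il; have := ml l; rewrite il => /eqP.
Qed.

Lemma hgen_lead b i : (hgen b i)@_(U_(i) *+ b i) = 1.
Proof.
rewrite mcoeff_hpoly mdegMn mdeg1 mul1n eqxx /=.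
have -> //: [forall l : 'I_n, (i < l)%N ==> ((U_(i) *+ b i)%MM l == 0%N)].
apply/forallP => l; apply/implyP => il; rewrite mulmnE mnm1E.
by have [e|] := eqVneq i l; first by rewrite e ltnn in il.
Qed.

(** The i-th generator, and x_i as well, can be the i-th member of a triangular
    system whose other members are the remaining generators. *)
Lemma hgen_regular b i p : (forall j, 0 < b j)%N ->
  ideal_gen (omit (hgen b) i) (hgen b i * p) -> ideal_gen (omit (hgen b) i) p.
Proof.
by move=> b0; apply: (triangular_regular b0); [exact: hgen_supp | exact: hgen_lead].
Qed.

Lemma X_regular b i p : (forall j, 0 < b j)%N ->
  ideal_gen (omit (hgen b) i) ('X_i * p) -> ideal_gen (omit (hgen b) i) p.
Proof.
move=> b0; pose f j := if j == i then 'X_i else hgen b j.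
have fE q : ideal_gen (omit (hgen b) i) q <-> ideal_gen (omit f i) q.
  by split; apply: ideal_gen_sub => _ [j ji ->]; exists j; rewrite /f ?(negPf ji).
have fi : f i = 'X_i by rewrite /f eqxx.
move/fE; rewrite -[in 'X_i * p]fi => fip; apply/fE.
apply: (@triangular_regular n f (fun j => if j == i then 1%N else b j) i) fip.
- by move=> j; case: eqP.
- move=> j m; rewrite /f; case: (eqVneq j i) => [->|_]; last exact: hgen_supp.
  rewrite msuppX inE => /eqP ->; rewrite mdeg1; split=> // l il.
  by rewrite mnm1E; case: eqP il => // ->; rewrite ltnn.
- move=> j; rewrite /f; case: (eqVneq j i) => [->|_]; last exact: hgen_lead.
  by rewrite mulm1n mcoeffX eqxx.
Qed.

Lemma Iideal_step b i p : slow b -> Iideal b p -> Iideal (up b i) ('X_i * p).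
Proof.
move=> sb /(Iideal_split i)[y [z [Iy ->]]]; rewrite mulrDr; apply: tsD => //.
  by apply: tsMl => //; exact: hgen_omit_up.
have -> : 'X_i * (hgen b i * z) =
   hgen (up b i) i * z - (hgen (up b i) i - 'X_i * hgen b i) * z by ring.
apply: tsB => //; apply: tsMr => //; first exact: hgen_Iideal.
exact/hgen_omit_up/hgen_up.
Qed.

Lemma Iideal_step_inj b i p : slow b -> (forall j, 0 < b j)%N ->
  Iideal (up b i) ('X_i * p) -> Iideal b p.
Proof.
move=> sb b0 /(Iideal_up_split sb)[y [z [Iy pE]]].
apply: (@ts_eq _ _ _ p (hgen b i * z)) => //; last by apply: tsMr => //; exact: hgen_Iideal.
apply: (@hgen_omit b i); apply: X_regular => //.
by rewrite mulrBr pE mulrA addrK.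
Qed.

(** If p kills h = h_(b_i)(x_1..x_i) modulo I' + (x_i h), where I' is spanned by
    the other generators, then p is in (x_i) + I' because h is regular. *)
Lemma Iideal_step_hom b i p : slow b -> (forall j, 0 < b j)%N ->
  (forall q, Iideal b q -> Iideal (up b i) (p * q)) ->
  exists z y, Iideal (up b i) y /\ p = 'X_i * z + y.
Proof.
move=> sb b0 /(_ _ (hgen_Iideal b i))/(Iideal_up_split sb)[y [z [Iy pE]]].
exists z, (p - 'X_i * z); split; last by rewrite addrC subrK.
apply: hgen_omit_up; apply: hgen_regular => //.
have -> : hgen b i * (p - 'X_i * z) = p * hgen b i - 'X_i * hgen b i * z by ring.
by rewrite pE addrK.
Qed.

Definition mdiff b b' : 'X_{1..n} := [multinom (b' i - b i)%N | i < n].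

Lemma slow_up b b' i : slow b -> slow b' -> (forall j, b j <= b' j)%N ->
  (b i < b' i)%N -> (forall j : 'I_n, (i < j)%N -> b j = b' j) -> slow (up b i).
Proof.
move=> sb sb' bb' bi above l j jl; rewrite /up.
have := sb l j jl; have := sb' l j jl; have := bb' j; have := bb' l.
case: (eqVneq j i) => [ji|_]; case: (eqVneq l i) => [li|_]; rewrite ?addn0; try lia.
by rewrite (above j) ?li -?jl; move: bi; rewrite -?li; lia.
Qed.

(** One may pass from b to b' >= b through slow sequences, raising each time the
    last entry that is still too small. *)
Lemma slow_ind (P : ('I_n -> nat) -> Prop) b' : slow b' -> P b' ->
  (forall b i, slow b -> slow (up b i) -> (forall j, up b i j <= b' j)%N ->
     P (up b i) -> P b) ->
  forall b, slow b -> (forall j, b j <= b' j)%N -> P b.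
Proof.
move=> sb' Pb' step b; have [N] := ubnP (\sum_j (b' j - b j))%N.
elim: N b => // N IH b; rewrite ltnS => bN sb bb'.
have [e|] := eqVneq [set i | b i < b' i]%N set0.
  suff -> : b = b' by [].
  apply: funext => i; apply/eqP; rewrite eqn_leq bb' leqNgt.
  by apply/negP => bi; have /setP/(_ i) := e; rewrite !inE bi.
case/set0Pn => i0; rewrite inE => bi0.
case: (@arg_maxnP _ i0 (fun i => b i < b' i)%N (fun i : 'I_n => i : nat) bi0) => i bi imax.
have above (j : 'I_n) : (i < j)%N -> b j = b' j.
  move=> ij; apply/eqP; rewrite eqn_leq bb' leqNgt; apply/negP => /imax /=.
  by rewrite leqNgt ij.
have ub j : (up b i j <= b' j)%N.
  by rewrite /up; case: eqP => [->|_] /=; rewrite ?addn1 ?addn0.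
have su := slow_up sb sb' bb' bi above.
apply: (step b i) => //; apply: IH => //; apply: leq_trans bN.
rewrite (bigD1 i) //= [X in (_ < X)%N](bigD1 i) //= {1}/up eqxx addn1.
have -> : (\sum_(j | j != i) (b' j - up b i j) = \sum_(j | j != i) (b' j - b j))%N.
  by apply: eq_bigr => j ji; rewrite /up (negPf ji) addn0.
by rewrite ltn_add2r; lia.
Qed.

Lemma mdiff_up b b' i : (forall j, up b i j <= b' j)%N ->
  'X_[mdiff b b'] = 'X_i * 'X_[mdiff (up b i) b'] :> R.
Proof.
move=> ub; rewrite -mpolyXD; congr 'X_[_]; apply/mnmP => j.
rewrite !mnmE; have := ub j; rewrite /up [j == i]eq_sym.
by case: (i == j); rewrite /= ?addn0; lia.
Qed.

Lemma mdiff_refl b : mdiff b b = 0%MM.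
Proof. by apply/mnmP => i; rewrite mnmE subnn mnm0E. Qed.

Lemma Iideal_raise b b' : slow b' -> slow b -> (forall j, 0 < b j)%N ->
  (forall j, b j <= b' j)%N ->
  [/\ forall p, Iideal b' ('X_[mdiff b b'] * p) <-> Iideal b p
    & forall p, (forall q, Iideal b q -> Iideal b' (p * q)) ->
      exists z y, Iideal b' y /\ p = 'X_[mdiff b b'] * z + y].
Proof.
move=> sb' sb b0 bb'; move: b0; move: b sb bb'; apply: slow_ind => // [_|b i sb su ub IH b0].
  rewrite mdiff_refl mpolyX0; split=> p; rewrite ?mul1r //.
  by exists p, 0; split; [exact: ts0 | rewrite mul1r addr0].
have [IHm IHh] := IH (fun j => leq_trans (b0 j) (leq_addr _ _)).
rewrite (mdiff_up ub); split=> p.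
  rewrite -mulrA mulrCA; split=> [/IHm|Ip]; first exact: Iideal_step_inj.
  by apply/IHm; exact: Iideal_step.
move=> hp; have [q Iq|z [y [Iy pE]]] := IHh p.
  by apply: hp; apply: Iideal_le Iq => // j; exact: leq_addr.
have [q Iq|z' [y' [Iy' zE]]] := @Iideal_step_hom b i z sb b0.
  apply/IHm; rewrite mulrA; apply: (@ts_eq _ _ _ _ (p * q)) => //; last exact: hp.
  rewrite -mulrBl; apply: tsMr => //; apply: ts_sub => //.
  by rewrite pE addrAC subrr add0r.
exists z', ('X_[mdiff (up b i) b'] * y' + y); split; last by rewrite pE zE; ring.
by apply: tsD => //; apply/IHm.
Qed.

Definition bmin b b' : 'I_n -> nat := fun i => minn (b i) (b' i).

Lemma slow_min b b' : slow b -> slow b' -> slow (bmin b b').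
Proof. by move=> sb sb' i j ij; have := sb i j ij; have := sb' i j ij; rewrite /bmin; lia. Qed.

Lemma mdiff_min b b' : mdiff (bmin b b') b' = mdiff b b'.
Proof. by apply/mnmP => i; rewrite !mnmE /bmin; lia. Qed.

Section Pair.
Variables b b' : 'I_n -> nat.
Hypotheses (sb : slow b) (sb' : slow b').
Hypotheses (b0 : forall j, (0 < b j)%N) (b0' : forall j, (0 < b' j)%N).

Let min0 j : (0 < bmin b b' j)%N. Proof. by rewrite leq_min b0 b0'. Qed.
Let min' j : (bmin b b' j <= b' j)%N. Proof. exact: geq_minr. Qed.

Lemma Iideal_colon p : Iideal b' ('X_[mdiff b b'] * p) <-> Iideal (bmin b b') p.
Proof.
have [H _] := Iideal_raise sb' (slow_min sb sb') min0 min'.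
by rewrite -mdiff_min; exact: H.
Qed.

Lemma Iideal_mulX p : Iideal b p -> Iideal b' ('X_[mdiff b b'] * p).
Proof.
by move=> Ip; apply/Iideal_colon; apply: Iideal_le Ip => [|i]; [exact: slow_min | exact: geq_minl].
Qed.

(** A map R_b -> R_b' kills I_b and I_b', hence I_min(b, b') = I_b + I_b'. *)
Lemma Iideal_hom p : (forall q, Iideal b q -> Iideal b' (p * q)) ->
  exists z y, Iideal b' y /\ p = 'X_[mdiff b b'] * z + y.
Proof.
move=> hp; have [_ H] := Iideal_raise sb' (slow_min sb sb') min0 min'.
rewrite -mdiff_min; apply: H => q; move: q; apply: ideal_gen_min => [|_ [i ->]].
  split=> [|x y Ix Iy|a x Ix|a x Ix]; first by rewrite mulr0; exact: ts0.
  - by rewrite mulrBr; exact: tsB.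
  - by rewrite mulrCA; exact: tsMl.
  - by rewrite mulrA; exact: tsMr.
have [bb|bb] := leqP (b i) (b' i).
  by rewrite /bmin (minn_idPl bb); apply: hp; exact: hgen_Iideal.
by rewrite /bmin (minn_idPr (ltnW bb)); apply: tsMl => //; exact: hgen_Iideal.
Qed.

End Pair.
End IdealsIb.
#[export] Hint Resolve Iideal_two_sided ideal_gen_two_sided : core.

(** * The ideal of relations of the Ozsvath-Szabo algebra *)

Section Gaps.
Variables n k : nat.
Local Notation R := {mpoly int[n]}.
Local Notation istate := (istate n k).
Implicit Types x y z : istate.

Definition gaps (x : istate) (i : nat) : nat :=
  #|[set j : 'I_n.+1 | (i <= j)%N && (j \notin val x)]|.

Lemma card_ge (l : nat) : #|[set j : 'I_n.+1 | (l <= j)%N]| = (n.+1 - l)%N.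
Proof.
have [ln|ln] := leqP l n.+1; last first.
  rewrite (_ : [set j | _] = set0) ?cards0; first lia.
  by apply/setP => j; rewrite !inE; have := ltn_ord j; lia.
have f_lt (j : 'I_(n.+1 - l)) : (j + l < n.+1)%N by have := ltn_ord j; lia.
pose f j := Ordinal (f_lt j).
have f_inj : injective f by move=> i j /(congr1 val) /= /addIn /ord_inj.
rewrite -[RHS]card_ord -(card_imset _ f_inj); apply: eq_card => j; rewrite inE.
apply/idP/imsetP => [lj|[i _ ->]]; last by rewrite /= leq_addl.
have jl : (j - l < n.+1 - l)%N by have := ltn_ord j; lia.
by exists (Ordinal jl) => //; apply: ord_inj; rewrite /= subnK.
Qed.

Lemma lo_val (i : 'I_n) : lo i = i :> nat. Proof. by []. Qed.
Lemma hi_val (i : 'I_n) : hi i = i.+1 :> nat. Proof. by rewrite /hi lift0. Qed.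

Lemma gaps_vcount x (i : 'I_n) : (gaps x i.+1 + vcount x i = n - i)%N.
Proof.
have -> : (n - i = n.+1 - i.+1)%N by lia.
rewrite -card_ge -(cardsID (val x)) addnC; congr (_ + _)%N.
  by apply: eq_card => j; rewrite !inE andbC hi_val.
by apply: eq_card => j; rewrite !inE andbC.
Qed.

Lemma gaps_step x (i : 'I_n.+1) : gaps x i = ((i \notin val x) + gaps x i.+1)%N.
Proof.
rewrite /gaps (cardsD1 i) inE leqnn /=; congr (_ + _)%N.
apply: eq_card => j; rewrite !inE ltn_neqAle -(inj_eq (@ord_inj n.+1)) eq_sym.
by rewrite andbA.
Qed.

Lemma gaps_end x : gaps x n.+1 = 0%N.
Proof.
by apply/eqP; rewrite cards_eq0; apply/eqP/setP => j; rewrite !inE leqNgt ltn_ord.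
Qed.

Lemma gaps_anti x i j : (i <= j)%N -> (gaps x j <= gaps x i)%N.
Proof.
move=> ij; apply: subset_leq_card; apply/subsetP => l; rewrite !inE => /andP[jl ->].
by rewrite (leq_trans ij jl).
Qed.

Lemma gaps_eq x y i : (forall j : 'I_n.+1, (i <= j)%N -> (j \in val x) = (j \in val y)) ->
  gaps x i = gaps y i.
Proof.
by move=> xy; apply: eq_card => j; rewrite !inE; case: leqP => //= ij; rewrite xy.
Qed.

Lemma gaps_leS x i : (i <= n)%N -> (gaps x i.+1 <= gaps x i <= (gaps x i.+1).+1)%N.
Proof. by rewrite -ltnS => li; have := gaps_step x (Ordinal li); case: (_ \notin _) => /=; lia. Qed.

Lemma mem_gaps x (i : 'I_n.+1) : (i \in val x) = (gaps x i == gaps x i.+1).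
Proof. by rewrite gaps_step; case: (i \in val x); rewrite ?eqxx //=; lia. Qed.

(** The class of a place is the common number of gaps of x and y from there on,
    and 0 where the two numbers differ.  The s-th class runs from the later of the
    j-th gaps of x and y (excluded) to the earlier of their (j+1)-st gaps, where
    j = n + 1 - k - s; the two states are too far when some class is empty. *)
Definition pair_class (x y : istate) (i : 'I_n) : nat :=
  if gaps x i.+1 == gaps y i.+1 then gaps x i.+1 else 0%N.

Definition class_ideal (x y : istate) : R -> Prop := colour_ideal (n - k) (pair_class x y).

Lemma class_ideal_two_sided x y : two_sided_ideal (class_ideal x y).
Proof. exact: colour_ideal_two_sided. Qed.
Hint Resolve class_ideal_two_sided : core.

Lemma gexp_gaps x y z i :
  ((gexp x y z i).*2 + `|gaps x i.+1 - gaps z i.+1|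
   = `|gaps y i.+1 - gaps z i.+1| + `|gaps x i.+1 - gaps y i.+1|)%N.
Proof.
have := gexp_double x y z i; have := gaps_vcount x i; have := gaps_vcount y i.
have := gaps_vcount z i; have := ltn_ord i.
move: (gexp _ _ _ i) (gaps x _) (gaps y _) (gaps z _) (vcount x i) (vcount y i) (vcount z i).
lia.
Qed.

(** The place of a class for x, z that is not in the class for the pair with y is
    a place where y lies off the interval between x and z, so that its variable
    divides U^gexp. *)
Lemma hits_gexp x y z (m : 'X_{1..n}) (c : 'I_n -> nat) :
  (forall i s, (0 < s)%N -> pair_class x z i = s -> gaps y i.+1 = s -> c i = s) ->
  hits (n - k) c m -> hits (n - k) (pair_class x z) (gexp x y z + m)%MM.
Proof.
move=> cs /hitsP[s sr ms]; apply/hitsP; exists s => // i xz; have s0 : (0 < s)%N by lia.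
rewrite mnmDE; have [ys|ys] := eqVneq (gaps y i.+1) s.
  by rewrite addn_gt0 (ms i) ?orbT //; apply: cs.
have := gexp_gaps x y z i; move: xz; rewrite /pair_class; case: eqP => // *; lia.
Qed.

Lemma class_ideal_mull x y z p : class_ideal y z p -> class_ideal x z ('X_[gexp x y z] * p).
Proof.
move=> Jp m /msupp_mulX[m1 /Jp h ->]; apply: hits_gexp h => i s s0.
rewrite /pair_class; case: (gaps x _ =P _) => [xz xs ys|_ s00]; last by lia.
by rewrite ys -xz xs eqxx.
Qed.

Lemma class_ideal_mulr x y z p : class_ideal x y p -> class_ideal x z ('X_[gexp x y z] * p).
Proof.
move=> Jp m /msupp_mulX[m1 /Jp h ->]; apply: hits_gexp h => i s s0.
rewrite /pair_class; case: (gaps x _ =P _) => [_ xs ys|_ s00]; last by lia.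
by rewrite xs ys eqxx.
Qed.

Definition in_class_ideals (a : B0 n k) : Prop := forall x y, class_ideal x y (bcoef a (x, y)).

Lemma bcoefN (a : B0 n k) u : bcoef (- a) u = - bcoef a u.
Proof. exact: mkB0E. Qed.

Lemma bcoef_sum (I : Type) (r : seq I) (P : pred I) (F : I -> B0 n k) u :
  bcoef (\sum_(i <- r | P i) F i) u = \sum_(i <- r | P i) bcoef (F i) u.
Proof.
by elim/big_rec2: _ => [|i p a _ <-]; rewrite ?bcoef0 ?bcoefD.
Qed.

Lemma in_class_ideals_two_sided : two_sided_ideal in_class_ideals.
Proof.
split.
- by move=> x y; rewrite bcoef0; exact: (ts0 (class_ideal_two_sided _ _)).
- by move=> a b Ja Jb x y; rewrite bcoefD bcoefN; exact: (tsB (class_ideal_two_sided _ _)).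
- move=> a b Jb x z; rewrite bcoefM; apply: (ts_sum (class_ideal_two_sided _ _)) => y _.
  by rewrite mulrCA; apply: (tsMl (class_ideal_two_sided _ _)); apply: class_ideal_mull.
- move=> b a Jb x z; rewrite bcoefM; apply: (ts_sum (class_ideal_two_sided _ _)) => y _.
  by rewrite mulrA; apply: (tsMr (class_ideal_two_sided _ _)); apply: class_ideal_mulr.
Qed.

Lemma class_ideal_empty x z (s p : nat) : (0 < s <= n - k)%N ->
  (s < gaps x p)%N -> (gaps z p.+1 < s)%N -> forall q, class_ideal x z q.
Proof.
move=> sr xp zp q m _; apply/hitsP; exists s => // i; rewrite /pair_class.
case: eqP => [xz xs|]; last by lia.
have [lip|pli] := leqP i.+1 p.
  by have := gaps_anti x lip; lia.
by have := gaps_anti z pli; lia.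
Qed.

Lemma pair_class_sym x y : pair_class x y = pair_class y x.
Proof. by apply: funext => i; rewrite /pair_class eq_sym; case: eqP. Qed.

Definition Rstep (i : 'I_n) x y : bool :=
  [&& lo i \in val x, hi i \notin val x & val y == hi i |: (val x :\ lo i)].
Definition Lstep (i : 'I_n) x y : bool :=
  [&& hi i \in val x, lo i \notin val x & val y == lo i |: (val x :\ hi i)].

Lemma bcoef_sum_fbasis (P : rel istate) x y :
  bcoef (\sum_(p : istate * istate | P p.1 p.2) fbasis p.1 p.2) (x, y) = (P x y)%:R.
Proof.
rewrite bcoef_sum; case Pxy: (P x y); last first.
  rewrite big1 // => -[u v] /= Puv; rewrite fbasisE.
  by case: eqP => //= xu; case: eqP => // yv; rewrite -xu -yv Pxy in Puv.
rewrite (bigD1 (x, y)) //= fbasisE !eqxx big1 ?addr0 // => -[u v] /= /andP[_ ne].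
rewrite fbasisE; case: (x =P u) ne => //= ->; case: (y =P v) => //= ->.
by rewrite eqxx.
Qed.

Lemma bcoef_Rgen i x y : bcoef (Rgen k i) (x, y) = (Rstep i x y)%:R.
Proof. exact: bcoef_sum_fbasis. Qed.
Lemma bcoef_Lgen i x y : bcoef (Lgen k i) (x, y) = (Lstep i x y)%:R.
Proof. exact: bcoef_sum_fbasis. Qed.

Lemma lo_hi (i j : 'I_n) : j = i.+1 :> nat -> lo j = hi i.
Proof. by move=> ij; apply: ord_inj; rewrite hi_val lo_val ij. Qed.
Lemma lo_neq_hi (i : 'I_n) : lo i != hi i.
Proof. by rewrite -(inj_eq (@ord_inj _)) hi_val lo_val neq_ltn leqnn. Qed.
Lemma hi_neq_hi (i j : 'I_n) : j = i.+1 :> nat -> hi j != hi i.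
Proof. by move=> ij; rewrite -(inj_eq (@ord_inj _)) !hi_val ij neq_ltn leqnn orbT. Qed.

Lemma Rstep_Lstep i x y : Rstep i x y = Lstep i y x.
Proof.
have nlh := lo_neq_hi i; apply/and3P/and3P => -[h1 h2 /eqP e].
  split; first by rewrite e !inE eqxx.
    by rewrite e !inE (negPf nlh) eqxx.
  apply/eqP/setP => l; rewrite e !inE.
  by case: (eqVneq l (lo i)) => [->|_] //=; case: (eqVneq l (hi i)) => [->|_] //=; apply/negbTE.
split; first by rewrite e !inE eqxx.
  by rewrite e !inE eq_sym (negPf nlh) eqxx.
apply/eqP/setP => l; rewrite e !inE.
by case: (eqVneq l (hi i)) => [->|_] //=; case: (eqVneq l (lo i)) => [->|_] //=; apply/negbTE.
Qed.

Lemma OSideal_scale p a : OSideal n k a -> OSideal n k (p *: a).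
Proof.
rewrite -[a in p *: a]mul1r B0scaleAl => Ia; apply: (tsMl (ts_memP (OSideal n k))) Ia.
Qed.

Lemma OSideal_fbasis_le x y m m' : (m <= m')%MM ->
  OSideal n k ('X_[m] *: fbasis x y) -> OSideal n k ('X_[m'] *: fbasis x y).
Proof. by move=> mm'; rewrite -(submK mm') mpolyXD -scalerA; exact: OSideal_scale. Qed.

Lemma fbasis_Rgen i x a b : Rstep i a b ->
  fbasis x a * Rgen k i = 'X_[gexp x a b] *: fbasis x b.
Proof.
move=> ab; apply: B0P => -[u v]; rewrite bcoefM bcoefZ (bigD1 a) //= big1 => [|y ya].
  rewrite addr0 bcoef_Rgen !fbasisE eqxx andbT.
  case: (u =P x) => [->|_] /=; last by rewrite mul0r !mulr0.
  have -> : Rstep i a v = (v == b).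
    by case/and3P: ab => h1 h2 /eqP bE; rewrite /Rstep h1 h2 -bE.
  by case: (v =P b) => [->|_]; rewrite ?mul1r ?mulr0.
by rewrite fbasisE (negPf ya) andbF mul0r mulr0.
Qed.

Lemma fbasis_Lgen i x a b : Lstep i a b ->
  fbasis x a * Lgen k i = 'X_[gexp x a b] *: fbasis x b.
Proof.
move=> ab; apply: B0P => -[u v]; rewrite bcoefM bcoefZ (bigD1 a) //= big1 => [|y ya].
  rewrite addr0 bcoef_Lgen !fbasisE eqxx andbT.
  case: (u =P x) => [->|_] /=; last by rewrite mul0r !mulr0.
  have -> : Lstep i a v = (v == b).
    by case/and3P: ab => h1 h2 /eqP bE; rewrite /Lstep h1 h2 -bE.
  by case: (v =P b) => [->|_]; rewrite ?mul1r ?mulr0.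
by rewrite fbasisE (negPf ya) andbF mul0r mulr0.
Qed.

Definition monotone5 (a b c d e : nat) : Prop :=
  [&& a <= b, b <= c, c <= d & d <= e]%N \/ [&& e <= d, d <= c, c <= b & b <= a]%N.

Lemma gexp_between x y z :
  (forall l, (l <= n.+1)%N -> (gaps x l <= gaps y l <= gaps z l)%N
                           \/ (gaps z l <= gaps y l <= gaps x l)%N) -> gexp x y z = 0%MM.
Proof.
move=> h; apply/mnmP => i; have := gexp_gaps x y z i.
have := h i.+1 (leqW (ltn_ord i)); rewrite mnm0E.
move: (gexp _ _ _ i) (gaps x _) (gaps y _) (gaps z _) => g gx gy gz; lia.
Qed.

Lemma Rstep_of_gaps (i : 'I_n) a b :
  gaps a i = gaps a i.+1 -> gaps a i.+1 <> gaps a i.+2 ->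
  (forall l, (l <= n.+1)%N -> gaps b l = (gaps a l - (l == i.+1))%N) -> Rstep i a b.
Proof.
move=> g1 g2 gb; have lin := ltn_ord i.
have := gaps_leS a (i := i.+1) lin => g3.
apply/and3P; split; first by rewrite mem_gaps lo_val g1.
  by rewrite mem_gaps hi_val; apply/eqP.
apply/eqP/setP => l; have ln := ltn_ord l; rewrite !inE !mem_gaps !gb; [|lia|lia].
rewrite -!(inj_eq (@ord_inj _)) hi_val lo_val.
have [li|li] := eqVneq (l : nat) i; first by rewrite li; lia.
have [li'|li'] := eqVneq (l : nat) i.+1; first by rewrite li'; lia.
by rewrite eqSS (negPf li) !subn0.
Qed.

Hypothesis hkn : (k <= n)%N.

Lemma gaps_start x : gaps x 0 = (n - k).+1.
Proof.
have := cardsC (val x); rewrite card_ord (eqP (valP x)) => e.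
have -> : gaps x 0 = #|~: val x| by apply: eq_card => j; rewrite !inE.
by lia.
Qed.

(** The intermediate states of the paths below are prescribed by their numbers
    of gaps; any function with steps 0 and 1 and the right end values occurs. *)
Lemma state_of_gaps (g : nat -> nat) : g 0%N = (n - k).+1 -> g n.+1 = 0%N ->
  (forall i, (i <= n)%N -> (g i.+1 <= g i <= (g i.+1).+1)%N) ->
  exists x, forall i, (i <= n.+1)%N -> gaps x i = g i.
Proof.
move=> g0 gn gS; pose A := [set i : 'I_n.+1 | g i == g i.+1].
have gA i : (i <= n.+1)%N -> #|[set j : 'I_n.+1 | (i <= j)%N && (j \notin A)]| = g i.
  move=> li; have [d] : exists d, (i + d = n.+1)%N by exists (n.+1 - i)%N; lia.
  elim: d i li => [|d IH] i li id.
    rewrite addn0 in id; rewrite id gn; apply/eqP; rewrite cards_eq0.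
    by apply/eqP/setP => j; rewrite !inE leqNgt ltn_ord.
  have lin : (i < n.+1)%N by lia.
  rewrite (cardsD1 (Ordinal lin)) inE leqnn /=.
  rewrite (_ : _ :\ _ = [set j : 'I_n.+1 | (i.+1 <= j)%N && (j \notin A)]); last first.
    apply/setP => j; rewrite !inE [in RHS]ltn_neqAle -(inj_eq (@ord_inj n.+1)) eq_sym.
    by rewrite andbA.
  rewrite IH ?inE /=; [|lia|lia].
  by have := gS i; have [->|] := eqVneq (g i) (g i.+1); lia.
have Ak : #|A| == k.
  have := cardsC A; rewrite card_ord; have := gA 0%N isT; rewrite g0.
  have -> : #|[set j : 'I_n.+1 | (0 <= j)%N && (j \notin A)]| = #|~: A|.
    by apply: eq_card => j; rewrite !inE.
  by move=> -> e; apply/eqP; lia.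
by exists (exist _ A Ak).
Qed.

(** Two consecutive steps move a particle by two places, so that x and z are
    too far. *)
Lemma RR_empty (i j : 'I_n) x y z : j = i.+1 :> nat -> Rstep i x y -> Rstep j y z ->
  exists2 s, (0 < s <= n - k)%N & (s < gaps x i.+1)%N /\ (gaps z i.+2 < s)%N.
Proof.
move=> ij /and3P[xi xhi /eqP yE] /and3P[_ yhj /eqP zE].
have lohi := lo_hi ij; have hihi := hi_neq_hi ij; have nlh := lo_neq_hi j.
have xhj : hi j \notin val x.
  apply: contra yhj => xhj; rewrite yE !inE xhj andbT; apply/orP; right.
  by rewrite -(inj_eq (@ord_inj _)) hi_val lo_val ij; lia.
have zhj : hi j \in val z by rewrite zE !inE eqxx.
have above : gaps x (hi j).+1 = gaps z (hi j).+1.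
  apply: gaps_eq => l; rewrite hi_val ij => jl; rewrite zE yE !inE.
  have ne (m : 'I_n.+1) : (m <= i.+2)%N -> (l == m) = false.
    by move=> mi; apply/negbTE; apply: contraTneq jl => ->; rewrite -leqNgt.
  by rewrite !ne // ?hi_val ?lo_val ?ij //; clear; lia.
have := gaps_step x (hi j); have := gaps_step z (hi j).
have := gaps_step x (hi i); rewrite xhi xhj zhj -above !hi_val ij /= => g1 g2 g3.
have := gaps_anti x (leq0n i.+1); rewrite gaps_start => g4.
by exists (gaps x i.+3).+1; clear -g1 g2 g3 g4; lia.
Qed.

Lemma OSideal_in_class_ideals a : OSideal n k a -> in_class_ideals a.
Proof.
apply: ideal_gen_min; first exact: in_class_ideals_two_sided.
move=> _ [i j ij|i j ij|i u lu hu] x z.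
- rewrite bcoefM; apply: (ts_sum (class_ideal_two_sided _ _)) => y _; rewrite !bcoef_Rgen.
  case xy: (Rstep i x y); last by rewrite mul0r mulr0; exact: (ts0 (class_ideal_two_sided _ _)).
  case yz: (Rstep j y z); last by rewrite !mulr0; exact: (ts0 (class_ideal_two_sided _ _)).
  by have [s sr [h1 h2]] := RR_empty ij xy yz; exact: class_ideal_empty h1 h2 _.
- rewrite bcoefM; apply: (ts_sum (class_ideal_two_sided _ _)) => y _; rewrite !bcoef_Lgen.
  case xy: (Lstep j x y); last by rewrite mul0r mulr0; exact: (ts0 (class_ideal_two_sided _ _)).
  case yz: (Lstep i y z); last by rewrite !mulr0; exact: (ts0 (class_ideal_two_sided _ _)).
  rewrite -!Rstep_Lstep in xy yz; rewrite /class_ideal pair_class_sym.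
  by have [s sr [h1 h2]] := RR_empty ij yz xy; exact: class_ideal_empty h1 h2 _.
rewrite bcoefZ fbasisE.
case: (x =P u) => [->|_]; last by rewrite mulr0; exact: (ts0 (class_ideal_two_sided _ _)).
case: (z =P u) => [->|_]; last by rewrite mulr0; exact: (ts0 (class_ideal_two_sided _ _)).
rewrite mulr1; apply: colour_idealX; apply/hitsP; exists (gaps u i.+1) => [|l].
  have := gaps_step u (hi i); have := gaps_step u (lo i); rewrite lu hu hi_val lo_val.
  by have := gaps_anti u (leq0n i); rewrite gaps_start; lia.
rewrite /pair_class eqxx mnm1E => gl; suff -> : i = l by rewrite eqxx.
have := gaps_step u (hi i); have := gaps_step u (lo i); rewrite lu hu hi_val lo_val /=.
move=> g1 g2; apply: ord_inj; have [li|il|//] := ltngtP i l.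
  by have := gaps_anti u (i := i.+2) (j := l.+1); rewrite gl; lia.
by have := gaps_anti u (i := l.+1) (j := i); rewrite gl; lia.
Qed.

(** If x and y are too far at the class s, some path from x to y that realises
    f_xy without any power of the variables contains two steps in a row. *)
Lemma far_chain x y s q : (0 < s <= n - k)%N -> (q <= n)%N -> (s < gaps x q)%N ->
  gaps y q = s -> (gaps y q.+1 < s)%N ->
  exists (i j : 'I_n) (a b c : istate), [/\ j = i.+1 :> nat, Rstep i a b, Rstep j b c &
    forall l, (l <= n.+1)%N -> monotone5 (gaps x l) (gaps a l) (gaps b l) (gaps c l) (gaps y l)].
Proof.
move=> sr qn xq yq yq1.
have q0 : (0 < q)%N by case: q xq yq {qn yq1} => //; rewrite !gaps_start; lia.
have xS := gaps_leS x; have yS := gaps_leS y.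
have xq1 := xS q qn; have yq1' := yS q qn.
have qn1 : (q.+1 <= n)%N.
  rewrite ltn_neqAle qn andbT; apply/eqP => e.
  by have := gaps_end x; move: xq1 xq; rewrite e; lia.
have yq1E : gaps y q.+1 = s.-1 by lia.
have lowx l : (l <= q)%N -> (gaps x q <= gaps x l)%N by exact: gaps_anti.
have lowy l : (l <= q)%N -> (gaps y q <= gaps y l)%N by exact: gaps_anti.
have highy l : (q < l)%N -> (gaps y l <= gaps y q.+1)%N by exact: gaps_anti.
have := xS q.+1 qn1 => xq2; have := yS q.+1 qn1 => yq2.
have := xS q.-1; have := yS q.-1; rewrite prednK // => ym xm.
(* The first state has gaps at q and q + 1 and a particle at q - 1, which the
   next two states move to q and to q + 1; elsewhere all lie between x and y. *)
pose ga l := if (l <= q)%N then maxn (minn (gaps x l) (gaps y l)) s.+1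
             else if l == q.+1 then s else minn (maxn (gaps x l) (gaps y l)) s.-1.
pose gb l := (ga l - (l == q))%N.
pose gc l := (gb l - (l == q.+1))%N.
have gaL l : (l <= q)%N -> ga l = maxn (minn (gaps x l) (gaps y l)) s.+1.
  by rewrite /ga => ->.
have gaH l : (q.+1 < l)%N -> ga l = minn (maxn (gaps x l) (gaps y l)) s.-1.
  move=> ql; rewrite /ga; have -> : (l <= q)%N = false by lia.
  by have -> : (l == q.+1) = false by lia.
have ga0 : ga 0 = (n - k).+1 by rewrite gaL // !gaps_start; lia.
have gan : ga n.+1 = 0%N by rewrite gaH // !gaps_end; lia.
have gaq : ga q = s.+1 by rewrite gaL // yq; lia.
have gaq1 : ga q.+1 = s by rewrite /ga ltnn eqxx.
have gaq2 : ga q.+2 = s.-1 by rewrite gaH //; lia.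
have gam : ga q.-1 = s.+1 by rewrite gaL ?leq_pred //; lia.
have gaS l : (l <= n)%N -> (ga l.+1 <= ga l <= (ga l.+1).+1)%N.
  move=> ln; have [lq|ql|->] := ltngtP l q; last by rewrite gaq gaq1; lia.
    by have := xS l ln; have := yS l ln; rewrite !gaL //; lia.
  have [lq1|ql1|->] := ltngtP l q.+1; [lia | | by rewrite gaq1 gaq2; lia].
  by have := xS l ln; have := yS l ln; rewrite !gaH //; lia.
have gbS l : (l <= n)%N -> (gb l.+1 <= gb l <= (gb l.+1).+1)%N.
  move=> ln; have := gaS l ln; rewrite /gb.
  have [->|lq] := eqVneq l q; first by rewrite gaq gaq1; case: eqP; lia.
  have [lq'|lq'] := eqVneq l.+1 q; last by lia.
  have -> : l = q.-1 by lia.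
  by rewrite prednK // gam gaq; lia.
have gcS l : (l <= n)%N -> (gc l.+1 <= gc l <= (gc l.+1).+1)%N.
  move=> ln; have := gbS l ln; rewrite /gc /gb.
  have [->|lq] := eqVneq l q; first by rewrite gaq gaq1 ?eqxx; case: eqP; lia.
  have [->|lq'] := eqVneq l q.+1; last by rewrite eqSS (negPf lq); lia.
  by rewrite gaq1 gaq2; lia.
have [a aE] := state_of_gaps ga0 gan gaS.
have gb0 : gb 0 = (n - k).+1 by rewrite /gb ga0; lia.
have gbn : gb n.+1 = 0%N by rewrite /gb gan.
have gc0 : gc 0 = (n - k).+1 by rewrite /gc gb0; lia.
have gcn : gc n.+1 = 0%N by rewrite /gc gbn.
have [b bE] := state_of_gaps gb0 gbn gbS; have [c cE] := state_of_gaps gc0 gcn gcS.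
have iP : (q.-1 < n)%N by lia.
have n1 : (q.-1 <= n.+1)%N by lia.
have n2 : (q <= n.+1)%N by lia.
have n3 : (q.+1 <= n.+1)%N by lia.
have n4 : (q.+2 <= n.+1)%N by lia.
exists (Ordinal iP), (Ordinal qn1), a, b, c; split; first by rewrite /= prednK.
- apply: Rstep_of_gaps; rewrite /= ?prednK //.
  + by rewrite !aE // gam gaq.
  + by rewrite !aE // gaq gaq1; apply/eqP; rewrite gtn_eqF.
  + by move=> l ln; rewrite bE // aE.
- apply: Rstep_of_gaps; rewrite /=.
  + by rewrite !bE // /gb gaq gaq1 eqxx subn1 gtn_eqF ?subn0.
  + rewrite !bE // /gb gaq1 gaq2 !gtn_eqF ?subn0 //.
    by apply/eqP; rewrite gtn_eqF // prednK //; case/andP: sr.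
  + by move=> l ln; rewrite cE // bE.
move=> l ln; rewrite aE // bE // cE // /monotone5 /gc /gb; case/andP: sr => s0 _.
have [lq|ql|e] := ltngtP l q.
- have xl : (s < gaps x l)%N := leq_trans xq (lowx l (ltnW lq)).
  have yl : (s <= gaps y l)%N by rewrite -yq lowy // ltnW.
  rewrite gaL ?(ltnW lq) // !ltn_eqF ?(leq_trans lq) // !subn0.
  by clear -xl yl; lia.
- have := highy l ql; rewrite yq1E subn0.
  have [-> _|lq1 yl] := eqVneq l q.+1; first by rewrite gaq1 subn1 yq1E; clear -xq1 xq s0; lia.
  by rewrite gaH ?subn0; [clear -yl; lia | rewrite ltn_neqAle eq_sym lq1].
- by rewrite e yq gaq ltn_eqF // subn0 subn1; clear -xq; lia.
Qed.

(** Let q be the last place of the class s: a state with gaps at q - 1 and q, at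
    most one away from x and y inside the class and between them elsewhere, turns
    the relation U_q I = 0 into the vanishing of the product over the class. *)
Lemma near_state x y s q : (0 < s <= n - k)%N -> (q <= n)%N -> gaps x q = s ->
  gaps y q = s -> (minn (gaps x q.+1) (gaps y q.+1) < s)%N ->
  exists (i : 'I_n) (a : istate), [/\ lo i \notin val a, hi i \notin val a &
    (gexp x a y + U_(i) <= [multinom (pair_class x y i == s : nat) | i < n])%MM].
Proof.
move=> sr qn xq yq minq.
have q0 : (0 < q)%N by case: q xq {yq qn minq} => //; rewrite gaps_start; lia.
have xS := gaps_leS x; have yS := gaps_leS y.
have := xS q qn => xq1; have := yS q qn => yq1.
have lowx l : (l <= q)%N -> (gaps x q <= gaps x l)%N by exact: gaps_anti.
have lowy l : (l <= q)%N -> (gaps y q <= gaps y l)%N by exact: gaps_anti.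
pose g l := if (l < q)%N then maxn (maxn (gaps x l) (gaps y l)) s.+1
            else minn (gaps x l) (gaps y l).
have gL l : (l < q)%N -> g l = maxn (maxn (gaps x l) (gaps y l)) s.+1 by rewrite /g => ->.
have gH l : (q <= l)%N -> g l = minn (gaps x l) (gaps y l) by rewrite /g ltnNge => ->.
have gS l : (l <= n)%N -> (g l.+1 <= g l <= (g l.+1).+1)%N.
  move=> ln; have := xS l ln; have := yS l ln.
  have [lq|ql|e] := ltngtP l.+1 q; first by rewrite !gL //; lia.
    by rewrite !gH //; lia.
  rewrite (gL l) -?e // (gH l.+1) ?e // xq yq; clear; lia.
have [||a aE] := state_of_gaps _ _ gS.
- by rewrite gL // !gaps_start; lia.
- by rewrite gH ?gaps_end //; lia.
have iP : (q.-1 < n)%N by lia.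
have gq : g q = s by rewrite gH // xq yq minnn.
have gm : g q.-1 = s.+1.
  by have := xS q.-1; have := yS q.-1; rewrite prednK // gL; lia.
have gq1 : g q.+1 = s.-1 by rewrite gH //; lia.
exists (Ordinal iP), a; split.
- by rewrite mem_gaps lo_val /= prednK // !aE ?gm ?gq; lia.
- by rewrite mem_gaps hi_val /= prednK // !aE ?gq1 ?gq; lia.
apply/mnm_lepP => i; rewrite mnmDE mnm1E mnmE -(inj_eq (@ord_inj _)) /=.
have := gexp_gaps x a y i; rewrite aE; last by exact: leqW (ltn_ord i).
have -> : (q.-1 == i :> nat) = (i.+1 == q) by lia.
rewrite /pair_class; have [e|ne] := eqVneq i.+1 q; first by rewrite e gq xq yq !eqxx; lia.
case: (ltnP i.+1 q) => iq; last by rewrite gH //; case: (gaps x _ == _); lia.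
have := lowx i.+1 (ltnW iq); have := lowy i.+1 (ltnW iq); rewrite gL //.
by have [<-|xy] := eqVneq (gaps x i.+1) (gaps y i.+1); lia.
Qed.

Lemma OSideal_class x y s : (0 < s <= n - k)%N ->
  OSideal n k ('X_[[multinom (pair_class x y i == s : nat) | i < n]] *: fbasis x y).
Proof.
move=> sr; have tI := ts_memP (OSideal n k).
(* q is the last place of the class if this is not empty; otherwise it is the
   (j+1)-st gap of one state, and the j-th gap of the other is not before it. *)
have exP : exists i, (i <= n)%N && (s <= minn (gaps x i) (gaps y i))%N.
  by exists 0%N; rewrite !gaps_start minnn; lia.
have ubP i : (i <= n)%N && (s <= minn (gaps x i) (gaps y i))%N -> (i <= n)%N by case/andP.
case: (ex_maxnP exP ubP) => q /andP[qn sq] qmax.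
have minq : (minn (gaps x q.+1) (gaps y q.+1) < s)%N.
  have [qn1|nq] := leqP q.+1 n.
    by rewrite ltnNge; apply/negP => h; have := qmax q.+1; rewrite qn1 h ltnn => /(_ isT).
  have -> : q = n by apply/eqP; rewrite eqn_leq qn -ltnS.
  by rewrite !gaps_end; case/andP: sr.
have := gaps_leS x qn => xq1; have := gaps_leS y qn => yq1.
have xRRy (i j : 'I_n) (a b c : istate) : Rstep i a b -> Rstep j b c -> j = i.+1 :> nat ->
    (forall l, (l <= n.+1)%N -> monotone5 (gaps x l) (gaps a l) (gaps b l) (gaps c l) (gaps y l)) ->
    OSideal n k (fbasis x y).
  move=> ab bc ij ch; have -> : fbasis x y = fbasis x a * (Rgen k i * Rgen k j) * fbasis c y.
    rewrite mulrA (fbasis_Rgen _ ab) -!B0scaleAl (fbasis_Rgen _ bc) -B0scaleAl fbasisM !scalerA.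
    rewrite !gexp_between ?mpolyX0 ?mulr1 ?scale1r // => l ln; have := ch l ln; rewrite /monotone5; lia.
  apply: (tsMr tI); apply: (tsMl tI); apply: ideal_gen_incl; exact: OSrel_RR.
have xLLy (i j : 'I_n) (a b c : istate) : Rstep i a b -> Rstep j b c -> j = i.+1 :> nat ->
    (forall l, (l <= n.+1)%N -> monotone5 (gaps y l) (gaps a l) (gaps b l) (gaps c l) (gaps x l)) ->
    OSideal n k (fbasis x y).
  rewrite !Rstep_Lstep => ab bc ij ch.
  have -> : fbasis x y = fbasis x c * (Lgen k j * Lgen k i) * fbasis a y.
    rewrite mulrA (fbasis_Lgen _ bc) -!B0scaleAl (fbasis_Lgen _ ab) -B0scaleAl fbasisM !scalerA.
    rewrite !gexp_between ?mpolyX0 ?mulr1 ?scale1r // => l ln; have := ch l ln; rewrite /monotone5; lia.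
  apply: (tsMr tI); apply: (tsMl tI); apply: ideal_gen_incl; exact: OSrel_LL.
have [xs|xs] := ltnP s (gaps x q).
  have [||i [j [a [b [c [ij ab bc ch]]]]]] := @far_chain x y s q sr qn xs; try lia.
  by apply: OSideal_scale; exact: xRRy ab bc ij ch.
have [ys|ys] := ltnP s (gaps y q).
  have [||i [j [a [b [c [ij ab bc ch]]]]]] := @far_chain y x s q sr qn ys; try lia.
  by apply: OSideal_scale; exact: xLLy ab bc ij ch.
have [||i [a [la ha le]]] := @near_state x y s q sr qn _ _ minq; try lia.
apply: OSideal_fbasis_le le _.
have -> : 'X_[gexp x a y + U_(i)] *: fbasis x y = fbasis x a * ('X_i *: fbasis a a) * fbasis a y.
  rewrite -B0scaleAr -B0scaleAl fbasisM gexp_xyy mpolyX0 scale1r fbasisM scalerA.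
  by rewrite addmC mpolyXD.
apply: (tsMr tI); apply: (tsMl tI); apply: ideal_gen_incl; exact: OSrel_U.
Qed.

(** Hence each component of B(n, k) is a quotient of the polynomial ring by a
    monomial ideal, from which the gradings and flatness can be read off. *)
Theorem OSidealP a : OSideal n k a <-> in_class_ideals a.
Proof.
split=> [|Ja]; first exact: OSideal_in_class_ideals.
have tI := ts_memP (OSideal n k).
have -> : a = \sum_x \sum_y bcoef a (x, y) *: fbasis x y.
  apply: B0P => -[u v]; rewrite !bcoef_sum (bigD1 u) //= bcoef_sum (bigD1 v) //=.
  rewrite bcoefZ fbasisE !eqxx mulr1 !big1 ?addr0 // => [x xu|y yv].
    rewrite bcoef_sum big1 // => y _.
    by rewrite bcoefZ fbasisE [u == x]eq_sym (negPf xu) mulr0.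
  by rewrite bcoefZ fbasisE [v == y]eq_sym (negPf yv) andbF mulr0.
apply: (ts_sum tI) => x _; apply: (ts_sum tI) => y _.
rewrite [bcoef a _]mpolyE scaler_suml big_seq; apply: (ts_sum tI) => m /Ja/hitsP[s sr cs].
rewrite -mul_mpolyC -scalerA; apply: OSideal_scale; apply: OSideal_fbasis_le (OSideal_class x y sr).
by apply/mnm_lepP => i; rewrite mnmE; case: eqP => // /cs.
Qed.

End Gaps.

(** * From weight sequences to states *)

Lemma card_ord_ge (N t : nat) : (\sum_(l < N) (t <= l : nat) = N - t)%N.
Proof.
elim: N => [|N IH]; first by rewrite big_ord0 sub0n.
by rewrite big_ord_recr /= IH; case: leqP; lia.
Qed.

Lemma sum_card_mem (T : finType) (A : {set T}) : (\sum_x (x \in A : nat) = #|A|)%N.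
Proof. by rewrite -sum1_card [RHS]big_mkcond; apply: eq_bigr => x _; case: (x \in A). Qed.

Section Degree.
Variables n k : nat.
Local Notation R := {mpoly int[n]}.
Local Notation istate := (istate n k).
Implicit Types x y z : istate.

(** Pigeonhole: a square-free monomial in the variables of index >= t omits too
    few of them to omit one in each of the first N classes. *)
Lemma multilinear_hits x y (t N : nat) (m : 'X_{1..n}) : (N <= n - k)%N ->
  (forall l : 'I_n, (m l <= (t <= l))%N) ->
  (forall l, (0 < pair_class x y l <= N)%N -> (t <= l)%N) ->
  (n - t < mdeg m + N)%N -> hits (n - k) (pair_class x y) m.
Proof.
move=> Nk ml ct big; apply/negPn/negP => nh; move: big; apply/negP; rewrite -leqNgt.
have ex (s : 'I_N) : exists l, pair_class x y l = s.+1 /\ m l = 0%N.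
  apply: contrapT => nex; case/negP: nh; apply/hitsP; exists s.+1.
    by have := ltn_ord s; lia.
  by move=> l cl; rewrite lt0n; apply/eqP => ml0; apply: nex; exists l.
have [f fP] := choice ex.
have f_inj : injective f.
  by move=> s s' e; apply: ord_inj; have := (fP s).1; rewrite e (fP s').1 => -[].
have <- : #|f @: [set: 'I_N]| = N by rewrite card_imset // cardsT card_ord.
rewrite mdegE -sum_card_mem -big_split -card_ord_ge; apply: leq_sum => l _ /=.
case: imsetP => [[s _ ->]|_]; last by rewrite addn0.
by rewrite (fP s).2 ct // (fP s).1; have := ltn_ord s; lia.
Qed.

Definition state_bseq x (i : 'I_n) : nat := (vcount x i).+1.

Lemma state_bseq_slow x : slow (state_bseq x).
Proof.
move=> i j ij; rewrite /state_bseq; have := gaps_vcount x i; have := gaps_vcount x j.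
have := gaps_leS x (ltn_ord i); rewrite -ij; have := ltn_ord j; lia.
Qed.

(** As max(a, 0) = (a + |a|) / 2, the detour through y increases the sum of the
    positive parts of the jumps by half the increase of their absolute values. *)
Lemma mdiff_state_bseq x y z : (mdiff (state_bseq z) (state_bseq y) + mdiff (state_bseq y) (state_bseq x)
  = gexp x y z + mdiff (state_bseq z) (state_bseq x))%MM.
Proof.
apply/mnmP => i; have := gexp_double x y z i; rewrite !mnmDE !(mnmE (fun _ => _ - _)%N) /state_bseq.
by move: (gexp _ _ _ i) (vcount x i) (vcount y i) (vcount z i) => g vx vy vz; lia.
Qed.

Lemma wseq_card (t : n.-tuple bool) : count_mem true t = #|[set i | tnth t i]|.
Proof.
rewrite -sum1_count big_tuple -sum_card_mem big_mkcond /=; apply: eq_bigr => i _.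
by rewrite inE; case: (tnth t i).
Qed.

Lemma widen_inj : injective (@lo n).
Proof. by move=> i j /(congr1 val) /= /ord_inj. Qed.

Lemma lstate_card (mu : wseq n k) : #|[set lo i | i in [set i | tnth (val mu) i]]| == k.
Proof. by rewrite card_imset; [rewrite -wseq_card (valP mu) | exact: widen_inj]. Qed.

Definition lstate (mu : wseq n k) : istate :=
  exist _ [set lo i | i in [set i | tnth (val mu) i]] (lstate_card mu).

Lemma mem_lstate mu i : (lo i \in val (lstate mu)) = tnth (val mu) i.
Proof. by rewrite /= mem_imset ?inE //; exact: widen_inj. Qed.

Lemma lstate_max mu : ord_max \notin val (lstate mu).
Proof.
apply/imsetP => -[i _ /(congr1 val) /= e]; by have := ltn_ord i; lia.
Qed.

Lemma lstate_inj : injective lstate.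
Proof.
move=> mu nu e; apply/val_inj/eq_from_tnth => i.
by rewrite -!mem_lstate e.
Qed.

Lemma lstate_surj x : left_istate x -> exists mu, x = lstate mu.
Proof.
move=> lx; pose t := [tuple lo i \in val x | i < n].
have memE (j : 'I_n.+1) : (j \in val x) = (j \in [set lo i | i in [set i | tnth t i]]).
  apply/idP/imsetP => [jx|[i]]; last by rewrite inE tnth_mktuple => ix ->.
  have jn : (j < n)%N.
    rewrite ltn_neqAle -ltnS ltn_ord andbT; apply: contra lx => /eqP e.
    by suff <- : j = ord_max by []; exact: ord_inj.
  by exists (Ordinal jn); [rewrite inE tnth_mktuple|]; have -> : lo (Ordinal jn) = j by exact: ord_inj.
have tk : count_mem true t == k.
  rewrite wseq_card -(card_imset _ widen_inj) -(eqP (valP x)); apply/eqP.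
  by apply: eq_card => j; rewrite memE.
by exists (exist _ t tk); apply/val_inj/setP => j; rewrite memE.
Qed.

Lemma bseq_lstate (mu : wseq n k) : Defs.bseq mu = state_bseq (lstate mu).
Proof.
apply: funext => i; rewrite /Defs.bseq /state_bseq add1n; congr _.+1.
rewrite /vcount -(card_imset _ widen_inj); apply: eq_card => j; rewrite !inE hi_val.
apply/imsetP/andP => [[l]|[/imsetP[l]]].
  rewrite inE => /andP[il tl] ->; split=> //.
  by apply/imsetP; exists l; rewrite ?inE.
by rewrite inE => tl -> il; exists l; rewrite // inE tl andbT.
Qed.

Lemma cpolyE l m : cpoly l m = 'X_[mdiff (state_bseq (lstate l)) (state_bseq (lstate m))] :> R.
Proof.
by rewrite /cpoly mpolyXE_id; apply: eq_bigr => i _; rewrite mnmE !bseq_lstate.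
Qed.

Lemma nth_sorted_le (s : seq nat) (j i : nat) : sorted ltn s -> (j < size s)%N ->
  (nth 0 s j <= i)%N = (j < count (fun p => p <= i) s)%N.
Proof.
elim: s j => // a s IH j; rewrite /= => pa; have sa := path_sorted pa.
have [ai|ia] := leqP a i; first by case: j => [|j] //=; rewrite ltnS => /(IH _ sa); rewrite add1n ltnS.
have gt : all (fun p => ~~ (p <= i))%N s.
  apply: sub_all (order_path_min ltn_trans pa) => p /= ap.
  by rewrite -ltnNge; exact: ltn_trans ia ap.
have -> : count (fun p => p <= i)%N s = 0%N.
  by apply/eqP; rewrite -leqn0 leqNgt -has_count -all_predC.
case: j => [|j] /=; first by rewrite ltnn => _; apply/negbTE; rewrite -ltnNge.
by rewrite ltnS => js; apply/negbTE; exact: (allP gt _ (mem_nth 0%N js)).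
Qed.

Lemma vees_sorted (mu : wseq n k) : sorted ltn (vees mu).
Proof.
apply: (subseq_sorted ltn_trans (s2 := iota 0 n)); last exact: iota_ltn_sorted.
by rewrite -val_enum_ord; apply: map_subseq; exact: filter_subseq.
Qed.

Lemma count_vees (mu : wseq n k) (P : pred nat) :
  count P (vees mu) = #|[set i : 'I_n | P i && ~~ tnth (val mu) i]|.
Proof.
rewrite /vees count_map count_filter -sum1_count big_enum_cond /= -sum_card_mem.
by rewrite big_mkcond /=; apply: eq_bigr => i _; rewrite inE /=; case: (_ && _).
Qed.

Hypothesis hkn : (k <= n)%N.

Lemma mesym_class_ideal x y d : (k < d)%N -> class_ideal x y (mesym n int d).
Proof.
move=> kd m; rewrite mem_msupp_mesym => /andP[/eqP md /forallP m1].
by apply: (multilinear_hits (t := 0) (N := n - k)) => //; lia.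
Qed.

Lemma etail_class_ideal x y (i : 'I_n) :
  class_ideal x y (etail n (minn (vcount x i) (vcount y i)).+1 i.+1).
Proof.
move=> m; rewrite mcoeff_msupp mcoeff_mon_sum.
case: andP => [[/eqP md /forallP m1] _|]; last by rewrite eqxx.
have := gaps_vcount x i; have := gaps_vcount y i.
have := gaps_anti x (leq0n i.+1); have := gaps_anti y (leq0n i.+1).
rewrite !gaps_start // => y0 x0 yv xv; have := ltn_ord i => lin.
apply: (multilinear_hits (t := i.+1) (N := (maxn (gaps x i.+1) (gaps y i.+1)).-1)) => //.
- by lia.
- move=> l; rewrite /pair_class; case: eqP => // e cl; rewrite ltnNge; apply/negP => li.
  by have := gaps_anti x (i := l.+1) (j := i.+1) li; have := gaps_anti y (i := l.+1) (j := i.+1) li; lia.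
by rewrite md; lia.
Qed.

Definition esym_ideal : R -> Prop := ideal_gen (fun p => exists i : 'I_k, p = mesym n int i.+1).

(** Modulo the e_d, the generator h_(b_i)(x_1..x_i) is, up to sign, the
    elementary polynomial e_(b_i)(x_(i+1)..x_n), which lies in J. *)
Lemma Iideal_sub_esym x y p : Iideal (bmin (state_bseq x) (state_bseq y)) p ->
  ideal_sum (class_ideal x y) esym_ideal p.
Proof.
have tE : two_sided_ideal (ideal_sum (class_ideal x y) esym_ideal).
  by apply: ideal_sum_two_sided; [exact: class_ideal_two_sided | exact: ideal_gen_two_sided].
apply: (ideal_gen_min tE) => _ [i ->]; set E := ideal_sum _ _ in tE *.
have Jx q : class_ideal x y q -> E q.
  by move=> Jq; apply: ideal_sumL => //; exact: ideal_gen_two_sided.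
have Ee d : E (mesym n int d.+1).
  have [dk|kd] := ltnP d k; last by apply: Jx; exact: mesym_class_ideal.
  apply: ideal_sumR; first exact: class_ideal_two_sided.
  by apply: ideal_gen_incl; exists (Ordinal dk).
have -> : bmin (state_bseq x) (state_bseq y) i = (minn (vcount x i) (vcount y i)).+1 by rewrite /bmin minnSS.
apply: (ts_eq tE (hpoly_etail tE Ee _ (ltn_ord i))).
by apply: (tsMl tE); apply: Jx; exact: etail_class_ideal.
Qed.

Lemma mesym_Iideal x y d : left_istate x -> left_istate y ->
  Iideal (bmin (state_bseq x) (state_bseq y)) (mesym n int d.+1).
Proof.
move=> lx ly; apply: (mesym_hpoly (@Iideal_two_sided _ _)) => e.
have h0 r : r = 0%N -> hpoly n e.+1 r = 0 by move=> ->; rewrite hpoly0.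
have [n0|n0] := posnP n; first by rewrite (h0 n n0); exact: (ts0 (Iideal_two_sided _)).
have lastP : (n.-1 < n)%N by rewrite prednK.
have v0 z : left_istate z -> vcount z (Ordinal lastP) = 0%N.
  move=> lz; apply/eqP; rewrite cards_eq0; apply/eqP/setP => j; rewrite !inE hi_val /= prednK //.
  apply/negbTE; apply: contra lz => /andP[jz jn]; suff <- : j = ord_max by [].
  by apply: ord_inj => /=; have := ltn_ord j; lia.
rewrite -[in X in hpoly _ _ X](prednK n0).
apply: (hpoly_above (b := bmin (state_bseq x) (state_bseq y)) (j := Ordinal lastP)).
- exact: Iideal_two_sided.
- by apply: slow_min; exact: state_bseq_slow.
- by move=> l _; exact: hgen_Iideal.
- by rewrite /bmin /state_bseq v0 // v0.
Qed.

Lemma count_vees_le (mu : wseq n k) (i : 'I_n) :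
  (count (fun p => p <= i) (vees mu) + gaps (lstate mu) i.+1 = (n - k).+1)%N.
Proof.
rewrite -(gaps_start hkn (lstate mu)) count_vees -(card_imset _ widen_inj).
have <- : #|[set j : 'I_n.+1 | (j <= i)%N && (j \notin val (lstate mu))]| =
    #|[set lo l | l in [set l : 'I_n | (l <= i)%N && ~~ tnth (val mu) l]]|.
  apply: eq_card => j; rewrite inE; apply/andP/imsetP => [[ji js]|[l]]; last first.
    by rewrite inE => /andP[li tl] ->; rewrite mem_lstate.
  have jn : (j < n)%N := leq_ltn_trans ji (ltn_ord i).
  have jE : j = lo (Ordinal jn) by exact: ord_inj.
  by exists (Ordinal jn); rewrite // inE ji -mem_lstate -jE.
rewrite /gaps -[RHS](cardsID [set j : 'I_n.+1 | (j <= i)%N]); congr (_ + _)%N.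
  by apply: eq_card => j; rewrite !inE andbC.
by apply: eq_card => j; rewrite !inE -ltnNge.
Qed.

Lemma size_vees (mu : wseq n k) : size (vees mu) = (n - k)%N.
Proof.
rewrite -count_predT count_vees; have := cardsC [set i | tnth (val mu) i].
rewrite -wseq_card (eqP (valP mu)) card_ord => e.
rewrite -[X in (X - _)%N]e addKn.
by apply: eq_card => i; rewrite !inE.
Qed.

Lemma gaps_lstate_gt0 mu (i : nat) : (i <= n)%N -> (0 < gaps (lstate mu) i)%N.
Proof.
by move=> ni; apply/card_gt0P; exists ord_max; rewrite inE ni lstate_max.
Qed.

Lemma vee_le (mu : wseq n k) j (i : 'I_n) : (j < n - k)%N ->
  (vee mu j <= i)%N = (gaps (lstate mu) i.+1 <= n - k - j)%N.
Proof.
move=> jk; rewrite /vee nth_sorted_le ?size_vees //; last exact: vees_sorted.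
have := count_vees_le mu i; lia.
Qed.

Lemma alpha_beta (l m : wseq n k) j (i : 'I_n) : (j < n - k)%N ->
  (alpha l m j <= i < beta_succ l m j)%N = (pair_class (lstate l) (lstate m) i == (n - k - j)%N).
Proof.
move=> jk; rewrite /alpha /beta_succ geq_max !vee_le // /pair_class.
have gl := gaps_lstate_gt0 l (ltn_ord i); have gm := gaps_lstate_gt0 m (ltn_ord i).
have -> : (i < if j.+1 < n - k then minn (vee m j.+1) (vee l j.+1) else n)%N =
  (n - k - j.+1 < gaps (lstate l) i.+1)%N && (n - k - j.+1 < gaps (lstate m) i.+1)%N.
  have [jk'|kj] := ltnP j.+1 (n - k); last by rewrite ltn_ord; lia.
  by rewrite leq_min !ltnNge !vee_le // andbC.
have [e|ne] := eqVneq (gaps (lstate l) i.+1) (gaps (lstate m) i.+1); first by rewrite -e; lia.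
lia.
Qed.

End Degree.

(** * The Sartori algebra in coordinates *)

Local Notation Hom := Defs.Hom.

Section HomCoordinates.
Variable n : nat.
Local Notation R := {mpoly int[n]}.

Section Pair.
Variables b b' : 'I_n -> nat.
Implicit Types (phi psi : Hom (Rb b) (Rb b')) (p q : R).

Lemma qpi_scale (I : tsideal R) (a p : R) : a *: (qpi I p : qring I) = qpi I (a * p).
Proof. by rewrite rmorphM. Qed.

Lemma is_mapE phi p : is_map phi p -> forall a, happ phi (qpi _ a) = qpi (Iideal b') (a * p).
Proof.
move=> pp a; rewrite -[a in LHS]mulr1 -qpi_scale /happ linearZ.
by rewrite -/(happ phi (qpi (Iideal b) 1)) pp; exact: qpi_scale.
Qed.

Lemma is_map_inj phi psi p : is_map phi p -> is_map psi p -> phi = psi.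
Proof.
move=> pp qp; apply: homP => u; have [a ->] := qpi_surj u.
by rewrite (is_mapE pp) (is_mapE qp).
Qed.

Lemma is_map_ex phi : exists p, is_map phi p.
Proof. exact: qpi_surj. Qed.

Lemma is_map_hom phi p : is_map phi p -> forall q, Iideal b q -> Iideal b' (p * q).
Proof.
move=> pp q Iq; have : happ phi (qpi (Iideal b) q) = 0.
  have -> : qpi (Iideal b) q = 0 by rewrite -(raddf0 (qpi (Iideal b))); apply/qpi_eq; rewrite subr0.
  by rewrite /happ linear0.
rewrite (is_mapE pp) mulrC -(raddf0 (qpi (Iideal b'))) => /qpi_eq.
by rewrite subr0.
Qed.

Lemma is_map_eq phi p q : is_map phi p -> (is_map phi q <-> Iideal b' (p - q)).
Proof. by move=> pp; rewrite /is_map pp; exact: qpi_eq. Qed.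

Lemma is_map0 : is_map (0 : Hom (Rb b) (Rb b')) 0.
Proof. by rewrite /is_map raddf0. Qed.

Lemma is_mapB phi psi p q : is_map phi p -> is_map psi q -> is_map (phi - psi) (p - q).
Proof. by rewrite /is_map => pp qq; rewrite [RHS]raddfB /= -pp -qq. Qed.

Lemma is_mapD phi psi p q : is_map phi p -> is_map psi q -> is_map (phi + psi) (p + q).
Proof. by rewrite /is_map => pp qq; rewrite [RHS]raddfD /= -pp -qq. Qed.

Lemma is_mapZ phi p c : is_map phi p -> is_map (c *: phi) (c * p).
Proof.
by rewrite /is_map => pp; rewrite -qpi_scale -pp.
Qed.

Lemma is_map_sum (I : Type) (r : seq I) (P : pred I) (F : I -> Hom (Rb b) (Rb b')) (f : I -> R) :
  (forall i, P i -> is_map (F i) (f i)) ->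
  is_map (\sum_(i <- r | P i) F i) (\sum_(i <- r | P i) f i).
Proof.
by move=> Ff; elim/big_rec2: _ => [|i p phi /Ff]; [exact: is_map0 | exact: is_mapD].
Qed.

Lemma hom_exists p : (forall q, Iideal b q -> Iideal b' (p * q)) ->
  exists phi, is_map phi p.
Proof.
move=> hp; pose f (u : Rb b) : Rb b' := qpi (Iideal b') (p * projT1 (cid (qpi_surj u))).
have fE a : f (qpi (Iideal b) a) = qpi (Iideal b') (p * a).
  rewrite /f; case: cid => a' /= /qpi_eq aa'; apply/qpi_eq.
  by rewrite -mulrBr; apply: hp; apply: ts_sub.
have flin : linear f.
  move=> c u v; have [a ->] := qpi_surj u; have [a' ->] := qpi_surj v.
  have -> : c *: qpi (Iideal b) a + qpi (Iideal b) a' = qpi (Iideal b) (c * a + a').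
    by rewrite raddfD qpi_scale.
  by rewrite !fE mulrDr raddfD mulrCA qpi_scale.
pose fL : {linear Rb b -> Rb b'} := HB.pack f (GRing.isLinear.Build _ _ _ _ f flin).
by exists fL; rewrite /is_map /happ /= fE mulr1.
Qed.

End Pair.

Lemma is_map_comp b b' b'' (phi : Hom (Rb b) (Rb b')) (psi : Hom (Rb b') (Rb b'')) (p q : R) :
  is_map phi p -> is_map psi q -> is_map (hcomp psi phi) (q * p).
Proof.
move=> pp qq; rewrite /is_map /happ /= -/(happ phi _) pp.
by rewrite -/(happ psi _) (is_mapE qq) mulrC.
Qed.

End HomCoordinates.

Section SartoriCoordinates.
Variables n k : nat.
Local Notation R := {mpoly int[n]}.
Local Notation wseq := (wseq n k).
Local Notation bq := (@Defs.bseq n k).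
Implicit Types (l m : wseq) (p q : R).

Lemma bq_slow l : slow (bq l). Proof. by rewrite bseq_lstate; exact: state_bseq_slow. Qed.
Lemma bq_gt0 l i : (0 < bq l i)%N. Proof. by rewrite bseq_lstate. Qed.
Lemma cpoly_bq l m : cpoly l m = 'X_[mdiff (bq l) (bq m)] :> R.
Proof. by rewrite cpolyE !bseq_lstate. Qed.
Hint Resolve bq_slow bq_gt0 : core.

Lemma hmap_ex l m p : exists phi : Hom (Rb (bq l)) (Rb (bq m)), is_map phi (p * cpoly l m).
Proof.
apply: hom_exists => q Iq; rewrite -mulrA cpoly_bq; apply: (tsMl (Iideal_two_sided _)).
exact: Iideal_mulX.
Qed.

(** The coordinates on the homomorphisms: every one is of this form. *)
Definition hmap l m p : Hom (Rb (bq l)) (Rb (bq m)) := projT1 (cid (hmap_ex l m p)).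

Lemma is_map_hmap l m p : is_map (hmap l m p) (p * cpoly l m).
Proof. by rewrite /hmap; case: cid. Qed.

Lemma hmap_surj l m (phi : Hom (Rb (bq l)) (Rb (bq m))) : exists p, phi = hmap l m p.
Proof.
have [q pq] := is_map_ex phi.
have [//|//|//|//|z [y [Iy qE]]] := Iideal_hom _ _ _ _ (is_map_hom pq).
exists z; apply: (is_map_inj (p := z * cpoly l m)); last exact: is_map_hmap.
by apply/(is_map_eq _ pq); rewrite cpoly_bq qE mulrC addrAC subrr add0r.
Qed.

Lemma hmap_eq l m p q :
  hmap l m p = hmap l m q <-> Iideal (bmin (state_bseq (lstate l)) (state_bseq (lstate m))) (p - q).
Proof.
have -> : bmin (state_bseq (lstate l)) (state_bseq (lstate m)) = bmin (bq l) (bq m) by rewrite !bseq_lstate.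
apply: iff_trans (Iideal_colon _ _ _ _ (p - q)) => //.
rewrite -cpoly_bq mulrC mulrBl; apply: iff_trans (is_map_eq _ (is_map_hmap l m p)).
by split=> [->|h]; [exact: is_map_hmap | exact: is_map_inj h (is_map_hmap _ _ _)].
Qed.

Lemma hmap_is_zmod l m : zmod_morphism (hmap l m).
Proof.
move=> p q; apply: is_map_inj (is_map_hmap _ _ _) _.
by rewrite mulrBl; apply: is_mapB; exact: is_map_hmap.
Qed.
HB.instance Definition _ l m :=
  GRing.isZmodMorphism.Build R (Hom (Rb (bq l)) (Rb (bq m))) (hmap l m) (@hmap_is_zmod l m).

Lemma hmapZ l m c p : hmap l m (c * p) = c *: hmap l m p.
Proof.
apply: is_map_inj (is_map_hmap _ _ _) _.
by rewrite -mulrA; apply: is_mapZ; exact: is_map_hmap.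
Qed.

(** The monomials x^c compose with the same correction U^gexp as the f_xy. *)
Lemma hmap_comp l o m p q :
  hcomp (hmap o m p) (hmap l o q) = hmap l m ('X_[gexp (lstate m) (lstate o) (lstate l)] * (p * q)).
Proof.
apply: is_map_inj (is_map_hmap _ _ _).
have := is_map_comp (is_map_hmap l o q) (is_map_hmap o m p).
have cpolyM : cpoly o m * cpoly l o = 'X_[gexp (lstate m) (lstate o) (lstate l)] * cpoly l m :> R.
  by rewrite !cpolyE -!mpolyXD addmC mdiff_state_bseq.
by congr is_map; rewrite mulrACA cpolyM; ring.
Qed.

Lemma hmap1 l : hmap l l 1 = hid (Rb (bq l)).
Proof.
apply: is_map_inj (is_map_hmap _ _ _) _.
by rewrite mul1r cpolyE mdiff_refl mpolyX0.
Qed.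

Lemma submod_gen_closed (S : pzRingType) (V : lmodType S) (G : V -> Prop) :
  [/\ submod_gen G 0, (forall v w, submod_gen G v -> submod_gen G w -> submod_gen G (v + w))
    & forall c v, G v -> submod_gen G (c *: v)].
Proof.
split; first by exists [::]; rewrite big_nil.
- move=> _ _ [s [Gs ->]] [t [Gt ->]]; exists (s ++ t); rewrite big_cat; split=> // u.
  by rewrite mem_cat => /orP[/Gs|/Gt].
- move=> c v Gv; exists [:: (c, v)]; rewrite big_seq1; split=> // u.
  by rewrite inE => /eqP ->.
Qed.

Hypothesis hkn : (k <= n)%N.

Lemma class_monomial l m j : (j < n - k)%N ->
  \prod_(i < n | (alpha l m j <= i < beta_succ l m j)%N) 'X_i
  = 'X_[[multinom (pair_class (lstate m) (lstate l) i == n - k - j)%N : nat | i < n]] :> R.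
Proof.
move=> jk; rewrite mpolyXE_id big_mkcond; apply: eq_bigr => i _.
by rewrite mnmE alpha_beta // pair_class_sym; case: (_ == _).
Qed.

Lemma class_monomial_ideal l m j : (j < n - k)%N ->
  class_ideal (lstate m) (lstate l) ('X_[[multinom (pair_class (lstate m) (lstate l) i == n - k - j)%N : nat | i < n]]).
Proof.
move=> jk; apply: colour_idealX; apply/hitsP; exists (n - k - j)%N; first lia.
by move=> i ci; rewrite mnmE ci eqxx.
Qed.

(** The generators of W are the maps given by the products over the classes; when
    l and m are too far one of the classes is empty and J is the whole ring. *)
Lemma WsubP l m (phi : Hom (Rb (bq l)) (Rb (bq m))) :
  Wsub phi <-> exists2 p, class_ideal (lstate m) (lstate l) p & phi = hmap l m p.
Proof.
have tJ := class_ideal_two_sided (lstate m) (lstate l); split.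
  case=> [[j [jk far]]|[s [Gs ->]]].
    have [p ->] := hmap_surj phi; exists p => // t _; apply/hitsP; exists (n - k - j)%N; first lia.
    move=> i ci; have := alpha_beta hkn l m i (ltnW jk); rewrite pair_class_sym ci eqxx.
    rewrite /alpha /beta_succ jk geq_max leq_min => /andP[/andP[h1 h2] /andP[h3 h4]].
    by case: far => far; lia.
  rewrite big_seq; elim/big_rec: _ => [|t phi' /Gs[j [jk tj]] [q Jq ->]].
    by exists 0; [exact: ts0 | rewrite raddf0].
  exists (t.1 * 'X_[[multinom (pair_class (lstate m) (lstate l) i == n - k - j)%N : nat | i < n]] + q).
    by apply: (tsD tJ) => //; apply: (tsMl tJ); exact: class_monomial_ideal.
  rewrite raddfD /= hmapZ; congr (_ *: _ + _); apply: is_map_inj tj _.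
  by rewrite class_monomial //; exact: is_map_hmap.
case=> p Jp ->; right; have [s0 sD sZ] := submod_gen_closed (@Wgen n k l m).
rewrite [p]mpolyE raddf_sum big_seq; elim/big_ind: _ => // t /Jp/hitsP[s sr cs].
pose u : 'X_{1..n} := [multinom (pair_class (lstate m) (lstate l) i == n - k - (n - k - s))%N : nat | i < n].
have su : (n - k - (n - k - s))%N = s by lia.
have ut : (u <= t)%MM.
  by apply/mnm_lepP => i; rewrite mnmE su; case: eqP => // /cs.
rewrite /= -mul_mpolyC -(submK ut) mpolyXD mulrA hmapZ; apply: sZ.
exists (n - k - s)%N; split; first lia.
by rewrite class_monomial; [exact: is_map_hmap | lia].
Qed.

Lemma sartoriW_two_sided : two_sided_ideal (@sartoriW n k).
Proof.
split.
- by move=> l m; apply/WsubP; exists 0; [exact: (ts0 (class_ideal_two_sided _ _)) | rewrite raddf0].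
- move=> a a' Wa Wa' l m; have /WsubP[p Jp aE] := Wa l m; have /WsubP[p' Jp' aE'] := Wa' l m.
  apply/WsubP; exists (p - p'); first exact: (tsB (class_ideal_two_sided _ _)).
  by rewrite raddfB /= -aE -aE'.
- move=> a a' Wa' l m; apply/WsubP.
  have /choice[f fE] o : exists pq, [/\ class_ideal (lstate o) (lstate l) pq.2, a o m = hmap o m pq.1 & a' l o = hmap l o pq.2].
    by have [p pE] := hmap_surj (a o m); have /WsubP[q Jq qE] := Wa' l o; exists (p, q).
  exists (\sum_o 'X_[gexp (lstate m) (lstate o) (lstate l)] * ((f o).1 * (f o).2)).
    apply: (ts_sum (class_ideal_two_sided _ _)) => o _; rewrite mulrCA.
    by apply: (tsMl (class_ideal_two_sided _ _)); apply: class_ideal_mull; case: (fE o).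
  by rewrite raddf_sum; apply: eq_bigr => o _; have [_ -> ->] := fE o; exact: hmap_comp.
- move=> a' a Wa l m; apply/WsubP.
  have /choice[f fE] o : exists pq, [/\ class_ideal (lstate m) (lstate o) pq.1, a o m = hmap o m pq.1 & a' l o = hmap l o pq.2].
    by have [p pE] := hmap_surj (a' l o); have /WsubP[q Jq qE] := Wa o m; exists (q, p).
  exists (\sum_o 'X_[gexp (lstate m) (lstate o) (lstate l)] * ((f o).1 * (f o).2)).
    apply: (ts_sum (class_ideal_two_sided _ _)) => o _; rewrite mulrA.
    by apply: (tsMr (class_ideal_two_sided _ _)); apply: class_ideal_mulr; case: (fE o).
  by rewrite raddf_sum; apply: eq_bigr => o _; have [_ -> ->] := fE o; exact: hmap_comp.
Qed.

End SartoriCoordinates.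

(** * The Ozsvath-Szabo algebra in coordinates *)

Section CornerCoordinates.
Variables n k : nat.
Local Notation R := {mpoly int[n]}.
Local Notation B0 := (B0 n k).
Local Notation e := (left_idem0 n k).
Local Notation OSB := (OSB n k).
Local Notation OSBl := (OSBl n k).
Implicit Types (a c : B0) (x y : istate n k).

Lemma bcoef_e x y : bcoef e (x, y) = ((x == y) && left_istate x)%:R.
Proof.
rewrite bcoef_sum; have [<-|xy] := eqVneq x y; last first.
  rewrite big1 // => z _; rewrite fbasisE; case: eqP => //= <-.
  by rewrite eq_sym (negPf xy).
case lx: (left_istate x); last first.
  rewrite big1 // => z lz; rewrite fbasisE; case: eqP => //= xz.
  by rewrite xz lz in lx.
rewrite (bigD1 x) //= fbasisE eqxx big1 ?addr0 // => z /andP[_ zx].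
by rewrite fbasisE eq_sym (negPf zx).
Qed.

Lemma bcoef_mule a x y : bcoef (a * e) (x, y) = if left_istate y then bcoef a (x, y) else 0.
Proof.
rewrite bcoefM (bigD1 y) //= gexp_xyy mpolyX0 mul1r bcoef_e eqxx big1 => [|z zy].
  by case: ifP; rewrite ?mulr1 ?mulr0 addr0.
by rewrite bcoef_e (negPf zy) !mulr0.
Qed.

Lemma bcoef_emul a x y : bcoef (e * a) (x, y) = if left_istate x then bcoef a (x, y) else 0.
Proof.
rewrite bcoefM (bigD1 x) //= gexp_xxy mpolyX0 mul1r bcoef_e eqxx big1 => [|z zx].
  by case: ifP; rewrite ?mul1r ?mul0r addr0.
by rewrite bcoef_e eq_sym (negPf zx) mul0r mulr0.
Qed.

Lemma bcoef1 x y : bcoef (1 : B0) (x, y) = (x == y)%:R.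
Proof. exact: mkB0E. Qed.

Lemma cval_inj : injective (@cval _ (left_idem n k)).
Proof. exact: val_inj. Qed.

Definition corner_of (c : B0) : OSBl := cproj (left_idem n k) (qpi (OSideal n k) c).

Lemma corner_of_val c : cval (corner_of c) = qpi (OSideal n k) (e * c * e).
Proof. by rewrite !rmorphM. Qed.

Lemma corner_of_eq (b : OSBl) a : cval b = qpi (OSideal n k) a -> b = corner_of a.
Proof.
move=> ba; apply: cval_inj => /=; rewrite -ba; have [eb be] := in_cornerP (cvalP b).
by rewrite eb be.
Qed.

Lemma corner_of_surj (b : OSBl) : exists c, b = corner_of c.
Proof. by have [c bc] := qpi_surj (cval b); exists c; exact: corner_of_eq. Qed.

Lemma corner_of_is_zmod : zmod_morphism corner_of.
Proof. by move=> a c; apply: cval_inj; rewrite /= raddfB mulrBr mulrBl. Qed.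
HB.instance Definition _ := GRing.isZmodMorphism.Build B0 OSBl corner_of corner_of_is_zmod.

Lemma corner_of_congr a c : e * a * e = e * c * e -> corner_of a = corner_of c.
Proof. by move=> ac; apply: cval_inj; rewrite (corner_of_val a) (corner_of_val c) ac. Qed.

Lemma idem_mul (A : pzRingType) (u a c : A) : u * u = u ->
  (u * a * u) * (u * c * u) = u * (a * u * c) * u.
Proof. by move=> uu; rewrite -!mulrA [u * (u * _)]mulrA uu. Qed.

Lemma corner_ofM a c : corner_of a * corner_of c = corner_of (a * e * c).
Proof.
apply: cval_inj; rewrite (corner_of_val (a * e * c)).
have -> : cval (corner_of a * corner_of c) = cval (corner_of a) * cval (corner_of c) by [].
rewrite (corner_of_val a) (corner_of_val c) -rmorphM; congr (qpi _ _).
exact: idem_mul (left_idem0_idem n k).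
Qed.

Lemma corner_of1 : corner_of 1 = 1.
Proof. by apply: cval_inj; rewrite (corner_of_val 1) mulr1 left_idem0_idem. Qed.

Lemma corner_ofZ (p : R) c : corner_of (p *: c) = corner_of (p *: (1 : B0)) * corner_of c.
Proof.
rewrite corner_ofM; apply: corner_of_congr; rewrite -!B0scaleAl mul1r -!B0scaleAr.
by rewrite (mulrA e e) left_idem0_idem.
Qed.

Lemma corner_of_central (p : R) c : corner_of (p *: (1 : B0)) * corner_of c = corner_of c * corner_of (p *: (1 : B0)).
Proof.
rewrite -corner_ofZ corner_ofM; apply: corner_of_congr; rewrite -[c * e * _]B0scaleAr mulr1 -!B0scaleAr -!B0scaleAl.
by rewrite -!mulrA left_idem0_idem.
Qed.

Definition OSB_esym (s : {mpoly int[k]}) : OSBl := corner_of (@esym_eval n k s *: (1 : B0)).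

Lemma corner_scalar_is_zmod : zmod_morphism (fun p : R => corner_of (p *: (1 : B0))).
Proof. by move=> p q; rewrite scalerBl raddfB. Qed.
Lemma corner_scalar_is_monoid : monoid_morphism (fun p : R => corner_of (p *: (1 : B0))).
Proof. by split=> [|p q]; rewrite ?scale1r ?corner_of1 // -scalerA corner_ofZ. Qed.

Definition corner_scalar (p : R) : OSBl := corner_of (p *: (1 : B0)).
HB.instance Definition _ := GRing.isZmodMorphism.Build R OSBl corner_scalar corner_scalar_is_zmod.
HB.instance Definition _ := GRing.isMonoidMorphism.Build R OSBl corner_scalar corner_scalar_is_monoid.
HB.instance Definition _ := GRing.RMorphism.copy OSB_esym (corner_scalar \o @esym_eval n k).

Lemma OSB_esymX (i : 'I_k) : OSB_esym 'X_i = esymU n k i.+1.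
Proof.
rewrite /OSB_esym esym_evalX -/(corner_scalar _) rmorph_sum; apply: eq_bigr => h _.
by rewrite rmorph_prod.
Qed.

Hypothesis hkn : (k <= n)%N.

Lemma corner_of_eq0 c : corner_of c = 0 <->
  forall l m : wseq n k, class_ideal (lstate l) (lstate m) (bcoef c (lstate l, lstate m)).
Proof.
have -> : corner_of c = 0 <-> OSideal n k (e * c * e).
  split=> [c0|Ic].
    have /qpi_eq : qpi (OSideal n k) (e * c * e) = qpi (OSideal n k) 0.
      by rewrite -corner_of_val c0 raddf0.
    by rewrite subr0.
  apply: cval_inj; rewrite corner_of_val /= -(raddf0 (qpi (OSideal n k))).
  by apply/qpi_eq; rewrite subr0.
have ece x y : bcoef (e * c * e) (x, y) =
    if left_istate x && left_istate y then bcoef c (x, y) else 0.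
  by rewrite bcoef_mule bcoef_emul; case: (left_istate x); case: (left_istate y).
rewrite OSidealP //; split=> [Jc l m|Jc x y].
  by have := Jc (lstate l) (lstate m); rewrite ece /left_istate !lstate_max.
rewrite ece; case: ifP => [/andP[/lstate_surj[l ->] /lstate_surj[m ->]]|_]; first exact: Jc.
exact: (ts0 (class_ideal_two_sided _ _)).
Qed.

End CornerCoordinates.

(** * Flatness *)

Section Flatness.
Variables n k : nat.
Hypothesis hkn : (k <= n)%N.
Local Notation R := {mpoly int[n]}.
Local Notation B0 := (B0 n k).

Lemma bcoef_fbasis (l m l' m' : wseq n k) (p : R) :
  bcoef (p *: fbasis (lstate l) (lstate m)) (lstate l', lstate m') = if (l' == l) && (m' == m) then p else 0.
Proof.
by rewrite bcoefZ fbasisE !(inj_eq (@lstate_inj n k)); case: (_ && _); rewrite ?mulr1 ?mulr0.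
Qed.

(** The elements e_s b of the bases of the quotients R/J, one for each pair of
    left states, assemble into a basis of the corner ring. *)
Lemma OSB_esym_flat : flat (via (@OSB_esym n k)).
Proof.
have rk : ((n - k) + k = n)%N by rewrite subnK.
pose D := (wseq n k * wseq n k)%type.
have fr (u : D) := cid (colour_ideal_free (pair_class (lstate u.1) (lstate u.2)) rk).
pose T u := projT1 (fr u).
have fr' (u : D) := cid (projT2 (fr u)).
pose b u := projT1 (fr' u).
have span u d p : (msize p <= d)%N -> exists s : T u -> {mpoly int[k]},
    (forall t, (msize (esym_eval n (s t) * b u t) <= d)%N) /\
    class_ideal (lstate u.1) (lstate u.2) (p - \sum_t esym_eval n (s t) * b u t) by case: (projT2 (fr' u)) => + _; apply.
have ind u (s : T u -> {mpoly int[k]}) :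
    class_ideal (lstate u.1) (lstate u.2) (\sum_t esym_eval n (s t) * b u t) -> forall t, s t = 0.
  by case: (projT2 (fr' u)) => _; apply.
pose B (w : {u : D & T u}) : via (@OSB_esym n k) :=
  corner_of (b (tag w) (tagged w) *: fbasis (lstate (tag w).1) (lstate (tag w).2)).
pose comb (s : {u : D & T u} -> {mpoly int[k]}) : B0 :=
  \sum_w (esym_eval n (s w) * b (tag w) (tagged w)) *: fbasis (lstate (tag w).1) (lstate (tag w).2).
have BE s : \sum_w s w *: B w = corner_of (comb s).
  rewrite raddf_sum; apply: eq_bigr => w _ /=.
  by rewrite -scalerA corner_ofZ.
have combE s l m : bcoef (comb s) (lstate l, lstate m) =
    \sum_(t : T (l, m)) esym_eval n (s (Tagged T t)) * b (l, m) t.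
  pose F (u : D) (t : T u) : R := bcoef ((esym_eval n (s (Tagged T t)) * b u t)
    *: fbasis (lstate u.1) (lstate u.2)) (lstate l, lstate m).
  transitivity (\sum_u \sum_(t : T u) F u t).
    by rewrite sig_big_dep bcoef_sum; apply: eq_bigr => -[u t].
  rewrite (bigD1 (l, m)) //= [X in _ + X]big1 ?addr0 => [|[l' m'] ne].
    by apply: eq_bigr => t _; rewrite /F bcoef_fbasis !eqxx.
  rewrite big1 // => t _; rewrite /F bcoef_fbasis; case: ifP => //= /andP[/eqP e1 /eqP e2].
  by move: ne; rewrite e1 e2 eqxx.
apply: (flat_of_basis (b := B)) => [x|s].
  have [c ->] := corner_of_surj x.
  have sP (u : D) := cid (span u _ (bcoef c (lstate u.1, lstate u.2)) (leqnn _)).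
  pose s u := projT1 (sP u).
  exists (fun w => s (tag w) (tagged w)); rewrite BE; apply/eqP.
  rewrite -[_ == _]/(corner_of c == corner_of _) -subr_eq0 -raddfB; apply/eqP/(corner_of_eq0 hkn) => l m.
  by rewrite bcoefD bcoefN combE; case: (projT2 (sP (l, m))).
rewrite BE => /(corner_of_eq0 hkn) Js [[l m] t].
by apply: (ind (l, m) (fun t => s (Tagged T t))); rewrite -combE.
Qed.

End Flatness.

(** * The projection to the Sartori algebra and its kernel *)

Section Projection.
Variables n k : nat.
Hypothesis hkn : (k <= n)%N.
Local Notation R := {mpoly int[n]}.
Local Notation B0 := (B0 n k).
Local Notation e := (left_idem0 n k).
Local Notation HW := (sartoriW_two_sided hkn).
Local Notation WI := (TSIdeal HW).

(** The indices are exchanged because products of maps are compositions: the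
    coefficient of f_xy becomes a map from R_(b^y) to R_(b^x). *)
Definition hom_of_B0 (c : B0) : sartori_hom n k :=
  (fun l m => hmap l m (bcoef c (lstate m, lstate l))) : hom_ring _.

Lemma hom_ring_ext (D : finType) (M : D -> lmodType R) (x y : hom_ring M) :
  (forall l m, x l m = y l m) -> x = y.
Proof. by move=> xy; apply: hom_ringP => l m u; rewrite xy. Qed.

Lemma hom_of_B0_is_zmod : zmod_morphism hom_of_B0.
Proof.
move=> a c; apply: hom_ringP => l m u; rewrite /hom_of_B0 bcoefD bcoefN raddfB.
by [].
Qed.
HB.instance Definition _ := GRing.isZmodMorphism.Build B0 (sartori_hom n k) hom_of_B0 hom_of_B0_is_zmod.

Lemma hom_of_B0_surj phi : exists c, phi = hom_of_B0 c.
Proof.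
have /choice[f fE] (u : wseq n k * wseq n k) := hmap_surj ((phi : hom_ring _) u.1 u.2).
exists (\sum_u f u *: fbasis (lstate u.2) (lstate u.1)); apply: hom_ring_ext => l m.
rewrite [LHS](fE (l, m)) /hom_of_B0 bcoef_sum (bigD1 (l, m)) //= bcoef_fbasis !eqxx.
rewrite big1 ?addr0 // => -[l' m'] ne; rewrite bcoef_fbasis /=.
by case: ifP => // /andP[/eqP e1 /eqP e2]; move: ne; rewrite e1 e2 eqxx.
Qed.

Lemma sum_left (V : nmodType) (F : istate n k -> V) :
  \sum_(x | left_istate x) F x = \sum_(l : wseq n k) F (lstate l).
Proof.
rewrite (eq_bigl (fun x => x \in [set lstate l | l in [set: wseq n k]])) => [|x].
  rewrite big_imset /=; last by move=> l m _ _; exact: lstate_inj.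
  by apply: eq_bigl => l; rewrite inE.
apply/idP/imsetP => [/lstate_surj[l ->]|[l _ ->]]; first by exists l.
by rewrite /left_istate lstate_max.
Qed.

Lemma hom_of_B0M a c : hom_of_B0 (a * e * c) = hom_of_B0 a * hom_of_B0 c.
Proof.
apply: hom_ring_ext => l m; rewrite /hom_of_B0 bcoefM.
rewrite (eq_bigr (fun y => if left_istate y then 'X_[gexp (lstate m) y (lstate l)]
   * (bcoef a (lstate m, y) * bcoef c (y, lstate l)) else 0)) => [|y _]; last first.
  by rewrite bcoef_mule; case: ifP => _ //; rewrite mul0r mulr0.
rewrite -big_mkcond sum_left raddf_sum; apply: eq_bigr => o _ /=.
exact/esym/hmap_comp.
Qed.

Lemma hom_of_B0_e : hom_of_B0 e = 1.
Proof.
apply: hom_ringP => l m u; rewrite /hom_of_B0 bcoef_e (inj_eq (@lstate_inj n k)) /left_istate lstate_max andbT.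
have [->|ml] := eqVneq m l; first by rewrite hmap1 [RHS]roneE.
by rewrite raddf0 [RHS]roneN // eq_sym.
Qed.

Lemma hom_of_B0_W c : (forall l m : wseq n k, class_ideal (lstate l) (lstate m) (bcoef c (lstate l, lstate m))) ->
  sartoriW (hom_of_B0 c).
Proof. by move=> Jc l m; apply/(WsubP hkn); exists (bcoef c (lstate m, lstate l)). Qed.

(** Elements of the kernel have their coefficients in J + I_min, which is
    J + (e_1, ..., e_k). *)
Lemma W_hom_of_B0 c (l m : wseq n k) : sartoriW (hom_of_B0 c) ->
  ideal_sum (class_ideal (lstate l) (lstate m)) (@esym_ideal n k) (bcoef c (lstate l, lstate m)).
Proof.
move=> /(_ m l)/(WsubP hkn)[p Jp /hmap_eq Ip].
have tS : two_sided_ideal (ideal_sum (class_ideal (lstate l) (lstate m)) (@esym_ideal n k)).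
  by apply: ideal_sum_two_sided; [exact: class_ideal_two_sided | exact: ideal_gen_two_sided].
apply: (ts_eq tS (y := p)); last by apply: ideal_sumL => //; exact: ideal_gen_two_sided.
by have := Iideal_sub_esym hkn Ip; rewrite /class_ideal pair_class_sym.
Qed.

Definition to_sartori (b : OSBl n k) : sartori HW := qpi WI (hom_of_B0 (projT1 (cid (corner_of_surj b)))).

Lemma to_sartori_corner_of c : to_sartori (corner_of c) = qpi WI (hom_of_B0 c).
Proof.
rewrite /to_sartori; case: cid => c' /= cc'; apply/qpi_eq; rewrite -raddfB; apply: hom_of_B0_W.
by apply/(corner_of_eq0 hkn); rewrite raddfB /= -cc' subrr.
Qed.

Lemma to_sartori_is_zmod : zmod_morphism to_sartori.
Proof.
move=> x y; have [a ->] := corner_of_surj x; have [c ->] := corner_of_surj y.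
by rewrite -raddfB !to_sartori_corner_of !raddfB.
Qed.

Lemma to_sartori_is_monoid : monoid_morphism to_sartori.
Proof.
split=> [|x y]; first by rewrite -corner_of1 to_sartori_corner_of -(rmorph1 (qpi WI)) -hom_of_B0_e; apply/qpi_eq;
  rewrite -raddfB; apply: hom_of_B0_W => l m; rewrite bcoefD bcoefN bcoef_e bcoef1 /left_istate lstate_max andbT subrr;
  exact: (ts0 (class_ideal_two_sided _ _)).
have [a ->] := corner_of_surj x; have [c ->] := corner_of_surj y.
by rewrite corner_ofM !to_sartori_corner_of hom_of_B0M rmorphM.
Qed.

HB.instance Definition _ := GRing.isZmodMorphism.Build (OSBl n k) (sartori HW) to_sartori to_sartori_is_zmod.
HB.instance Definition _ := GRing.isMonoidMorphism.Build (OSBl n k) (sartori HW) to_sartori to_sartori_is_monoid.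

Lemma to_sartori_surj y : exists x, to_sartori x = y.
Proof.
by have [phi ->] := qpi_surj y; have [c ->] := hom_of_B0_surj phi; exists (corner_of c); rewrite to_sartori_corner_of.
Qed.

Lemma to_sartori_esym (i : 'I_k) : to_sartori (OSB_esym n 'X_i) = 0.
Proof.
rewrite to_sartori_corner_of esym_evalX -(raddf0 (qpi WI)); apply/qpi_eq; rewrite subr0 => l m.
apply/(WsubP hkn); exists 0; first exact: (ts0 (class_ideal_two_sided _ _)).
rewrite /hom_of_B0 bcoefZ bcoef1 (inj_eq (@lstate_inj n k)); have [->|_] := eqVneq; last by rewrite mulr0.
apply/hmap_eq; rewrite mulr1 subr0; by apply: mesym_Iideal => //; exact: lstate_max.
Qed.

Lemma to_sartori_ker x :
  to_sartori x = 0 <-> ideal_gen (fun a => exists i : 'I_k, a = OSB_esym n 'X_i) x.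
Proof.
set K := ideal_gen _; have tK : two_sided_ideal K by exact: ideal_gen_two_sided.
split; last first.
  apply: (ideal_gen_min (I := fun u => to_sartori u = 0)) => [|_ [i ->]]; last exact: to_sartori_esym.
  split=> [|u v u0 v0|a u u0|a u u0]; first by rewrite raddf0.
  - by rewrite raddfB /= u0 v0 subr0.
  - by rewrite rmorphM /= u0 mulr0.
  - by rewrite rmorphM /= u0 mul0r.
have [c ->] := corner_of_surj x; rewrite to_sartori_corner_of -(raddf0 (qpi WI)) => /qpi_eq; rewrite subr0 => Wc.
have Kesym p (a : B0) : @esym_ideal n k p -> K (corner_of (p *: a)).
  move=> [s [Gs ->]]; rewrite big_seq scaler_suml raddf_sum; apply: (ts_sum tK) => t /Gs[i ->].
  rewrite /= mulrAC [X in X *: a]mulrC -scalerA corner_ofZ; apply: (tsMr tK).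
  by apply: ideal_gen_incl; exists i; rewrite /OSB_esym esym_evalX.
have fP (u : wseq n k * wseq n k) : exists p, @esym_ideal n k p /\
    class_ideal (lstate u.1) (lstate u.2) (bcoef c (lstate u.1, lstate u.2) - p).
  have [q [p [Jq Ep ->]]] := W_hom_of_B0 u.1 u.2 Wc; exists p; split=> //.
  by rewrite addrK.
have [f fE] := choice fP.
have -> : corner_of c = corner_of (\sum_u f u *: fbasis (lstate u.1) (lstate u.2)).
  apply/eqP; rewrite -subr_eq0 -raddfB; apply/eqP/(corner_of_eq0 hkn) => l m.
  rewrite bcoefD bcoefN bcoef_sum (bigD1 (l, m)) //= bcoef_fbasis !eqxx big1 ?addr0.
    by case: (fE (l, m)).
  move=> [l' m'] ne; rewrite bcoef_fbasis /=.
  by case: ifP => // /andP[/eqP e1 /eqP e2]; move: ne; rewrite e1 e2 eqxx.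
by rewrite raddf_sum; apply: (ts_sum tK) => u _; apply: Kesym; case: (fE u).
Qed.

End Projection.

(** * Gradings *)

Section Filter.
Variable n : nat.
Local Notation R := {mpoly int[n]}.
Implicit Types (P : pred 'X_{1..n}) (p q : R).

Lemma mfilter_is_zmod P : zmod_morphism (mfilter P).
Proof.
move=> p q; apply/mpolyP => m; rewrite mcoeffB !mcoeff_mfilter mcoeffB.
by case: ifP; rewrite ?subrr.
Qed.
HB.instance Definition _ P := GRing.isZmodMorphism.Build R R (mfilter P) (mfilter_is_zmod P).

Lemma mfilterT P p : (forall m, m \in msupp p -> P m) -> mfilter P p = p.
Proof.
move=> pP; apply/mpolyP => m; rewrite mcoeff_mfilter; case: ifPn => // nP.
by apply/esym/memN_msupp_eq0; apply: contra nP; exact: pP.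
Qed.

Lemma mfilterF P p : (forall m, m \in msupp p -> ~~ P m) -> mfilter P p = 0.
Proof.
move=> pP; apply/mpolyP => m; rewrite mcoeff_mfilter mcoeff0; case: ifP => // Pm.
by apply/memN_msupp_eq0; apply: contraL Pm; exact: pP.
Qed.

Lemma mfilterZX P c m : mfilter P (c *: 'X_[m]) = if P m then c *: 'X_[m] else 0.
Proof.
apply/mpolyP => t; rewrite mcoeff_mfilter mcoeffZ mcoeffX.
case: (eqVneq m t) => [->|mt]; first by case: ifP; rewrite ?mcoeff0 // mcoeffZ mcoeffX eqxx.
by rewrite mulr0 if_same; case: ifP; rewrite ?mcoeff0 // mcoeffZ mcoeffX (negPf mt) mulr0.
Qed.

Lemma mfilterXM P m p : mfilter P ('X_[m] * p) = 'X_[m] * mfilter (fun m' => P (m + m')%MM) p.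
Proof.
rewrite [p]mpolyE mulr_sumr !raddf_sum mulr_sumr; apply: eq_bigr => m' _ /=.
rewrite -scalerAr -mpolyXD !mfilterZX; case: ifP; rewrite ?mulr0 //.
by rewrite -scalerAr mpolyXD.
Qed.

(** I_b is generated by homogeneous elements. *)
Lemma Iideal_mfilter (b : 'I_n -> nat) p : Iideal b p ->
  forall Q : pred nat, Iideal b (mfilter (fun m => Q (mdeg m)) p).
Proof.
have tI := Iideal_two_sided b.
have mulI a x : (forall Q : pred nat, Iideal b (mfilter (fun m => Q (mdeg m)) x)) ->
    forall Q : pred nat, Iideal b (mfilter (fun m => Q (mdeg m)) (a * x)).
  move=> Ix Q; rewrite [a]mpolyE mulr_suml raddf_sum; apply: (ts_sum tI) => m _ /=.
  rewrite -mul_mpolyC -mulrA mulrCA mfilterXM; apply: (tsMl tI).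
  rewrite (_ : mfilter _ _ = (a@_m)%:MP * mfilter (fun m' => Q (mdeg m + mdeg m')%N) x).
    by apply: (tsMl tI); exact: (Ix (fun d => Q (mdeg m + d)%N)).
  apply/mpolyP => t; rewrite mcoeffCM !mcoeff_mfilter mcoeffCM mdegD.
  by case: ifP; rewrite ?mulr0.
apply: (ideal_gen_min (I := fun x => forall Q : pred nat,
  Iideal b (mfilter (fun m => Q (mdeg m)) x))) => [|_ [i ->] Q].
  split=> [Q|x y Ix Iy Q|a x Ix|a x Ix]; first by rewrite raddf0; exact: (ts0 tI).
  - by rewrite raddfB; apply: (tsB tI); [exact: Ix | exact: Iy].
  - exact: mulI.
  - by move=> Q; rewrite mulrC; exact: mulI.
case Qb: (Q (b i)).
  by rewrite mfilterT => [|m /hgen_supp[-> _]] //; exact: hgen_Iideal.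
by rewrite mfilterF => [|m /hgen_supp[-> _]]; [exact: (ts0 tI) | rewrite Qb].
Qed.

Lemma colour_ideal_mfilter r c P p : colour_ideal r c p -> colour_ideal r c (mfilter P p).
Proof. by move=> Jp m /msupp_mfilter[_ /Jp]. Qed.

End Filter.

Section Gradings.
Variables n k : nat.
Local Notation R := {mpoly int[n]}.
Local Notation B0 := (B0 n k).
Local Notation e := (left_idem0 n k).
Implicit Types (a c : B0) (x y : istate n k).

Definition bdist x y : nat := (\sum_(i < n) `|vcount x i - vcount y i|)%N.

Definition bdeg (u : istate n k * istate n k) (m : 'X_{1..n}) : int :=
  (2 * mdeg m + bdist u.1 u.2)%N%:Z.

Lemma B0gradingP d a : B0grading d a <->
  forall u m, m \in msupp (bcoef a u) -> bdeg u m = d.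
Proof. by split=> [ga [x y]|ga x y] m; [exact: ga | exact: (ga (x, y))]. Qed.

Lemma B0grading0 d : B0grading d (0 : B0).
Proof. by move=> x y m; rewrite bcoef0 msupp0. Qed.

Lemma B0gradingB d a c : B0grading d a -> B0grading d c -> B0grading d (a - c).
Proof.
by move=> ga gc x y m; rewrite bcoefD bcoefN => /mem_msuppB[/ga|/gc].
Qed.

Lemma gexp_deg x y z :
  (2 * mdeg (gexp x y z) + bdist x z = bdist x y + bdist y z)%N.
Proof.
rewrite mdegE mul2n -addnn -!big_split /=; apply: eq_bigr => i _.
by have := gexp_double x y z i; lia.
Qed.

Lemma B0gradingM d d' a c : B0grading d a -> B0grading d' c -> B0grading (d + d') (a * c).
Proof.
move=> ga gc x z m; rewrite bcoefM => /msupp_sum_le/flatten_mapP[y _].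
case/msupp_mulX => m0 /mem_msuppM[m1 [m2 [/ga <- /gc <- ->]]] ->.
rewrite !mdegD -!/(bdist _ _); have := gexp_deg x y z; lia.
Qed.

Lemma B0grading_e : B0grading 0 e.
Proof.
move=> x y m; rewrite bcoef_e; case: eqP => [->|_]; last by rewrite msupp0.
case: (left_istate y); last by rewrite msupp0.
rewrite msupp1 inE => /eqP->; rewrite mdeg0 big1 // => i _; lia.
Qed.

Lemma OSBlgradingP d (b : OSBl n k) : OSBlgrading d b <-> exists2 c, B0grading d c & b = corner_of c.
Proof.
split=> [[c gc bc]|[c gc ->]]; first by exists c; rewrite ?(corner_of_eq bc).
exists (e * c * e); last exact: corner_of_val.
by rewrite -[d]addr0 -[d]add0r; apply: B0gradingM; [apply: B0gradingM => //|]; exact: B0grading_e.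
Qed.

Definition bcomp (d : int) (c : B0) : B0 :=
  mkB0 (fun u => mfilter (fun m => bdeg u m == d) (bcoef c u)).

Lemma bcomp_grading d c : B0grading d (bcomp d c).
Proof.
apply/B0gradingP => u m; rewrite mkB0E => /msupp_mfilter[/eqP ->].
by [].
Qed.

Lemma sum_mfilter (deg : 'X_{1..n} -> int) (s : seq int) (p : R) : uniq s ->
  (forall m, m \in msupp p -> deg m \in s) ->
  \sum_(d <- s) mfilter (fun m => deg m == d) p = p.
Proof.
move=> us ps; apply/mpolyP => m; rewrite raddf_sum /=.
under eq_bigr => d _ do rewrite mcoeff_mfilter.
have [ms|nms] := boolP (m \in msupp p).
  rewrite (bigD1_seq (deg m)) ?ps //= eqxx big1 ?addr0 // => d dm.
  by rewrite eq_sym (negPf dm).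
by rewrite (memN_msupp_eq0 nms) big1 // => d _; case: ifP.
Qed.

Lemma mfilter_sum (deg : 'X_{1..n} -> int) (s : seq int) (f : int -> R) d : uniq s ->
  (forall d m, m \in msupp (f d) -> deg m = d) -> d \in s ->
  mfilter (fun m => deg m == d) (\sum_(d' <- s) f d') = f d.
Proof.
move=> us fd ds; rewrite raddf_sum (bigD1_seq d) //= mfilterT => [|m /fd -> //].
rewrite big1 ?addr0 // => d' d'd; apply: mfilterF => m /fd ->; exact: d'd.
Qed.

Lemma bcomp_sum c : exists s : seq int, uniq s /\ c = \sum_(d <- s) bcomp d c.
Proof.
pose s := undup (flatten [seq [seq bdeg u m | m <- msupp (bcoef c u)]
                         | u : istate n k * istate n k]).
exists s; split; first exact: undup_uniq.
apply: B0P => u; rewrite bcoef_sum -[LHS](@sum_mfilter (bdeg u) s) ?undup_uniq //.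
  by apply: eq_bigr => d _; rewrite mkB0E.
move=> m um; rewrite mem_undup; apply/flatten_mapP; exists u; first by rewrite mem_enum.
exact: map_f.
Qed.

Hypothesis hkn : (k <= n)%N.

(** Directness holds because the ideals J are monomial. *)
Lemma OSBl_is_grading : grading (@OSBlgrading n k).
Proof.
split.
- by move=> d; apply/OSBlgradingP; exists 0; [exact: B0grading0 | rewrite raddf0].
- move=> d x y /OSBlgradingP[a ga ->] /OSBlgradingP[c gc ->]; apply/OSBlgradingP.
  by exists (a - c); [exact: B0gradingB | rewrite raddfB].
- by exists e; [exact: B0grading_e|].
- move=> d d' x y [a ga xa] [c gc yc]; exists (a * c); first exact: B0gradingM.
  by rewrite rmorphM /= -xa -yc.
- move=> x; have [c ->] := corner_of_surj x; have [s [_ cs]] := bcomp_sum c.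
  exists s, (fun d => corner_of (bcomp d c)); split; last by rewrite -raddf_sum -cs.
  by move=> d; apply/OSBlgradingP; exists (bcomp d c); [exact: bcomp_grading|].
move=> s b us gb sb0 d ds.
have /choice[f fP] d' : exists c, B0grading d' c /\ b d' = corner_of c.
  by have /OSBlgradingP[c gc bc] := gb d'; exists c.
rewrite (fP d).2; apply/(corner_of_eq0 hkn) => l m.
have {}sb0 : corner_of (\sum_(d' <- s) f d') = 0.
  by rewrite raddf_sum -[RHS]sb0; apply: eq_bigr => d' _; rewrite (fP d').2.
move/(corner_of_eq0 hkn)/(_ l m): sb0; rewrite bcoef_sum => Js.
rewrite -(@mfilter_sum (bdeg (lstate l, lstate m)) s (fun d' => bcoef (f d') (lstate l, lstate m)) d us) //.
  exact: colour_ideal_mfilter.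
by move=> d' t; have /B0gradingP := (fP d').1; apply.
Qed.

Lemma mesym_deg r m : m \in msupp (mesym n int r) -> mdeg m = r.
Proof. by rewrite mem_msupp_mesym => /andP[/eqP]. Qed.

Lemma OSB_esym_graded :
  graded_hom (weight_grading (fun i : 'I_k => (2 * i.+1)%N)) (@OSBlgrading n k) (@OSB_esym n k).
Proof.
move=> d s sd; apply/OSBlgradingP; exists (esym_eval n s *: (1 : B0)) => // x y m.
rewrite bcoefZ bcoef1; case: eqP => [->|_]; last by rewrite mulr0 msupp0.
rewrite mulr1 [s]mpolyE raddf_sum /= => /msupp_sum_le/flatten_mapP[t].
rewrite mem_filter /= => tm; rewrite /esym_eval comp_mpolyZ => /msuppZ_le.
rewrite comp_mpolyX -(sd _ tm) => mt.
have -> : mdeg m = (\sum_(i < k) i.+1 * t i)%N.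
  elim: (index_enum _) m mt => [|i r IH] m; first by rewrite !big_nil msupp1 inE => /eqP->; rewrite mdeg0.
  rewrite !big_cons => /mem_msuppM[m1 [m2 [mi /IH e2 ->]]]; rewrite mdegD e2; congr (_ + _)%N.
  move: mi; rewrite tnth_mktuple; elim: (t i) m1 => [|q IHq] m1.
    by rewrite expr0 msupp1 inE muln0 => /eqP->; rewrite mdeg0.
  rewrite exprS => /mem_msuppM[m3 [m4 [/mesym_deg e3 /IHq e4 ->]]].
  by rewrite mdegD e3 e4 mulnS.
rewrite [X in (_ + X)%N]big1 ?addn0 => [|i _]; last by lia.
by rewrite big_distrr /=; congr Posz; apply: eq_bigr => i _; rewrite mulnA.
Qed.

Local Notation HW := (sartoriW_two_sided hkn).
Local Notation bq := (@Defs.bseq n k).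

Definition hdeg (l m : wseq n k) (t : 'X_{1..n}) : int :=
  (2 * mdeg t)%N%:Z - \sum_(i < n) ((bq m i)%:Z - (bq l i)%:Z).

Lemma hdeg_bdeg (l m : wseq n k) t :
  hdeg l m (t + mdiff (state_bseq (lstate l)) (state_bseq (lstate m)))%MM = bdeg (lstate m, lstate l) t.
Proof.
rewrite /hdeg /bdeg mdegD mulnDr (PoszD (2 * mdeg t) (2 * _)) (PoszD (2 * mdeg t) (bdist _ _)).
rewrite -addrA; congr (_ + _); rewrite [mdeg (mdiff _ _)]mdegE big_distrr /bdist !(big_morph Posz PoszD (erefl _)) -sumrB.
by apply: eq_bigr => i _; rewrite !bseq_lstate mnmE /state_bseq /=; lia.
Qed.

Lemma hom_of_B0_graded d c : B0grading d c -> sartori_hom_grading d (hom_of_B0 c).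
Proof.
move=> /B0gradingP gc l m; exists (bcoef c (lstate m, lstate l) * cpoly l m).
  exact: is_map_hmap.
move=> t; rewrite cpolyE mulrC => /msupp_mulX[t' /gc <- ->].
by rewrite -hdeg_bdeg addmC.
Qed.

Lemma to_sartori_graded : graded_hom (@OSBlgrading n k) (sartori_grading (HW := HW)) (to_sartori hkn).
Proof.
move=> d x /OSBlgradingP[c gc ->]; exists (hom_of_B0 c); first exact: hom_of_B0_graded.
exact: to_sartori_corner_of.
Qed.

(** Directness holds because the maps in W are those given by a homogeneous ideal,
    x^c J + I_(b^m), in each component. *)
Lemma sartori_is_grading : grading (sartori_grading (HW := HW)).
Proof.
split.
- move=> d; exists 0; last by rewrite raddf0.
  by move=> l m; exists 0; [exact: is_map0 | move=> t; rewrite msupp0].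
- move=> d _ _ [phi gphi ->] [phi' gphi' ->]; exists (phi - phi'); last by rewrite raddfB.
  move=> l m; have [p pp dp] := gphi l m; have [p' pp' dp'] := gphi' l m.
  by exists (p - p'); [exact: is_mapB | move=> t /mem_msuppB[/dp|/dp']].
- exists (hom_of_B0 e); first by apply: hom_of_B0_graded; exact: B0grading_e.
  by rewrite hom_of_B0_e.
- move=> d d' _ _ [phi gphi ->] [phi' gphi' ->]; exists (phi * phi'); last by rewrite rmorphM.
  move=> l m.
  have /choice[p pP] (o : wseq n k) : exists p, is_map ((phi : hom_ring _) o m) p /\
      forall t, t \in msupp p -> hdeg o m t = d by have [p] := gphi o m; exists p.
  have /choice[q qP] (o : wseq n k) : exists p, is_map ((phi' : hom_ring _) l o) p /\
      forall t, t \in msupp p -> hdeg l o t = d' by have [q] := gphi' l o; exists q.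
  exists (\sum_o p o * q o).
    by apply: is_map_sum => o _; apply: is_map_comp; [case: (qP o) | case: (pP o)].
  move=> t /msupp_sum_le/flatten_mapP[o _] /mem_msuppM[t1 [t2 [/(pP o).2 <- /(qP o).2 <- ->]]].
  rewrite /hdeg mdegD mulnDr PoszD addrACA -opprD -big_split /=; congr (_ - _).
  by apply: eq_bigr => i _; ring.
- move=> y; have [phi ->] := qpi_surj y; have [c ->] := hom_of_B0_surj phi.
  have [s [_ cs]] := bcomp_sum c.
  exists s, (fun d => qpi (TSIdeal HW) (hom_of_B0 (bcomp d c))); split.
    by move=> d; exists (hom_of_B0 (bcomp d c)); [apply: hom_of_B0_graded; exact: bcomp_grading|].
  by rewrite -!raddf_sum -cs.
move=> s b us gb sb0 d ds.
have /choice[f fP] d' : exists phi, sartori_hom_grading d' phi /\ b d' = qpi (TSIdeal HW) phi.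
  by have [phi gphi bphi] := gb d'; exists phi.
rewrite (fP d).2 -(raddf0 (qpi (TSIdeal HW))); apply/qpi_eq; rewrite subr0 => l m.
have : sartoriW (\sum_(d' <- s) f d').
  have /qpi_eq : qpi (TSIdeal HW) (\sum_(d' <- s) f d') = qpi (TSIdeal HW) 0.
    by rewrite raddf0 raddf_sum -[RHS]sb0; apply: eq_bigr => d' _; rewrite (fP d').2.
  by rewrite subr0.
move=> /(_ l m)/(WsubP hkn)[u Ju fu].
have /choice[p pP] d' : exists p, is_map ((f d' : hom_ring _) l m) p /\
    forall t, t \in msupp p -> hdeg l m t = d' by have [p] := (fP d').1 l m; exists p.
have sumE : ((\sum_(d' <- s) f d' : sartori_hom n k) : hom_ring _) l m = \sum_(d' <- s) (f d' : hom_ring _) l m.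
  by elim/big_rec2: _ => // d' phi1 phi2 _ <-.
have : is_map (((\sum_(d' <- s) f d' : sartori_hom n k) : hom_ring _) l m) (\sum_(d' <- s) p d').
  by rewrite sumE; apply: is_map_sum => d' _; case: (pP d').
rewrite fu => /(is_map_eq _ (is_map_hmap l m u)) Iu.
have {}Iu := Iideal_mfilter Iu (fun q => (2 * q)%N%:Z - \sum_(i < n) ((bq m i)%:Z - (bq l i)%:Z) == d).
rewrite raddfB /= (@mfilter_sum (hdeg l m)) // in Iu; last by move=> d' t; case: (pP d') => _; apply.
rewrite cpolyE mulrC mfilterXM mulrC -cpolyE in Iu.
apply/(WsubP hkn); exists (mfilter (fun t => hdeg l m (mdiff (state_bseq (lstate l)) (state_bseq (lstate m)) + t)%MM == d) u).
  exact: colour_ideal_mfilter.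
apply: (is_map_inj (p := p d)); first by case: (pP d).
by apply/(is_map_eq _ (is_map_hmap _ _ _)).
Qed.

End Gradings.

Theorem theorem1p1 (n k : nat) (hkn : (k <= n)%N) :
  exists (HW : two_sided_ideal (@sartoriW n k))
         (j : {rmorphism {mpoly int[k]} -> OSBl n k})
         (pi : {rmorphism OSBl n k -> sartori HW}),
    [/\ forall i : 'I_k, j 'X_i = esymU n k i.+1,
        graded_deformation (fun i : 'I_k => (2 * i.+1)%N)
          (@OSBlgrading n k) (@sartori_grading n k HW) j pi
      & flat (via j)].
Proof.
exists (sartoriW_two_sided hkn), (@OSB_esym n k), (to_sartori hkn); split.
- exact: OSB_esymX.
- split; [exact: OSBl_is_grading | exact: sartori_is_grading | exact: OSB_esym_graded
         | exact: to_sartori_graded | | exact: to_sartori_surj | exact: to_sartori_ker].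
  by move=> s x; have [c ->] := corner_of_surj x; exact: corner_of_central.
- exact: OSB_esym_flat.
Qed.
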